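(* A non-symmetric left-invariant Riemannian metric on $\mathbb{R}\ltimes\mathbb{R}^3$ is $\mathcal{F}_t$-critical (for $t\in\mathbb{R}$) if and only if one of the following holds, where each listed left-invariant metric is given by its non-zero Lie brackets in an orthonormal basis $\{e_1,e_2,e_3,e_4\}$ of the Lie algebra, with $t$ as indicated (the stated value of the energy $\mathcal{E}_t$ is that of the listed metric): (a) The functional has zero energy ($\mathcal{E}_t=0$) and the metric is homothetic to a left-invariant metric determined by one of the following: (1) $[e_1,e_4]=e_1+e_3$, $[e_3,e_4]=-(e_1+e_3)$. In this case $t=-3$. (2) $[e_1,e_4]=e_1+\frac{1}{\sqrt2}e_3$, $[e_2,e_4]=-e_2+\frac{1}{\sqrt2}e_3$, $[e_3,e_4]=-\frac{1}{\sqrt2}(e_1+e_2)$. In this case $t=-\frac32$. (3) $[e_1,e_4]=e_1$, $[e_2,e_4]=fe_2$, $[e_3,e_4]=pe_3$, where $(f,p)\in\{(f,p)\in\mathbb{R}^2;\ -1\leq f\leq p\leq1\}\setminus\{(-1,p);\ -1\leq p<0\}$ and $(f,p)\notin\{(0,0),(0,1),(1,1)\}$. In this case $t=-\frac{f^2+p^2+1}{2(f^2+p^2+fp+f+p+1)}$. (4) $[e_1,e_4]=e_1$, $[e_2,e_4]=-(\kappa+\frac12)e_2+he_3$, $[e_3,e_4]=-he_2+(\kappa-\frac12)e_3$, with $\kappa\in(\frac{\sqrt3}{2},+\infty)$. For a fixed $\kappa$, the parameter $h$ is the only positive solution of $h^2(4\kappa^2-3)-\kappa^2(4\kappa^2+3)=0$.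 In this case $t=-\frac{48\kappa^4-9}{16\kappa^4-9}$. (5) $[e_1,e_4]=e_1+ce_3$, $[e_2,e_4]=-(p+1)e_2+he_3$, $[e_3,e_4]=-ce_1-he_2+pe_3$, with $p\in(\zeta,-1)\cup(\frac{1-\sqrt{21}}{10},0)$, where $\zeta=-1.697464\dots$ is the only real solution of $8p^3+15p^2+3p+1=0$. For a fixed $p$, the parameters $c$ and $h$ are the only positive solutions of $$c^2(p+2)(5p^2-p-1)+(2p+1)(8p^3+15p^2+3p+1)=0,$$ $$h^2(p+2)(5p^2-p-1)-(p+1)(p-1)(5p^3+12p^2+1)=0.$$ In this case $t=-\frac{30p^4-3p^2-6p-3}{2(p^2+p+1)(5p^2-p-1)}$. (b) The energy of the functional is non-zero and the metric is homothetic to one of the following: (6) $[e_1,e_4]=\frac13e_1$, $[e_2,e_4]=fe_2+he_3$, $[e_3,e_4]=-he_2-(f-\frac23)e_3$, with $h\in(0,+\infty)$. For a fixed $h$, the parameter $f$ is the only positive solution of $36(f^2-h^2)-24f-5=0$. In this case $t=-\frac{36h^2+5}{12h^2+11}$ and $\mathcal{E}_t=-\frac{16}{3}h^2$. (7) $[e_1,e_4]=ae_1+be_2$, $[e_2,e_4]=-be_1+\frac13e_2+be_3$, $[e_3,e_4]=-be_2-(a-\frac23)e_3$, with $b\in(0,+\infty)$. For a fixed $b$, the parameter $a$ is the only positive solution of $9a^2-18b^2-6a-8=0$. In this case $t=-\frac{18b^2+7}{12b^2+10}$ and $\mathcal{E}_t=-\frac83b^2$. Moreover, the metrics in (1)--(3)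 are algebraic Ricci solitons, while the metrics in (4)--(7) are not.
   Context: **Critical metrics and energy.** On a homogeneous Riemannian $4$-manifold $(M,g)$ let $R$ be the curvature tensor, $\rho$ the Ricci tensor and $\tau$ the scalar curvature. For $t\in\mathbb{R}$ let $\mathcal{F}_t(g)=\int_M\{\|\rho\|^2+t\tau^2\}\,\mathrm{dvol}_g$. A homogeneous metric is called $\mathcal{F}_t$-critical if it satisfies the Euler-Lagrange equation of $\mathcal{F}_t$ for variations of constant volume, which in the homogeneous four-dimensional case is $$-\Delta\rho+\tfrac12(\|\rho\|^2+t\tau^2)g-2R[\rho]-2t\tau\rho=0,$$ where $\Delta\rho$ is the rough Laplacian (trace of $\nabla^2\rho$), and $R[\rho]_{ij}=R_{ikj\ell}\rho^{k\ell}$, with sign convention such that $R_{ikj\ell}g^{k\ell}=\rho_{ij}$. The energy is $\mathcal{E}_t=\|\rho\|^2+t\tau^2$. The equation is invariant under homotheties. **Groups.** $\mathbb{R}\ltimes\mathbb{R}^3$ denotes any simply connected Lie group whose Lie algebra is a semi-direct extension $\mathbb{R}\ltimes\mathfrak{r}^3$ of the three-dimensional Abelian Lie algebra $\mathfrak{r}^3$ by a derivation (an arbitrary element of $\mathfrak{gl}(3,\mathbb{R})$). **Terminology.** ''Non-symmetric'' means not locally symmetric. Homotheties need not preserve the group structure. A Lie group with left-invariant metric is an algebraic Ricci soliton if its Ricci operator satisfies $\mathrm{Ric}=\lambda\,\mathrm{Id}+\mathfrak{D}$ for some $\lambda\in\mathbb{R}$ and some derivation $\mathfrak{D}$ of the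 Lie algebra. Brackets of basis elements not listed (up to antisymmetry) are zero. *)

(* Defs.v *)
From HB Require Import structures.
From mathcomp Require Import all_boot all_order all_algebra.
From mathcomp Require Import all_classical all_reals all_analysis.

Set Implicit Arguments.
Unset Strict Implicit.
Unset Printing Implicit Defensive.

Import Order.TTheory GRing.Theory Num.Theory.
Import numFieldNormedType.Exports.

Local Open Scope ring_scope.

(* Over an arbitrary MathComp-Analysis [R : realType].

   All vectors are row vectors and matrices act on them from the right.  The
   Lie algebra R |x r^3 has underlying space 'rV[R]_4: the first three
   coordinates are the Abelian ideal r^3, and the last basis vector e_4 acts on
   r^3 by the derivation [v |-> v *m D], i.e. row i of D is [e_4, e_i].        *)

Record left_inv_metric (R : realType) := LeftInvMetric {
  der : 'M[R]_3;
  gram : 'M[R]_4;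
  gram_sym : gram^T = gram;
  gram_pos : forall x : 'rV[R]_4, x != 0 -> 0 < (x *m gram *m x^T) 0 0
}.

Section LieAlgebra.
Context {R : realType} (g : left_inv_metric R).
Implicit Types (x y z u v w : 'rV[R]_4) (b : 'rV[R]_4 -> 'rV[R]_4 -> R).

Definition ip x y : R := (x *m gram g *m y^T) 0 0.

Definition e_ (i : 'I_4) : 'rV[R]_4 := delta_mx 0 i.

Definition ad4 : 'M[R]_4 := (block_mx (der g) 0 0 0 : 'M[R]_(3 + 1)).

Definition lie x y : 'rV[R]_4 :=
  x 0 ord_max *: (y *m ad4) - y 0 ord_max *: (x *m ad4).

(* Levi-Civita connection on left-invariant fields: [nabla x y] is the vector
   whose inner product with every z is [koszul x y z].                         *)
Definition koszul x y z : R :=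
  (ip (lie x y) z - ip (lie y z) x + ip (lie z x) y) / 2.

Definition ginv : 'M[R]_4 := invmx (gram g).

Definition nabla x y : 'rV[R]_4 := (\row_k koszul x y (e_ k)) *m ginv.

Definition curv x y z : 'rV[R]_4 :=
  nabla x (nabla y z) - nabla y (nabla x z) - nabla (lie x y) z.

(* The sign is such that [Riem x y x y] is a positive multiple of the sectional
   curvature, so that R_{ikjl} g^{kl} is the Ricci tensor.                     *)
Definition Riem x y z w : R := ip (curv x y w) z.

Definition ricci x y : R :=
  \sum_(k < 4) \sum_(l < 4) ginv k l * Riem x (e_ k) y (e_ l).

Definition ricci_mx : 'M[R]_4 := \matrix_(i, j) ricci (e_ i) (e_ j).

(* [ip (x *m Ric) y = ricci x y] *)
Definition Ric : 'M[R]_4 := ricci_mx *m ginv.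

Definition scal : R := \tr Ric.

Definition ricci_norm2 : R := \tr (Ric *m Ric).

Definition energy (t : R) : R := ricci_norm2 + t * scal ^+ 2.

(* Covariant derivatives of a left-invariant bilinear form b:
   [cov b w] is nabla_w b and [cov2 b x w] is nabla^2_{x,w} b.                 *)
Definition cov b w y z : R := - b (nabla w y) z - b y (nabla w z).

Definition cov2 b x w y z : R :=
  cov (cov b w) x y z - cov b (nabla x w) y z.

Definition rough_laplacian b y z : R :=
  \sum_(i < 4) \sum_(j < 4) ginv i j * cov2 b (e_ i) (e_ j) y z.

Definition Riem_ricci x y : R :=
  \sum_(k < 4) \sum_(l < 4)
    Riem x (e_ k) y (e_ l) * (ginv *m ricci_mx *m ginv) k l.

Definition critical (t : R) : Prop := forall x y,
  - rough_laplacian ricci x y + energy t / 2 * ip x y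
  - 2 * Riem_ricci x y - 2 * t * scal * ricci x y = 0.

Definition locally_symmetric : Prop := forall v x y z,
  nabla v (curv x y z) - curv (nabla v x) y z - curv x (nabla v y) z
  - curv x y (nabla v z) = 0.

Definition derivation (P : 'M[R]_4) : Prop := forall x y,
  lie x y *m P = lie (x *m P) y + lie x (y *m P).

Definition algebraic_soliton : Prop :=
  exists (lambda : R) (P : 'M[R]_4), derivation P /\ Ric = lambda%:M + P.

End LieAlgebra.

Section Homothety.
Context {R : realType}.

Definition expmx (A : 'M[R]_3) : 'M[R]_3 :=
  limn (fun n : nat => \sum_(k < n) (k`!%:R)^-1 *: A ^+ k : 'M[R]_3).

(* The simply connected group is R^4 with product
     (x, s) (y, t) = (x + y *m expmx (s *: D), s + t),
   so left translation by (x, s) has constant differential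
   [dtransl g s], and left translation by (x, s)^-1 has differential
   [dtransl g (- s)].                                                          *)
Definition dtransl (g : left_inv_metric R) (s : R) : 'M[R]_4 :=
  (block_mx (expmx (s *: der g)) 0 0 1%:M : 'M[R]_(3 + 1)).

Definition metric_at (g : left_inv_metric R) (p u v : 'rV[R]_4) : R :=
  ip g (u *m dtransl g (- p 0 ord_max)) (v *m dtransl g (- p 0 ord_max)).

Fixpoint class_C (k : nat) (f : 'rV[R]_4 -> 'rV[R]_4) : Prop :=
  if k is k'.+1 then
    (forall p, differentiable f p) /\
    (forall v, class_C k' (fun p => 'd f p v))
  else continuous f.

Definition smooth (f : 'rV[R]_4 -> 'rV[R]_4) : Prop := forall k, class_C k f.

Definition homothetic (g g' : left_inv_metric R) : Prop :=
  exists (phi psi : 'rV[R]_4 -> 'rV[R]_4) (c : R),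
    [/\ smooth phi, smooth psi, cancel phi psi & cancel psi phi] /\
    0 < c /\
    forall p u v : 'rV[R]_4,
      metric_at g' (phi p) ('d phi p u) ('d phi p v) = c * metric_at g p u v.

End Homothety.

Section ListedMetrics.
Context {R : realType}.
Implicit Types (t f p h c k a b : R).

Lemma gram1_pos (x : 'rV[R]_4) : x != 0 -> 0 < (x *m 1%:M *m x^T) 0 0.
Proof.
move=> x0; rewrite mulmx1 mxE lt0r; apply/andP; split; last first.
  by apply: sumr_ge0 => i _; rewrite mxE -expr2 sqr_ge0.
apply: contra x0; rewrite psumr_eq0 => [|i _]; last by rewrite mxE -expr2 sqr_ge0.
move=> /allP x0; apply/eqP/rowP => i.
by have := x0 i (mem_index_enum i); rewrite !mxE -expr2 sqrf_eq0 => /eqP.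
Qed.

(* The metric making e_1, ..., e_4 orthonormal on the Lie algebra with
     [e_i, e_4] = m_i1 e_1 + m_i2 e_2 + m_i3 e_3    (i = 1, 2, 3),
   where the rows of m are given as lists; hence the sign in [der].            *)
Definition brackets (m : seq (seq R)) : left_inv_metric R :=
  LeftInvMetric (- \matrix_(i < 3, j < 3) nth 0 (nth [::] m i) j)
    (trmx1 _ 4) gram1_pos.

Definition metric1 := brackets
  [:: [:: 1; 0; 1];
      [:: 0; 0; 0];
      [:: -1; 0; -1]].

Definition metric2 := brackets
  [:: [:: 1; 0; 1 / Num.sqrt 2];
      [:: 0; -1; 1 / Num.sqrt 2];
      [:: - (1 / Num.sqrt 2); - (1 / Num.sqrt 2); 0]].

Definition metric3 f p := brackets
  [:: [:: 1; 0; 0];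
      [:: 0; f; 0];
      [:: 0; 0; p]].

Definition param3 f p : Prop :=
  -1 <= f <= p /\ p <= 1 /\ ~ (f = -1 /\ -1 <= p < 0) /\
  (f, p) <> (0, 0) /\ (f, p) <> (0, 1) /\ (f, p) <> (1, 1).

Definition t3 f p : R :=
  - ((f ^+ 2 + p ^+ 2 + 1) / (2 * (f ^+ 2 + p ^+ 2 + f * p + f + p + 1))).

Definition metric4 k h := brackets
  [:: [:: 1; 0; 0];
      [:: 0; - (k + 1 / 2); h];
      [:: 0; - h; k - 1 / 2]].

Definition range4 k : Prop := Num.sqrt 3 / 2 < k.

Definition eqn4 k h : Prop :=
  h ^+ 2 * (4 * k ^+ 2 - 3) - k ^+ 2 * (4 * k ^+ 2 + 3) = 0.

Definition param4 k h : Prop := range4 k /\ 0 < h /\ eqn4 k h.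

Definition t4 k : R := - ((48 * k ^+ 4 - 9) / (16 * k ^+ 4 - 9)).

Definition metric5 p c h := brackets
  [:: [:: 1; 0; c];
      [:: 0; - (p + 1); h];
      [:: - c; - h; p]].

Definition cubic5 p : R := 8 * p ^+ 3 + 15 * p ^+ 2 + 3 * p + 1.

Definition range5 p : Prop :=
  (exists zeta : R, cubic5 zeta = 0 /\ zeta < p < -1) \/
  (1 - Num.sqrt 21) / 10 < p < 0.

Definition eqn5c p c : Prop :=
  c ^+ 2 * (p + 2) * (5 * p ^+ 2 - p - 1) + (2 * p + 1) * cubic5 p = 0.

Definition eqn5h p h : Prop :=
  h ^+ 2 * (p + 2) * (5 * p ^+ 2 - p - 1)
  - (p + 1) * (p - 1) * (5 * p ^+ 3 + 12 * p ^+ 2 + 1) = 0.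

Definition param5 p c h : Prop :=
  range5 p /\ (0 < c /\ eqn5c p c) /\ (0 < h /\ eqn5h p h).

Definition t5 p : R :=
  - ((30 * p ^+ 4 - 3 * p ^+ 2 - 6 * p - 3)
     / (2 * (p ^+ 2 + p + 1) * (5 * p ^+ 2 - p - 1))).

Definition metric6 h f := brackets
  [:: [:: 1 / 3; 0; 0];
      [:: 0; f; h];
      [:: 0; - h; - (f - 2 / 3)]].

Definition eqn6 h f : Prop := 36 * (f ^+ 2 - h ^+ 2) - 24 * f - 5 = 0.

Definition param6 h f : Prop := 0 < h /\ 0 < f /\ eqn6 h f.

Definition t6 h : R := - ((36 * h ^+ 2 + 5) / (12 * h ^+ 2 + 11)).

Definition metric7 b a := brackets
  [:: [:: a; b; 0];
      [:: - b; 1 / 3; b];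
      [:: 0; - b; - (a - 2 / 3)]].

Definition eqn7 b a : Prop := 9 * a ^+ 2 - 18 * b ^+ 2 - 6 * a - 8 = 0.

Definition param7 b a : Prop := 0 < b /\ 0 < a /\ eqn7 b a.

Definition t7 b : R := - ((18 * b ^+ 2 + 7) / (12 * b ^+ 2 + 10)).

Definition listed1 t (g : left_inv_metric R) : Prop := t = -3 /\ g = metric1.

Definition listed2 t (g : left_inv_metric R) : Prop :=
  t = - (3 / 2) /\ g = metric2.

Definition listed3 t (g : left_inv_metric R) : Prop :=
  exists f p, [/\ param3 f p, t = t3 f p & g = metric3 f p].

Definition listed4 t (g : left_inv_metric R) : Prop :=
  exists k h, [/\ param4 k h, t = t4 k & g = metric4 k h].

Definition listed5 t (g : left_inv_metric R) : Prop :=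
  exists p c h, [/\ param5 p c h, t = t5 p & g = metric5 p c h].

Definition listed6 t (g : left_inv_metric R) : Prop :=
  exists h f, [/\ param6 h f, t = t6 h & g = metric6 h f].

Definition listed7 t (g : left_inv_metric R) : Prop :=
  exists b a, [/\ param7 b a, t = t7 b & g = metric7 b a].

Definition listed_a t (g : left_inv_metric R) : Prop :=
  listed1 t g \/ listed2 t g \/ listed3 t g \/ listed4 t g \/ listed5 t g.

Definition listed_b t (g : left_inv_metric R) : Prop :=
  listed6 t g \/ listed7 t g.

End ListedMetrics.

(* Main.v *)
(* In an orthonormal basis adapted to the Abelian ideal, the derivation is
   S + A with S = diag(x1, x2, x3) and A skew with entries u1, u2, u3. If S and
   A commute, then rotating the ideal by exp(s A) at time s is an isometry onto
   the metric with A = 0. Put K = [A, S], T = tr S, s = |S|^2, tau = -(T^2 + s)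
   and m = s - t tau. Criticality becomes
     m (T^2 - 3 s) = 3 |K|^2,
     - [A, [A, K]] + [S, [S, K]] + 2 T [A, K] + (2 m - T^2) K = 2 m T S0,
   with S0 the trace-free part of S. For K = 0 this leaves (3). For T = 0 the
   diagonal part gives u1 u2 u3 = 0; if only one u_i is left, one gets (1) or
   (4), and if two are left, m and the u_i^2 solve a linear system, which gives
   (2) and (5). For T <> 0, pairing with L = [A, K] gives |L - m S0| = 0, and
   then (6) and (7). The first equation determines m, hence t, once T^2 <> 3 s.
   Conversely the listed metrics solve the system, and homotheties preserve
   criticality because the left-invariant tensors are natural: a homothety
   intertwines the frames of left-invariant fields through a matrix-valued
   function, and Schwarz's theorem makes it compatible with the connections. *)

Require Import Defs.
From HB Require Import structures.
From mathcomp Require Import all_boot all_order all_algebra.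
From mathcomp Require Import all_classical all_reals all_analysis.
From mathcomp Require Import ring lra.

Set Implicit Arguments.
Unset Strict Implicit.
Unset Printing Implicit Defensive.

Import Order.TTheory GRing.Theory Num.Theory.
Import numFieldNormedType.Exports.

Local Open Scope ring_scope.

(** * The matrix exponential *)

(** Homotheties need not respect the group structure, so their invariants cannot be compared through
    structure constants. The differential is instead read in the two left-invariant frames. The
    discrepancy between the two connections is then symmetric in one pair of arguments and skew in
    another, hence zero; this is uniqueness of the Levi-Civita connection. Invariance serves both
    directions: it also lets criticality of an arbitrary metric be tested on an orthonormal model.
    The unknown t enters only through m. The equality T^2 = 3 s forces S to be scalar, which is the
    flat or hyperbolic case. The energy of a critical metric is 4/3 m T^2, so zero energy means T =
    0 or m = 0; this is the division between (a) and (b). For T = 0 an eigenvalue is scaled to 1,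
    and the rational functions of p in (5) come from Cramer's rule. For T <> 0 the trace is scaled
    to 1; vanishing of the off-diagonal part of L - m S0 then forces either an eigenvalue equal to
    the mean 1/3 or at most one non-zero u_i, which explains the constants 1/3 and 2/3 of (6) and
    (7). *)

Lemma cvgn_sum (R : realType) (V : normedModType R) (I : Type) (r : seq I)
    (u : I -> nat -> V) (l : I -> V) :
  (forall i, (u i) @ \oo --> l i)%classic ->
  ((fun k => \sum_(i <- r) u i k) @ \oo --> \sum_(i <- r) l i)%classic.
Proof.
move=> ul; elim: r => [|i r IH].
  rewrite big_nil; under eq_fun do rewrite big_nil; exact: cvg_cst.
rewrite big_cons; under eq_fun do rewrite big_cons; exact: cvgD.
Qed.

Section MatrixExponential.
Context {R : realType} {n : nat}.
Implicit Types (M N Q : 'M[R]_n.+1) (s x : R).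

Definition exp_entry_coef M i j k : R := (k`!%:R)^-1 * (M ^+ k) i j.

(** Defined entry by entry, so that termwise differentiation of scalar power series applies;
    [expmxE] identifies it with the matrix limit. *)
Definition emx M s : 'M[R]_n.+1 :=
  \matrix_(i, j) limn (pseries (exp_entry_coef M i j) s).

(** Gives domination by a scalar exponential series. The factor [n.+1] in the witness pays for the
    number of terms in each entry of a product. *)
Lemma mx_entry_bound M : exists2 C : R, 0 <= C &
  forall k i j, `|(M ^+ k) i j| <= C ^+ k.
Proof.
pose B := \sum_i \sum_j `|M i j|.
have B0 : 0 <= B by apply: sumr_ge0 => i _; apply: sumr_ge0.
have MB i j : `|M i j| <= B.
  rewrite /B (bigD1 i) //= (bigD1 j) //= -addrA lerDl addr_ge0 //.
    by apply: sumr_ge0.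
  by apply: sumr_ge0 => a _; apply: sumr_ge0.
exists (B *+ n.+1); first exact: mulrn_wge0.
elim=> [|k IH] i j.
  by rewrite !expr0 mxE; case: eqP; rewrite ?normr1 ?normr0.
rewrite exprS mxE (le_trans (ler_norm_sum _ _ _)) //.
apply: (@le_trans _ _ (\sum_(l < n.+1) B * (B *+ n.+1) ^+ k)).
  by apply: ler_sum => l _; rewrite normrM ler_pM.
by rewrite sumr_const card_ord exprS mulrnAl.
Qed.

Lemma cvg_exp_entry M i j s : cvgn (pseries (exp_entry_coef M i j) s).
Proof.
have [C C0 hC] := mx_entry_bound M.
apply: normed_cvg.
apply: (@series_le_cvg _ _ (exp_coeff (C * `|s|))) => [k|k|k|].
- exact: normr_ge0.
- by rewrite /exp_coeff /= divr_ge0 // exprn_ge0 // mulr_ge0.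
- rewrite /exp_coeff /= /exp_entry_coef !normrM normrX ger0_norm ?invr_ge0 //.
  rewrite exprMn [leRHS]mulrC -mulrA ler_wpM2l ?invr_ge0 //.
  by rewrite ler_wpM2r // exprn_ge0.
exact: is_cvg_series_exp_coeff.
Qed.

Lemma pseries_diffs_exp_entry M i j :
  pseries_diffs (exp_entry_coef M i j) =
  (fun k => (k`!%:R)^-1 * (M ^+ k.+1) i j).
Proof.
by apply/funext => k; rewrite /pseries_diffs /exp_entry_coef mulrA factS natrM
  invfM mulVKf.
Qed.

Lemma series_expSr M i j s k :
  pseries (fun k => (k`!%:R)^-1 * (M ^+ k.+1) i j) s k =
  \sum_l pseries (exp_entry_coef M i l) s k * M l j.
Proof.
rewrite /pseries /series /=.
under [RHS]eq_bigr do rewrite mulr_suml.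
rewrite exchange_big /=; apply: eq_bigr => a _.
rewrite exprSr mxE mulr_sumr mulr_suml; apply: eq_bigr => l _.
by rewrite /exp_entry_coef -!mulrA; congr (_ * (_ * _)); rewrite mulrC.
Qed.

Lemma series_expSl M i j s k :
  pseries (fun k => (k`!%:R)^-1 * (M ^+ k.+1) i j) s k =
  \sum_l M i l * pseries (exp_entry_coef M l j) s k.
Proof.
rewrite /pseries /series /=.
under [RHS]eq_bigr do rewrite mulr_sumr.
rewrite exchange_big /=; apply: eq_bigr => a _.
rewrite exprS mxE mulr_sumr mulr_suml; apply: eq_bigr => l _.
by rewrite /exp_entry_coef !mulrA; congr (_ * _ * _); rewrite mulrC.
Qed.

Lemma cvg_expSr M i j s :
  (pseries (fun k => (k`!%:R)^-1 * (M ^+ k.+1) i j) s @ \oo -->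
   (emx M s *m M) i j)%classic.
Proof.
rewrite (funext (series_expSr M i j s)).
rewrite mxE; apply: cvgn_sum => l; apply: cvgMr_tmp; rewrite mxE.
exact: cvg_exp_entry.
Qed.

Lemma cvg_expSl M i j s :
  (pseries (fun k => (k`!%:R)^-1 * (M ^+ k.+1) i j) s @ \oo -->
   (M *m emx M s) i j)%classic.
Proof.
rewrite (funext (series_expSl M i j s)).
rewrite mxE; apply: cvgn_sum => l; apply: cvgMl_tmp; rewrite mxE.
exact: cvg_exp_entry.
Qed.

Lemma emx_comm M s : emx M s *m M = M *m emx M s.
Proof.
apply/matrixP => i j; rewrite -(cvg_lim _ (@cvg_expSr M i j s)) //.
by apply/cvg_lim => //; exact: cvg_expSl.
Qed.

Lemma is_derive_emx M i j s :
  is_derive s (1 : R) (fun s => emx M s i j) ((M *m emx M s) i j).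
Proof.
have -> : (fun s => emx M s i j) =
          (fun s => limn (pseries (exp_entry_coef M i j) s)).
  by apply/funext => x; rewrite mxE.
(* Termwise differentiation asks for convergence of the series and of its first two formal
   derivatives at a point beyond s, taken to be |s| + 1. Factoring [M ^+ m] out of the power writes
   a shifted series as a finite combination of convergent ones. *)
have cS m K : cvgn (pseries (fun k => (k`!%:R)^-1 * (M ^+ (k + m)) i j) K).
  elim: m => [|m IH] in K *.
    by under [X in pseries X]eq_fun do rewrite addn0; exact: cvg_exp_entry.
  have -> : (fun k => (k`!%:R)^-1 * (M ^+ (k + m.+1)) i j) =
            (fun k => (k`!%:R)^-1 * ((M ^+ m * M ^+ k.+1) i j) : R).
    by apply/funext => k; rewrite -exprD addnC addSnnS.
  have -> : pseries (fun k => (k`!%:R)^-1 * ((M ^+ m * M ^+ k.+1) i j)) K =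
     (fun p => \sum_l (M ^+ m) i l *
         pseries (fun k => (k`!%:R)^-1 * (M ^+ k.+1) l j) K p).
    apply/funext => p; rewrite /pseries /series /=.
    under [RHS]eq_bigr do rewrite mulr_sumr.
    rewrite exchange_big /=; apply: eq_bigr => a _.
    rewrite mxE mulr_sumr mulr_suml; apply: eq_bigr => l _; ring.
  apply/cvg_ex; eexists; apply: cvgn_sum => l; apply: cvgMl_tmp.
  exact: cvg_expSl.
have -> : (M *m emx M s) i j =
    limn (pseries (pseries_diffs (exp_entry_coef M i j)) s).
  rewrite pseries_diffs_exp_entry; apply/esym/cvg_lim => //; exact: cvg_expSl.
have d2 : pseries_diffs (pseries_diffs (exp_entry_coef M i j)) =
    (fun k => (k`!%:R)^-1 * (M ^+ (k + 2)) i j).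
  rewrite pseries_diffs_exp_entry; apply/funext => k.
  by rewrite /pseries_diffs mulrA factS natrM invfM mulVKf // addn2.
apply: (@pseries_snd_diffs _ _ (`|s| + 1)).
- exact: cvg_exp_entry.
- by rewrite pseries_diffs_exp_entry; apply/cvg_ex; eexists; exact: cvg_expSl.
- by rewrite d2.
- by rewrite [ltRHS]ger0_norm ?ltrDl // addr_ge0.
Qed.

Lemma emx0 M : emx M 0 = 1%:M.
Proof.
apply/matrixP => i j; rewrite !mxE; apply/cvg_lim => //.
rewrite -(@cvg_shiftS _ _ (nbhs ((i == j)%:R : R))) /=.
rewrite (_ : (fun k => _) = cst ((i == j)%:R)); first exact: cvg_cst.
apply/funext => k; rewrite /pseries /series /= big_nat_recl //= big1 ?addr0.
  by rewrite /exp_entry_coef fact0 invr1 mul1r expr0 mulr1 mxE.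
by move=> l _; rewrite expr0n /= mulr0.
Qed.

End MatrixExponential.

Section MatrixDerivative.
Context {R : realType}.

Definition mx_derive m n (F F' : R -> 'M[R]_(m, n)) : Prop :=
  forall s i j, is_derive s (1 : R) (fun s => F s i j) (F' s i j).

Lemma mx_derive_cst m n (A : 'M[R]_(m, n)) : mx_derive (fun=> A) (fun=> 0).
Proof. by move=> s i j; rewrite mxE; exact: is_derive_cst. Qed.

Lemma mx_deriveM m n p (F F' : R -> 'M[R]_(m, n)) (G G' : R -> 'M[R]_(n, p)) :
  mx_derive F F' -> mx_derive G G' ->
  mx_derive (fun s => F s *m G s) (fun s => F' s *m G s + F s *m G' s).
Proof.
move=> dF dG s i j.
have -> : (fun s => (F s *m G s) i j) =
    \sum_(l < n) (fun s => F s i l) * (fun s => G s l j).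
  by apply/funext => x; rewrite mxE fct_sumE.
apply: is_derive_eq; first by apply: is_derive_sum => l; exact: is_deriveM.
rewrite !mxE -big_split /=; apply: eq_bigr => l _.
by rewrite addrC /GRing.scale /= [_ * F' _ _ _]mulrC.
Qed.

Lemma mx_derive_scale m n (F F' : R -> 'M[R]_(m, n)) (a : R) :
  mx_derive F F' -> mx_derive (fun s => F (a * s)) (fun s => a *: F' (a * s)).
Proof.
move=> dF s i j; rewrite mxE.
have da : is_derive s (1 : R) (fun s => a * s) a.
  rewrite (_ : (fun s => a * s) = a *: (@id R)) //.
  by apply: is_derive_eq; rewrite /GRing.scale /= mulr1.
by apply: is_derive_eq (is_derive1_comp (dF (a * s) i j) da) _; rewrite mulrC.
Qed.

Lemma mx_derive0_cst m n (F : R -> 'M[R]_(m, n)) :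
  mx_derive F (fun=> 0) -> forall s, F s = F 0.
Proof.
move=> dF s; apply/matrixP => i j.
apply: (@is_derive_0_is_cst _ (fun s => F s i j)) => x.
by have := dF x i j; rewrite mxE.
Qed.

Lemma mx_derive_eq m n (F F' F'' : R -> 'M[R]_(m, n)) :
  mx_derive F F' -> F' =1 F'' -> mx_derive F F''.
Proof. by move=> dF e s i j; rewrite -e. Qed.

Context {n : nat}.
Implicit Types (M N Q : 'M[R]_n.+1) (s x : R).

Lemma mx_derive_emx M : mx_derive (emx M) (fun s => M *m emx M s).
Proof. by move=> s i j; exact: is_derive_emx. Qed.

Lemma mx_derive_emxa M a :
  mx_derive (fun s => emx M (a * s)) (fun s => a *: (M *m emx M (a * s))).
Proof. exact: (mx_derive_scale (F := emx M) a (mx_derive_emx M)). Qed.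

Lemma emxNK M s : emx M (- s) *m emx M s = 1%:M.
Proof.
have d : mx_derive (fun x => emx M (-1 * x) *m emx M x) (fun=> 0).
  apply: mx_derive_eq (mx_deriveM (mx_derive_emxa M (-1)) (mx_derive_emx M)) _.
  by move=> x; rewrite -emx_comm -scalemxAl scaleN1r mulmxA addNr.
by have := mx_derive0_cst d s; rewrite mulN1r mulr0 emx0 mulmx1.
Qed.

Lemma emxKN M s : emx M s *m emx M (- s) = 1%:M.
Proof. by have := emxNK M (- s); rewrite opprK. Qed.

(** Uniqueness for a linear equation: multiplying the solution by the inverse exponential gives a
    constant. Transposes, sums, rescalings and intertwinings of exponentials below all reduce to
    checking the equation. *)
Lemma emx_ode M p (Y : R -> 'M[R]_(n.+1, p)) :
  mx_derive Y (fun s => M *m Y s) -> forall s, Y s = emx M s *m Y 0.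
Proof.
move=> dY s.
have d : mx_derive (fun x => emx M (-1 * x) *m Y x) (fun=> 0).
  apply: mx_derive_eq (mx_deriveM (mx_derive_emxa M (-1)) dY) _.
  by move=> x; rewrite -emx_comm -scalemxAl scaleN1r mulmxA addNr.
have := mx_derive0_cst d s; rewrite mulN1r mulr0 emx0 mul1mx => <-.
by rewrite mulmxA emxKN mul1mx.
Qed.

Lemma emx_tr M s : (emx M s)^T = emx M^T s.
Proof.
rewrite (emx_ode (M := M^T) (Y := fun x => (emx M x)^T)).
  by rewrite emx0 trmx1 mulmx1.
move=> x i j; rewrite -trmx_mul emx_comm !mxE.
rewrite (_ : (fun s => _) = (fun s => emx M s j i)).
  by have := is_derive_emx M j i x; rewrite mxE.
by apply/funext => y; rewrite mxE.
Qed.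

Lemma emxD M N s : M *m N = N *m M -> emx (M + N) s = emx M s *m emx N s.
Proof.
move=> MN.
have cMN x : N *m emx M x = emx M x *m N.
  rewrite [LHS](emx_ode (M := M) (Y := fun x => N *m emx M x)) ?emx0 ?mulmx1 //.
  apply: mx_derive_eq (mx_deriveM (mx_derive_cst N) (mx_derive_emx M)) _ => y.
  by rewrite mul0mx add0r !mulmxA MN.
rewrite [RHS](emx_ode (M := M + N) (Y := fun x => emx M x *m emx N x)).
  by rewrite !emx0 !mulmx1.
apply: mx_derive_eq (mx_deriveM (mx_derive_emx M) (mx_derive_emx N)) _ => y.
by rewrite mulmxDl !mulmxA cMN.
Qed.

Lemma expmx_series M s :
  ((fun k : nat => \sum_(i < k) (i`!%:R)^-1 *: (s *: M) ^+ i : 'M[R]_n.+1)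
    @ \oo --> emx M s)%classic.
Proof.
have -> : (fun k : nat => \sum_(i < k) (i`!%:R)^-1 *: (s *: M) ^+ i) =
    (fun k => \sum_i \sum_j
       pseries (exp_entry_coef M i j) s k *: (delta_mx i j : 'M[R]_n.+1)).
  apply/funext => k; rewrite [LHS]matrix_sum_delta; apply: eq_bigr => i _.
  apply: eq_bigr => j _; congr (_ *: _).
  rewrite summxE /pseries /series /= big_mkord; apply: eq_bigr => l _.
  by rewrite exprZn !mxE /exp_entry_coef mulrA mulrAC.
rewrite [emx M s]matrix_sum_delta; apply: cvgn_sum => i; apply: cvgn_sum => j.
by apply: cvgZr_tmp; rewrite mxE; exact: cvg_exp_entry.
Qed.

End MatrixDerivative.

Lemma emx_intertwine (R : realType) m n (M : 'M[R]_m.+1) (N : 'M[R]_n.+1)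
    (Q : 'M[R]_(m.+1, n.+1)) s : Q *m N = M *m Q -> Q *m emx N s = emx M s *m Q.
Proof.
move=> QN.
rewrite [LHS](emx_ode (M := M) (Y := fun x => Q *m emx N x)) ?emx0 ?mulmx1 //.
apply: mx_derive_eq (mx_deriveM (mx_derive_cst Q) (mx_derive_emx N)) _ => y.
by rewrite mul0mx add0r !mulmxA QN.
Qed.

Lemma emxZ (R : realType) n (M : 'M[R]_n.+1) a s :
  emx (a *: M) s = emx M (a * s).
Proof.
rewrite [RHS](emx_ode (M := a *: M) (Y := fun x => emx M (a * x))).
  by rewrite mulr0 emx0 mulmx1.
by apply: mx_derive_eq (mx_derive_emxa M a) _ => x; rewrite scalemxAl.
Qed.

Lemma expmxE (R : realType) (M : 'M[R]_3) s : expmx (s *: M) = emx M s.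
Proof. by apply/cvg_lim => //; exact: expmx_series. Qed.

Lemma emx_fixl (R : realType) m n (B : 'M[R]_(m, n.+1)) (M : 'M[R]_n.+1) s :
  B *m M = 0 -> B *m emx M s = B.
Proof.
move=> BM; have d : mx_derive (fun x => B *m emx M x) (fun=> 0).
  apply: mx_derive_eq (mx_deriveM (mx_derive_cst B) (mx_derive_emx M)) _ => x.
  by rewrite mul0mx add0r mulmxA BM mul0mx.
by rewrite (mx_derive0_cst d s) emx0 mulmx1.
Qed.

Lemma emx_fixr (R : realType) m n (B : 'M[R]_(n.+1, m)) (M : 'M[R]_n.+1) s :
  M *m B = 0 -> emx M s *m B = B.
Proof.
move=> MB; apply: trmx_inj; rewrite trmx_mul emx_tr; apply: emx_fixl.
by rewrite -trmx_mul MB trmx0.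
Qed.

(** * Smooth functions and Schwarz's theorem *)

Section ScalarDifferential.
Context {R : realType} {V : normedModType R}.
Implicit Types (f g : V -> R) (h : R -> R) (p v : V).

Lemma diffDE f g p v : differentiable f p -> differentiable g p ->
  'd (fun q => f q + g q) p v = 'd f p v + 'd g p v.
Proof. by move=> df dg; rewrite -[fun q => _]/(f + g) diffD. Qed.

Lemma diffME f g p v : differentiable f p -> differentiable g p ->
  'd (fun q => f q * g q) p v = f p * 'd g p v + 'd f p v * g p.
Proof.
move=> df dg; rewrite -[fun q => _]/(f * g) diffM //.
by rewrite [LHS]/(f p * 'd g p v + g p * 'd f p v) [X in _ + X]mulrC.
Qed.

Lemma differentiable_comp1 h (h' : R) f p : is_derive (f p) (1 : R) h h' ->
  differentiable f p -> differentiable (fun q => h (f q)) p.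
Proof.
move=> dh df; rewrite -[fun q => _]/(h \o f).
apply: differentiable_comp => //; apply/derivable1_diffP; exact: ex_derive.
Qed.

Lemma diff_comp1 h (h' : R) f p v : is_derive (f p) (1 : R) h h' ->
  differentiable f p -> 'd (fun q => h (f q)) p v = h' * 'd f p v.
Proof.
move=> dh df; rewrite -[fun q => _]/(h \o f).
rewrite diff_comp //; last by apply/derivable1_diffP; exact: ex_derive.
rewrite /= diff1E; last by apply/derivable1_diffP; exact: ex_derive.
by rewrite derive1E derive_val /GRing.scale /= mulrC.
Qed.

End ScalarDifferential.

(** The two nearby points may differ. The mean value theorem yields unrelated intermediate points
    for the two orders of differentiation, and this form absorbs that. *)
Lemma eq_continuous_near (R : realType) (V : normedModType R) (a b : V -> R) p :
  continuous a -> continuous b ->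
  (forall d : R, 0 < d -> exists2 q1, `|p - q1| < d &
     exists2 q2, `|p - q2| < d & a q1 = b q2) -> a p = b p.
Proof.
move=> ca cb near; apply/eqP; apply: contraT => ab.
pose eps := `|a p - b p| / 2.
have eps0 : 0 < eps by rewrite divr_gt0 // normr_gt0 subr_eq0.
have : \forall q \near p, `|a p - a q| < eps by exact: ((cvgrPdist_lt _ _).1 (ca p)).
rewrite -nbhs_nearE => /nbhs_ballP[d1 /= d10]; rewrite -ball_normE => h1.
have : \forall q \near p, `|b p - b q| < eps by exact: ((cvgrPdist_lt _ _).1 (cb p)).
rewrite -nbhs_nearE => /nbhs_ballP[d2 /= d20]; rewrite -ball_normE => h2.
have d0 : 0 < Num.min d1 d2 by rewrite lt_min d10.
have [q1] := near _ d0; rewrite lt_min => /andP[/h1 /= q1d _].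
move=> [q2]; rewrite lt_min => /andP[_ /h2 /= q2d] e12.
have : `|a p - b p| < eps + eps.
  rewrite -(subrKA (a q1)) (le_lt_trans (ler_normD _ _)) // ltrD //.
  by rewrite e12 distrC.
by rewrite -splitr ltxx.
Qed.

Section ScalarSmooth.
Context {R : realType}.
Local Notation V := 'rV[R]_4.
Implicit Types (f g : V -> R) (h : R -> R) (p u v : V).

(** Scalar counterpart of [class_C]: matrix entries and their products live here, which maps from
    the space to itself do not cover. *)
Fixpoint Ck (k : nat) f : Prop :=
  if k is k'.+1 then
    (forall p, differentiable f p) /\
    (forall v, Ck k' (fun p => 'd f p v))
  else continuous f.

Fixpoint Ck1 (k : nat) h : Prop :=
  if k is k'.+1 then
    exists2 h', (forall x, is_derive x (1 : R) h (h' x)) & Ck1 k' h'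
  else continuous h.

Lemma differentiable_mxE m n (F : V -> 'M[R]_(m, n)) p i j :
  differentiable F p -> differentiable (fun q => F q i j) p.
Proof.
move=> dF; rewrite -[fun q => _]/((fun M : 'M[R]_(m, n) => M i j) \o F).
by apply: differentiable_comp => //; exact: differentiable_coord.
Qed.

Lemma diff_mxE m n (F : V -> 'M[R]_(m, n)) p v i j :
  differentiable F p -> 'd (fun q => F q i j) p v = ('d F p v) i j.
Proof.
move=> dF; rewrite -!deriveE //; last exact: differentiable_mxE.
by rewrite derive_mx ?mxE //; exact: diff_derivable.
Qed.

Lemma class_C_entry k (F : V -> V) j :
  class_C k F -> Ck k (fun p => F p 0 j).
Proof.
elim: k F => [|k IH] F /=.
  move=> cF p; apply: (@continuous_comp _ _ _ F (fun M : V => M 0 j) p (cF p)).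
  exact: coord_continuous.
move=> [dF cF]; split=> [p|v]; first exact: differentiable_mxE.
rewrite (_ : (fun p => _) = (fun p => ('d F p v) 0 j)); first exact: IH.
by apply/funext => p; rewrite diff_mxE.
Qed.

Lemma CkS k f : Ck k.+1 f -> Ck k f.
Proof.
elim: k f => [|k IH] f [df cf]; last by split=> // v; exact: IH.
by move=> p; exact: differentiable_continuous.
Qed.

Lemma Ck_cst k (a : R) : Ck k (fun=> a).
Proof.
elim: k a => [|k IH] a; first by move=> p; exact: cst_continuous.
split=> [p|v]; first exact: differentiable_cst.
rewrite (_ : (fun p => _) = (fun=> 0)); first exact: IH.
by apply/funext => p; rewrite diff_cst.
Qed.

Lemma Ck_coord k i : Ck k (fun p => p 0 i).
Proof.
case: k => [|k]; first by move=> p; exact: (@coord_continuous R 1 4 0 i p).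
split=> [p|v]; first exact: differentiable_coord.
rewrite (_ : (fun p => _) = (fun=> v 0 i)); first exact: Ck_cst.
by apply/funext => p; rewrite (@diff_mxE _ _ id) // diff_val.
Qed.

Lemma Ck_add k f g : Ck k f -> Ck k g -> Ck k (fun p => f p + g p).
Proof.
elim: k f g => [|k IH] f g; first by move=> cf cg p; exact: cvgD (cf p) (cg p).
move=> [df cf] [dg cg]; split=> [p|v]; first exact: differentiableD.
rewrite (_ : (fun p => 'd _ p v) = (fun p => 'd f p v + 'd g p v));
  first exact: IH (cf v) (cg v).
by apply/funext => p; exact: diffDE.
Qed.

Lemma Ck_mul k f g : Ck k f -> Ck k g -> Ck k (fun p => f p * g p).
Proof.
elim: k f g => [|k IH] f g Cf Cg.
  by move=> p; exact: cvgM (Cf p) (Cg p).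
have [[df cf] [dg cg]] := (Cf, Cg).
split=> [p|v]; first exact: differentiableM.
rewrite (_ : (fun p => 'd _ p v) = (fun p => f p * 'd g p v + 'd f p v * g p)).
  exact: Ck_add (IH _ _ (CkS Cf) (cg v)) (IH _ _ (cf v) (CkS Cg)).
by apply/funext => p; exact: diffME.
Qed.

Lemma Ck_sum k (I : Type) (r : seq I) (F : I -> V -> R) :
  (forall i, Ck k (F i)) -> Ck k (fun p => \sum_(i <- r) F i p).
Proof.
move=> cF; elim: r => [|i r IH].
  by under eq_fun do rewrite big_nil; exact: Ck_cst.
by under eq_fun do rewrite big_cons; exact: Ck_add.
Qed.

Lemma Ck_comp k h f : Ck1 k h -> Ck k f -> Ck k (fun p => h (f p)).
Proof.
elim: k h f => [|k IH] h f.
  by move=> ch cf p; exact: (@continuous_comp _ _ _ f h p (cf p) (ch _)).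
move=> [h' dh ch] Cf; have [df cf] := Cf.
split=> [p|v]; first exact: differentiable_comp1.
rewrite (_ : (fun p => 'd _ p v) = (fun p => h' (f p) * 'd f p v)).
  exact: Ck_mul (IH _ _ ch (CkS Cf)) (cf v).
by apply/funext => p; exact: diff_comp1.
Qed.

(* The mean value theorem applied twice to the second difference of f. *)
Lemma second_difference f p u v (e : R) : Ck 2 f -> 0 < e ->
  exists2 s : R, 0 < s < e & exists2 t : R, 0 < t < e &
  f (p + e *: u + e *: v) - f (p + e *: u) - f (p + e *: v) + f p =
  e ^+ 2 * 'd (fun q => 'd f q u) (p + s *: u + t *: v) v.
Proof.
move=> [df cf] e0.
have dline (g : V -> R) q w x : (forall q, differentiable g q) ->
    is_derive x (1 : R) (fun x => g (q + x *: w)) ('d g (q + x *: w) w).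
  move=> dg; have dl : is_diff x (fun x : R => q + x *: w) (fun y => y *: w).
    by apply: is_diff_eq; rewrite add0r.
  split; first by apply/derivable1_diffP; exact: differentiable_comp.
  rewrite deriveE; last exact: differentiable_comp.
  by rewrite diff_comp //= diff_val scale1r.
have cont (g : R -> R) (dg : R -> R) : (forall x, is_derive x (1 : R) g (dg x)) ->
    {within `[0, e], continuous g}%classic.
  move=> dg'; apply: continuous_subspaceT => x.
  by apply: differentiable_continuous; apply/derivable1_diffP; exact: ex_derive.
pose G x := f (p + e *: v + x *: u) - f (p + x *: u).
have dG x : is_derive x (1 : R) G
    ('d f (p + e *: v + x *: u) u - 'd f (p + x *: u) u).
  by apply: is_deriveB; exact: dline.
have [s sI Gs] := MVT e0 (fun x _ => dG x) (cont _ _ dG).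
have [duf _] := cf u.
have dH x : is_derive x (1 : R) (fun x => 'd f (p + s *: u + x *: v) u)
   ('d (fun q => 'd f q u) (p + s *: u + x *: v) v).
  exact: (dline (fun q => 'd f q u)).
have [t tI Ht] := MVT e0 (fun x _ => dH x) (cont _ _ dH).
exists s; first by rewrite in_itv in sI.
exists t; first by rewrite in_itv in tI.
rewrite subr0 in Ht; rewrite subr0 in Gs.
transitivity (G e - G 0).
  by rewrite /G scale0r !addr0 [p + e *: v + _]addrAC; ring.
rewrite Gs; rewrite scale0r addr0 in Ht.
by rewrite expr2 -mulrA [e * 'd _ _ _]mulrC -Ht [p + e *: v + _]addrAC mulrC.
Qed.

(** The second difference is symmetric in u and v, so the two mixed derivatives agree at points
    arbitrarily close to p. The step d / (|u| + |v| + 1) keeps both intermediate points within d. *)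
Lemma schwarz f p u v : Ck 2 f ->
  'd (fun q => 'd f q u) p v = 'd (fun q => 'd f q v) p u.
Proof.
move=> cf; have [_ c1f] := cf.
have [_ /(_ v) ca] := c1f u; have [_ /(_ u) cb] := c1f v.
apply: (eq_continuous_near ca cb) => d d0.
pose N := `|u| + `|v| + 1.
have N0 : 0 < N by rewrite ltr_wpDl // addr_ge0.
pose e := d / N.
have e0 : 0 < e by rewrite divr_gt0.
have near s t w w' : 0 < s < e -> 0 < t < e -> `|w| + `|w'| + 1 = N ->
    `|p - (p + s *: w + t *: w')| < d.
  move=> /andP[s0 se] /andP[t0 te] wN.
  rewrite -addrA opprD addNKr normrN.
  rewrite (le_lt_trans (ler_normD _ _)) // !normrZ !gtr0_norm //.
  have -> : d = e * N by rewrite divfK // gt_eqF.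
  rewrite -wN mulrDr mulr1 ltr_pwDr // mulrDr lerD // ler_wpM2r //; exact: ltW.
have [s sI [t tI h1]] := second_difference p u v cf e0.
have [s' s'I [t' t'I h2]] := second_difference p v u cf e0.
exists (p + s *: u + t *: v); first exact: near.
exists (p + s' *: v + t' *: u).
  by apply: near => //; rewrite /N [`|v| + _]addrC.
have e2 : e ^+ 2 != 0 by rewrite expf_eq0 /= gt_eqF.
apply: (mulfI e2); rewrite -h1 -h2 [p + e *: v + _]addrAC; ring.
Qed.

End ScalarSmooth.

(** * The Levi-Civita connection of a left-invariant metric *)

Section MetricAlgebra.
Context {R : realType} (g : left_inv_metric R).
Implicit Types (x y z u v w : 'rV[R]_4) (a : R).

Lemma rV1_det (A : 'M[R]_1) : A^T = A.
Proof. by apply/matrixP => i j; rewrite mxE !ord1. Qed.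

Lemma ipC x y : ip g x y = ip g y x.
Proof.
by rewrite /ip -[in LHS](rV1_det (x *m _ *m _)) !trmx_mul trmxK gram_sym mulmxA.
Qed.

Lemma ipDl x y z : ip g (x + y) z = ip g x z + ip g y z.
Proof. by rewrite /ip !mulmxDl mxE. Qed.

Lemma ipZl a x z : ip g (a *: x) z = a * ip g x z.
Proof. by rewrite /ip -!scalemxAl mxE. Qed.

Lemma ipNl x z : ip g (- x) z = - ip g x z.
Proof. by rewrite -scaleN1r ipZl mulN1r. Qed.

Lemma ipDr x y z : ip g z (x + y) = ip g z x + ip g z y.
Proof. by rewrite ipC ipDl !(ipC z). Qed.

Lemma ipZr a x z : ip g z (a *: x) = a * ip g z x.
Proof. by rewrite ipC ipZl ipC. Qed.

Lemma ipNr x z : ip g z (- x) = - ip g z x.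
Proof. by rewrite ipC ipNl ipC. Qed.

Definition ipE := (ipDl, ipZl, ipNl, ipDr, ipZr, ipNr).

Lemma gram_unit : gram g \in unitmx.
Proof.
rewrite -row_free_unit; apply: inj_row_free => x xG.
apply/eqP; apply: contraT => /(@gram_pos _ g).
by rewrite xG mul0mx mxE ltxx.
Qed.

Lemma ip_inj x y : (forall z, ip g x z = ip g y z) -> x = y.
Proof.
move=> xy; apply/eqP; rewrite -subr_eq0; apply: contraT => /(@gram_pos _ g).
by rewrite -/(ip g _ _) ipDl ipNl xy subrr ltxx.
Qed.

Lemma lieDl x y z : lie g (x + y) z = lie g x z + lie g y z.
Proof. by rewrite /lie mulmxDl mxE scalerDl scalerDr opprD addrACA. Qed.

Lemma lieZl a x z : lie g (a *: x) z = a *: lie g x z.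
Proof.
by rewrite /lie -scalemxAl mxE scalerBr !scalerA [_ 0 ord_max * a]mulrC.
Qed.

Lemma lieC x y : lie g x y = - lie g y x.
Proof. by rewrite /lie opprB. Qed.

Lemma lieDr x y z : lie g z (x + y) = lie g z x + lie g z y.
Proof. by rewrite lieC lieDl opprD -!(lieC z). Qed.

Lemma lieZr a x z : lie g z (a *: x) = a *: lie g z x.
Proof. by rewrite lieC lieZl -scalerN -lieC. Qed.

Definition lieE := (lieDl, lieZl, lieDr, lieZr).

Lemma koszulDr x y u v : koszul g x y (u + v) = koszul g x y u + koszul g x y v.
Proof. by rewrite /koszul !(lieE, ipE); field. Qed.

Lemma koszulZr x y a u : koszul g x y (a *: u) = a * koszul g x y u.
Proof. by rewrite /koszul !(lieE, ipE); field. Qed.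

Lemma rV_sum_e x : x = \sum_i x 0 i *: e_ i.
Proof. by rewrite [LHS]row_sum_delta. Qed.

Lemma ip_nabla x y z : ip g (nabla g x y) z = koszul g x y z.
Proof.
rewrite /ip /nabla /ginv mulmxKV ?gram_unit // mxE [z in RHS]rV_sum_e.
elim/big_rec2: _ => [|i b k _ ->].
  by have := koszulZr x y 0 0; rewrite scale0r mul0r.
by rewrite koszulDr koszulZr !mxE mulrC.
Qed.

Lemma nablaDl x y z : nabla g (x + y) z = nabla g x z + nabla g y z.
Proof.
by apply: ip_inj => w; rewrite !(ip_nabla, ipE) /koszul !(lieE, ipE); field.
Qed.

Lemma nablaZl a x z : nabla g (a *: x) z = a *: nabla g x z.
Proof.
by apply: ip_inj => w; rewrite !(ip_nabla, ipE) /koszul !(lieE, ipE); field.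
Qed.

Lemma nablaDr x y z : nabla g z (x + y) = nabla g z x + nabla g z y.
Proof.
by apply: ip_inj => w; rewrite !(ip_nabla, ipE) /koszul !(lieE, ipE); field.
Qed.

Lemma nablaZr a x z : nabla g z (a *: x) = a *: nabla g z x.
Proof.
by apply: ip_inj => w; rewrite !(ip_nabla, ipE) /koszul !(lieE, ipE); field.
Qed.

Lemma nablaNl x z : nabla g (- x) z = - nabla g x z.
Proof. by rewrite -scaleN1r nablaZl scaleN1r. Qed.

Lemma nablaNr x z : nabla g z (- x) = - nabla g z x.
Proof. by rewrite -scaleN1r nablaZr scaleN1r. Qed.

Definition nablaE := (nablaDl, nablaZl, nablaNl, nablaDr, nablaZr, nablaNr).

Lemma nabla_metric x y z : ip g (nabla g x y) z + ip g y (nabla g x z) = 0.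
Proof.
rewrite [ip g y _]ipC !ip_nabla /koszul (lieC z y) (lieC z x) (lieC y x) !ipE.
by field.
Qed.

Lemma nabla_torsion x y : nabla g x y - nabla g y x = lie g x y.
Proof.
apply: ip_inj => z; rewrite !(ipE, ip_nabla) /koszul.
by rewrite (lieC y x) (lieC x z) (lieC z y) !ipE; field.
Qed.

End MetricAlgebra.

(* The connection is kept abstract here: with [nabla] itself, comparing terms
   up to conversion would unfold the inverse Gram matrix. *)
Section AbstractConnection.
Context {R : realFieldType} {V : lmodType R}.
Variables (b : V -> V -> R) (nb br : V -> V -> V).
Hypothesis bl : forall y, scalar (b ^~ y).
Hypothesis b_inj : forall x y, (forall z, b x z = b y z) -> x = y.
Hypothesis nbl : forall y, linear (nb ^~ y).
Hypothesis nbr : forall x, linear (nb x).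
Hypothesis brl : forall y, linear (br ^~ y).
Hypothesis brr : forall x, linear (br x).

Lemma linearP0 (W : lmodType R) (f : V -> W) : linear f -> f 0 = 0.
Proof. by move=> lf; have := lf (-1) 0 0; rewrite scaler0 addr0 scaleN1r addNr. Qed.

Lemma linearPD (W : lmodType R) (f : V -> W) x y : linear f -> f (x + y) = f x + f y.
Proof. by move=> lf; rewrite -[x]scale1r lf !scale1r. Qed.

Lemma linearPZ (W : lmodType R) (f : V -> W) a x : linear f -> f (a *: x) = a *: f x.
Proof. by move=> lf; rewrite -[a *: x]addr0 lf linearP0 // addr0. Qed.

Lemma linearPN (W : lmodType R) (f : V -> W) x : linear f -> f (- x) = - f x.
Proof. by move=> lf; rewrite -scaleN1r linearPZ // scaleN1r. Qed.

Let bD x y z : b (x + y) z = b x z + b y z.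
Proof. exact: (linearPD (W := R^o) x y (bl z)). Qed.
Let bZ a x z : b (a *: x) z = a * b x z.
Proof. exact: (linearPZ (W := R^o) a x (bl z)). Qed.
Let bN x z : b (- x) z = - b x z.
Proof. exact: (linearPN (W := R^o) x (bl z)). Qed.
Let nDl x y z : nb (x + y) z = nb x z + nb y z. Proof. exact: linearPD x y (nbl z). Qed.
Let nZl a x z : nb (a *: x) z = a *: nb x z. Proof. exact: linearPZ a x (nbl z). Qed.
Let nNl x z : nb (- x) z = - nb x z. Proof. exact: linearPN x (nbl z). Qed.
Let nDr x y z : nb z (x + y) = nb z x + nb z y. Proof. exact: linearPD x y (nbr z). Qed.
Let nZr a x z : nb z (a *: x) = a *: nb z x. Proof. exact: linearPZ a x (nbr z). Qed.
Let nNr x z : nb z (- x) = - nb z x. Proof. exact: linearPN x (nbr z). Qed.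
Let nE := (nDl, nZl, nNl, nDr, nZr, nNr).
Let bE := (bD, bZ, bN).

Definition curv_of x y z := nb x (nb y z) - nb y (nb x z) - nb (br x y) z.

(** Vector identities are tested against the form [b], which turns them into scalar identities
    within reach of [ring]. *)
Lemma curv_of_lin1 y z : linear (fun x => curv_of x y z).
Proof. by move=> a u v; apply: b_inj => t; rewrite /curv_of brl !(nE, bE); ring. Qed.

Lemma curv_of_lin2 x z : linear (fun y => curv_of x y z).
Proof. by move=> a u v; apply: b_inj => t; rewrite /curv_of brr !(nE, bE); ring. Qed.

Lemma curv_of_lin3 x y : linear (curv_of x y).
Proof. by move=> a u v; apply: b_inj => t; rewrite /curv_of !(nE, bE); ring. Qed.

End AbstractConnection.

Section AbstractTransfer.
Context {R : realFieldType} {V : lmodType R}.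
Variables (b : V -> V -> R) (nb br nb' br' : V -> V -> V) (al : V -> V).
Hypothesis bl : forall y, scalar (b ^~ y).
Hypothesis b_inj : forall x y, (forall z, b x z = b y z) -> x = y.
Hypothesis nbl : forall y, linear (nb ^~ y).
Hypothesis nbl' : forall y, linear (nb' ^~ y).
Hypothesis nbr' : forall x, linear (nb' x).
Hypothesis torsion : forall x y, nb x y - nb y x = br x y.
Hypothesis torsion' : forall x y, nb' x y - nb' y x = br' x y.
Hypothesis al_lin : linear al.

(* [second u v z] is what differentiating the frame equation
   [D_v (zA) = (nabla_v z)A - nabla'_{vA} (zA)] once more along [u] gives. *)
Definition second u v z : V :=
  al (nb u (nb v z)) - nb' (al u) (al (nb v z))
  - nb' (al (nb u v) - nb' (al u) (al v)) (al z)
  - nb' (al v) (al (nb u z) - nb' (al u) (al z)).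

(** The hypothesis says that the commutator of second derivatives is the derivative along the
    bracket. On antisymmetrising in u and v the mixed terms cancel in pairs, and torsion-freeness
    converts the rest into the two curvatures. *)
Lemma curv_transfer u v z :
  second u v z - second v u z = al (nb (br u v) z) - nb' (al (br u v)) (al z) ->
  curv_of nb' br' (al u) (al v) (al z) = al (curv_of nb br u v z).
Proof.
have bD x y w : b (x + y) w = b x w + b y w := linearPD (W := R^o) x y (bl w).
have bN x w : b (- x) w = - b x w := linearPN (W := R^o) x (bl w).
have alD x y : al (x + y) = al x + al y := linearPD x y al_lin.
have alN x : al (- x) = - al x := linearPN x al_lin.
have nDl x y w : nb (x + y) w = nb x w + nb y w := linearPD x y (nbl w).
have nNl x w : nb (- x) w = - nb x w := linearPN x (nbl w).
have nDl' x y w : nb' (x + y) w = nb' x w + nb' y w := linearPD x y (nbl' w).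
have nNl' x w : nb' (- x) w = - nb' x w := linearPN x (nbl' w).
have nDr' x y w : nb' w (x + y) = nb' w x + nb' w y := linearPD x y (nbr' w).
have nNr' x w : nb' w (- x) = - nb' w x := linearPN x (nbr' w).
rewrite /second /curv_of -torsion -torsion'.
rewrite !(alD, alN, nDl, nNl, nDl', nNl', nDr', nNr') => e.
apply: b_inj => w; have := congr1 (b ^~ w) e; rewrite !(bD, bN) => {}e.
by lra.
Qed.

End AbstractTransfer.

(* Applied to the difference of two torsion-free metric connections. *)
Lemma symmetric_skew_eq0 (R : realFieldType) (V : Type) (T : V -> V -> V -> R) :
  (forall u v w, T u v w = T v u w) -> (forall u v w, T u v w = - T u w v) ->
  forall u v w, T u v w = 0.
Proof.
move=> Ts Tk u v w; have : T u v w = - T u v w.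
  by rewrite {1}Tk Ts Tk opprK Ts Tk Ts.
by move=> h; lra.
Qed.

(** * Left translations and directional derivatives *)

Section LeftTranslation.
Context {R : realType} (g : left_inv_metric R).

(** Compared block row by block row: the inclusion of the ideal intertwines [ad4] with [der], and
    the last basis row is annihilated by [ad4], hence fixed by its exponential. *)
Lemma dtranslE s : dtransl g s = emx (ad4 g) s.
Proof.
pose P : 'M[R]_(3, 4) := row_mx 1%:M (0 : 'M[R]_(3, 1)).
pose E : 'M[R]_(1, 4) := row_mx (0 : 'M[R]_(1, 3)) 1%:M.
have hP : P *m emx (ad4 g) s = emx (der g) s *m P.
  apply: emx_intertwine; rewrite /P /ad4.
  apply: etrans (@mul_row_block _ 3 3 1 3 1 _ _ _ _ _ _) _.
  apply: etrans (esym (@mul_mx_row _ 3 3 3 1 _ _ _)).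
  by rewrite !mul1mx !mul0mx !mulmx0 mulmx1 !addr0.
have hE : E *m emx (ad4 g) s = E.
  apply: emx_fixl; apply: etrans (@mul_row_block _ 1 3 1 3 1 _ _ _ _ _ _) _.
  by rewrite !mul0mx !mulmx0 !addr0 row_mx0.
have PE : col_mx P E = 1%:M :> 'M[R]_4.
  exact: esym (@scalar_mx_block R 3 1 1).
rewrite -[RHS]mul1mx -PE; apply: esym.
apply: etrans (@mul_col_mx _ 3 1 4 4 _ _ _) _; rewrite hP hE /dtransl expmxE.
congr col_mx; apply: etrans (@mul_mx_row _ 3 3 3 1 _ _ _) _.
by rewrite mulmx1 mulmx0.
Qed.

Lemma ad4_col4 : ad4 g *m delta_mx ord_max 0 = 0 :> 'cV[R]_4.
Proof.
rewrite -colE; apply/colP => i; rewrite !mxE.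
by case: splitP => j ej; rewrite !mxE; case: splitP => k ek; rewrite ?mxE //;
  have := ltn_ord k; rewrite -ek.
Qed.

(** [ad4] takes values in the ideal, so translating a vector never changes its last coordinate. This
    is why the frame below depends on the base point in such a simple way. *)
Lemma emx_ad4_col4 (u : 'rV[R]_4) s :
  (u *m emx (ad4 g) s) 0 ord_max = u 0 ord_max.
Proof.
have h : emx (ad4 g) s *m (delta_mx ord_max 0 : 'cV[R]_4) = delta_mx ord_max 0.
  exact/emx_fixr/ad4_col4.
have := congr1 (fun M => (u *m M) 0 0) h.
by rewrite mulmxA -!colE !mxE.
Qed.

Lemma Ck1_emx n (M B : 'M[R]_n.+1) k i j : Ck1 k (fun s => (B *m emx M s) i j).
Proof.
have d (C : 'M[R]_n.+1) x : is_derive x (1 : R) (fun s => (C *m emx M s) i j)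
    ((C *m M *m emx M x) i j).
  have := mx_deriveM (mx_derive_cst C) (mx_derive_emx M) x i j.
  by rewrite mul0mx add0r mulmxA.
elim: k B => [|k IH] B; last by exists (fun s => (B *m M *m emx M s) i j).
move=> x; apply: differentiable_continuous; apply/derivable1_diffP.
by have := d B x => ?; exact: ex_derive.
Qed.

End LeftTranslation.

Section DirectionalDerivative.
Context {R : realType}.
Local Notation V := 'rV[R]_4.
Implicit Types (f h : V -> R) (F H : V -> V) (p w : V).

(** Differentiability is bundled with the value, because the term ['d f p w] alone carries no
    information where f is not differentiable. *)
Definition sder f p w (d : R) : Prop := differentiable f p /\ 'd f p w = d.

Definition vder F p w (d : V) : Prop :=
  forall j, sder (fun q => F q 0 j) p w (d 0 j).

Lemma sder_cst (a : R) p w : sder (fun=> a) p w 0.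
Proof. by split; [exact: differentiable_cst|rewrite diff_cst]. Qed.

Lemma sderD f h p w a b : sder f p w a -> sder h p w b ->
  sder (fun q => f q + h q) p w (a + b).
Proof.
by move=> [df <-] [dh <-]; split; [exact: differentiableD|exact: diffDE].
Qed.

Lemma sderM f h p w a b : sder f p w a -> sder h p w b ->
  sder (fun q => f q * h q) p w (a * h p + f p * b).
Proof.
move=> [df <-] [dh <-]; split; first exact: differentiableM.
by rewrite addrC; exact: diffME.
Qed.

Lemma sder_sum (I : Type) (r : seq I) (f : I -> V -> R) p w (a : I -> R) :
  (forall i, sder (f i) p w (a i)) ->
  sder (fun q => \sum_(i <- r) f i q) p w (\sum_(i <- r) a i).
Proof.
move=> df; elim: r => [|i r IH].
  by under eq_fun do rewrite big_nil; rewrite big_nil; exact: sder_cst.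
by under eq_fun do rewrite big_cons; rewrite big_cons; exact: sderD.
Qed.

Lemma sder_eq f p w a b : sder f p w a -> a = b -> sder f p w b.
Proof. by move=> ? <-. Qed.

Lemma sder_uniq f p w a b : sder f p w a -> sder f p w b -> a = b.
Proof. by move=> [_ <-] [_ <-]. Qed.

Lemma vder_uniq F p w a b : vder F p w a -> vder F p w b -> a = b.
Proof. by move=> Fa Fb; apply/rowP => j; exact: sder_uniq (Fa j) (Fb j). Qed.

Lemma sder_lin (l : V -> R) F p w d : scalar l -> vder F p w d ->
  sder (fun q => l (F q)) p w (l d).
Proof.
move=> ll dF.
have l0 : l 0 = 0.
  by have := ll (-1) 0 0; rewrite scaler0 addr0 mulN1r addNr.
have lD x y : l (x + y) = l x + l y by rewrite -[x]scale1r ll mul1r scale1r.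
have lZ a x : l (a *: x) = a * l x by rewrite -[a *: x]addr0 ll l0 addr0.
have lE x : l x = \sum_i x 0 i * l (delta_mx 0 i).
  rewrite {1}[x]row_sum_delta; elim/big_rec2: _ => [|i a b _ <-] //.
  by rewrite lD lZ.
rewrite lE; have -> : (fun q => l (F q)) =
    (fun q => \sum_i F q 0 i * l (delta_mx 0 i)) by apply/funext => q.
apply: sder_sum => i; apply: sder_eq (sderM (dF i) (sder_cst _ _ _)) _.
by rewrite mulr0 addr0.
Qed.

Lemma sder_bilin (b : V -> V -> R) F H p w dF dH :
  (forall y, scalar (b ^~ y)) -> (forall x, scalar (b x)) ->
  vder F p w dF -> vder H p w dH ->
  sder (fun q => b (F q) (H q)) p w (b dF (H p) + b (F p) dH).
Proof.
move=> bl br hF hH.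
have l0 y : b 0 y = 0.
  by have := bl y (-1) 0 0; rewrite scaler0 addr0 mulN1r addNr.
have lD x x' y : b (x + x') y = b x y + b x' y.
  by rewrite -[x]scale1r bl mul1r scale1r.
have lZ a x y : b (a *: x) y = a * b x y.
  by rewrite -[a *: x]addr0 bl l0 addr0.
have lE x y : b x y = \sum_i x 0 i * b (delta_mx 0 i) y.
  rewrite {1}[x]row_sum_delta; elim/big_rec2: _ => [|i c d _ <-] //.
  by rewrite lD lZ.
rewrite [b dF _]lE [b (F p) _]lE -big_split /=.
have -> : (fun q => b (F q) (H q)) =
    (fun q => \sum_i F q 0 i * b (delta_mx 0 i) (H q)) by apply/funext => q.
apply: sder_sum => i; apply: sderM => //; exact: sder_lin.
Qed.

Lemma sder_trilin (b : V -> V -> V -> R) F G H p w dF dG dH :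
  (forall y z, scalar (fun x => b x y z)) ->
  (forall x z, scalar (fun y => b x y z)) ->
  (forall x y, scalar (b x y)) ->
  vder F p w dF -> vder G p w dG -> vder H p w dH ->
  sder (fun q => b (F q) (G q) (H q)) p w
    (b dF (G p) (H p) + b (F p) dG (H p) + b (F p) (G p) dH).
Proof.
move=> b1 b2 b3 hF hG hH.
have l0 y z : b 0 y z = 0.
  by have := b1 y z (-1) 0 0; rewrite scaler0 addr0 mulN1r addNr.
have lD x x' y z : b (x + x') y z = b x y z + b x' y z.
  by rewrite -[x]scale1r b1 mul1r scale1r.
have lZ a x y z : b (a *: x) y z = a * b x y z.
  by rewrite -[a *: x]addr0 b1 l0 addr0.
have lE x y z : b x y z = \sum_i x 0 i * b (delta_mx 0 i) y z.
  rewrite {1}[x]row_sum_delta; elim/big_rec2: _ => [|i c d _ <-] //.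
  by rewrite lD lZ.
rewrite -addrA [b dF _ _]lE [b (F p) dG _]lE [b (F p) (G p) dH]lE -!big_split /=.
have -> : (fun q => b (F q) (G q) (H q)) =
    (fun q => \sum_i F q 0 i * b (delta_mx 0 i) (G q) (H q)) by apply/funext => q.
apply: sder_sum => i; rewrite -mulrDr; apply: sderM => //.
by apply: sder_bilin => // y a u v; rewrite b2.
Qed.

End DirectionalDerivative.

Section MoreDerivatives.
Context {R : realType}.
Local Notation V := 'rV[R]_4.

Lemma rowDE (x y : V) j : (x + y) 0 j = x 0 j + y 0 j.
Proof. by rewrite mxE. Qed.

Lemma rowNE (x : V) j : (- x) 0 j = - x 0 j.
Proof. by rewrite mxE. Qed.

Lemma rowZE a (x : V) j : (a *: x) 0 j = a * x 0 j.
Proof. by rewrite mxE. Qed.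

Definition entryE := (rowDE, rowNE, rowZE).

Lemma vder_eq (F : V -> V) p w a b : vder F p w a -> a = b -> vder F p w b.
Proof. by move=> ? <-. Qed.

Lemma vderD (F H : V -> V) p w a b : vder F p w a -> vder H p w b ->
  vder (fun q => F q + H q) p w (a + b).
Proof.
move=> dF dH j; have := sderD (dF j) (dH j); rewrite -rowDE.
by rewrite (_ : (fun q => F q 0 j + H q 0 j) = (fun q => (F q + H q) 0 j)) //;
  apply/funext => q; rewrite rowDE.
Qed.

Lemma vderN (F : V -> V) p w a : vder F p w a -> vder (fun q => - F q) p w (- a).
Proof.
move=> dF j; have := sderM (sder_cst (-1) p w) (dF j).
rewrite mul0r add0r mulN1r -rowNE.
by rewrite (_ : (fun q => -1 * F q 0 j) = (fun q => (- F q) 0 j)) //;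
  apply/funext => q; rewrite rowNE mulN1r.
Qed.

Lemma vder_bilin (B : V -> V -> V) (F H : V -> V) p w dF dH :
  (forall y, linear (B ^~ y)) -> (forall x, linear (B x)) ->
  vder F p w dF -> vder H p w dH ->
  vder (fun q => B (F q) (H q)) p w (B dF (H p) + B (F p) dH).
Proof.
move=> Bl Br hF hH j; rewrite rowDE.
apply: (sder_bilin (b := fun x y => B x y 0 j)) => // [y a u v|x a u v].
  by rewrite Bl !entryE.
by rewrite Br !entryE.
Qed.

Lemma vder_trilin (B : V -> V -> V -> V) (F G H : V -> V) p w dF dG dH :
  (forall y z, linear (fun x => B x y z)) ->
  (forall x z, linear (fun y => B x y z)) ->
  (forall x y, linear (B x y)) ->
  vder F p w dF -> vder G p w dG -> vder H p w dH ->
  vder (fun q => B (F q) (G q) (H q)) p w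
    (B dF (G p) (H p) + B (F p) dG (H p) + B (F p) (G p) dH).
Proof.
move=> B1 B2 B3 hF hG hH j; rewrite !rowDE.
apply: (sder_trilin (b := fun x y z => B x y z 0 j)) => //.
- by move=> y z a u v; rewrite B1 !entryE.
- by move=> y z a u v; rewrite B2 !entryE.
- by move=> y z a u v; rewrite B3 !entryE.
Qed.

Lemma sder_comp1 (h : R -> R) (h' : R) (f : V -> R) p w d :
  is_derive (f p) (1 : R) h h' -> sder f p w d ->
  sder (fun q => h (f q)) p w (h' * d).
Proof.
move=> dh [df <-]; split; first exact: differentiable_comp1 dh df.
exact: diff_comp1.
Qed.

Lemma sder_coord p w j : sder (fun q : V => q 0 j) p w (w 0 j).
Proof.
split; first exact: differentiable_coord.
by rewrite (@diff_mxE _ _ _ id) // diff_val.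
Qed.

End MoreDerivatives.

Section Multilinearity.
Context {R : realType} (g : left_inv_metric R).
Implicit Types (x y z u v w : 'rV[R]_4) (a : R).

Lemma nabla_linl y : linear ((nabla g) ^~ y).
Proof. by move=> a u v /=; rewrite !nablaE. Qed.

Lemma nabla_linr x : linear (nabla g x).
Proof. by move=> a u v /=; rewrite !nablaE. Qed.

Lemma lie_linl y : linear ((lie g) ^~ y).
Proof. by move=> a u v /=; rewrite !lieE. Qed.

Lemma lie_linr x : linear (lie g x).
Proof. by move=> a u v /=; rewrite !lieE. Qed.

Lemma ip_linl y : scalar ((ip g) ^~ y).
Proof. by move=> a u v /=; rewrite !ipE. Qed.

Lemma ip_linr x : scalar (ip g x).
Proof. by move=> a u v /=; rewrite !ipE. Qed.

Lemma curv_lin1 y z : linear (fun x => curv g x y z).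
Proof.
exact: (curv_of_lin1 ip_linl (@ip_inj _ g) nabla_linl nabla_linr lie_linl).
Qed.

Lemma curv_lin2 x z : linear (fun y => curv g x y z).
Proof.
exact: (curv_of_lin2 ip_linl (@ip_inj _ g) nabla_linl nabla_linr lie_linr).
Qed.

Lemma curv_lin3 x y : linear (curv g x y).
Proof.
exact: (curv_of_lin3 (lie g) ip_linl (@ip_inj _ g) nabla_linr).
Qed.

Lemma Riem_lin1 y z w : scalar (fun x => Riem g x y z w).
Proof. by move=> a u v; rewrite /Riem curv_lin1 ip_linl. Qed.

Lemma Riem_lin2 x z w : scalar (fun y => Riem g x y z w).
Proof. by move=> a u v; rewrite /Riem curv_lin2 ip_linl. Qed.

Lemma Riem_lin3 x y w : scalar (fun z => Riem g x y z w).
Proof. by move=> a u v; rewrite /Riem ip_linr. Qed.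

Lemma Riem_lin4 x y z : scalar (Riem g x y z).
Proof. by move=> a u v; rewrite /Riem curv_lin3 ip_linl. Qed.

Lemma ricci_linl y : scalar ((ricci g) ^~ y).
Proof.
move=> a u v; rewrite /ricci mulr_sumr -big_split; apply: eq_bigr => k _ /=.
rewrite mulr_sumr -big_split; apply: eq_bigr => l _ /=.
by rewrite Riem_lin1 [LHS]mulrDr mulrCA.
Qed.

Lemma ricci_linr x : scalar (ricci g x).
Proof.
move=> a u v; rewrite /ricci mulr_sumr -big_split; apply: eq_bigr => k _ /=.
rewrite mulr_sumr -big_split; apply: eq_bigr => l _ /=.
by rewrite Riem_lin3 mulrDr mulrCA.
Qed.

Section Cov.
Variable b : 'rV[R]_4 -> 'rV[R]_4 -> R.
Hypothesis bl : forall y, scalar (b ^~ y).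
Hypothesis br : forall x, scalar (b x).

Lemma cov_lin1 y z : scalar (fun w => cov g b w y z).
Proof.
move=> a u v; rewrite /cov (nabla_linl y) (nabla_linl z) bl br.
by rewrite mulrBr mulrN !opprD; exact: addrACA.
Qed.

Lemma cov_lin2 w z : scalar (fun y => cov g b w y z).
Proof.
move=> a u v; rewrite /cov nabla_linr !bl.
by rewrite mulrBr mulrN !opprD; exact: addrACA.
Qed.

Lemma cov_lin3 w y : scalar (cov g b w y).
Proof.
move=> a u v; rewrite /cov nabla_linr !br.
by rewrite mulrBr mulrN !opprD; exact: addrACA.
Qed.

End Cov.

(* Otherwise [ring] compares these atoms up to conversion, unfolding them. *)
Local Ltac generalize_cov :=
  repeat match goal with |- context [cov ?h ?b ?x ?y ?z] =>
    generalize (cov h b x y z) end;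
  intros.

Lemma cov2_lin1 b : (forall y, scalar (b ^~ y)) -> (forall x, scalar (b x)) ->
  forall w y z, scalar (fun x => cov2 g b x w y z).
Proof.
move=> bl br w y z a u v; rewrite /cov2 (nabla_linl w) (cov_lin1 bl br y z).
rewrite (cov_lin1 (cov_lin2 bl w) (cov_lin3 br w) y z).
generalize_cov; ring.
Qed.

Lemma cov2_lin2 b : (forall y, scalar (b ^~ y)) -> (forall x, scalar (b x)) ->
  forall x y z, scalar (fun w => cov2 g b x w y z).
Proof.
move=> bl br x y z a u v; rewrite /cov2 (nabla_linr x) (cov_lin1 bl br y z).
have h w : cov g (cov g b w) x y z =
  - cov g b w (nabla g x y) z - cov g b w y (nabla g x z) by [].
rewrite !h (cov_lin1 bl br (nabla g x y) z) (cov_lin1 bl br y (nabla g x z)).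
generalize_cov; ring.
Qed.
End Multilinearity.

Lemma bilinear_mxE (R : realType) (b : 'rV[R]_4 -> 'rV[R]_4 -> R) x y :
  (forall y, scalar (b ^~ y)) -> (forall x, scalar (b x)) ->
  b x y = (x *m (\matrix_(i, j) b (e_ i) (e_ j)) *m y^T) 0 0.
Proof.
move=> bl br.
have l0 z : b 0 z = 0.
  by have := bl z (-1) 0 0; rewrite scaler0 addr0 mulN1r addNr.
have r0 z : b z 0 = 0.
  by have := br z (-1) 0 0; rewrite scaler0 addr0 mulN1r addNr.
have lE u v : b u v = \sum_i u 0 i * b (e_ i) v.
  rewrite {1}[u]rV_sum_e; elim/big_rec2: _ => [|i c d _ <-] //.
  by rewrite bl.
have rE u v : b u v = \sum_i v 0 i * b u (e_ i).
  rewrite {1}[v]rV_sum_e; elim/big_rec2: _ => [|i c d _ <-] //.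
  by rewrite br.
rewrite rE mxE; apply: eq_bigr => j _; rewrite !mxE mulrC; congr (_ * _).
by rewrite lE; apply: eq_bigr => i _; rewrite !mxE.
Qed.

(** Both double sums are traces of X Y^T, and the two changes of basis cancel by cyclicity of the
    trace. *)
Lemma contraction_natural (R : realType) (A B B' M M' : 'M[R]_4) (a d : R) :
  A *m B' *m A^T = a *: B -> M' = d *: (A^T *m M *m A) ->
  \sum_(k < 4) \sum_(l < 4) M' k l * B' k l =
  d * a * \sum_(k < 4) \sum_(l < 4) M k l * B k l.
Proof.
have tr (X Y : 'M[R]_4) : \sum_(k < 4) \sum_(l < 4) X k l * Y k l = \tr (X *m Y^T).
  by apply: eq_bigr => k _; rewrite mxE; apply: eq_bigr => l _; rewrite mxE.
move=> AB ->; rewrite !tr -scalemxAl linearZ /= -mulrA; congr (_ * _).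
rewrite -mulmxA mxtrace_mulC.
have ABt : A *m B'^T *m A^T = a *: B^T.
  by rewrite -linearZ -AB /= !trmx_mul trmxK mulmxA.
by rewrite mulmxA ABt -scalemxAl mxtraceZ mxtrace_mulC.
Qed.

(** * Left-invariant fields and their commutators *)

Section Frame.
Context {R : realType} (g g' : left_inv_metric R).
Local Notation V := 'rV[R]_4.
Implicit Types (f : V -> R) (p u v w x y z : V).

(** The left-invariant field with value u at the identity, evaluated at p: the differential of left
    translation by p depends on its last coordinate only. *)
Definition frame (h : left_inv_metric R) p u : V :=
  u *m emx (ad4 h) (p 0 ord_max).

Lemma diff_sum_e f p y : 'd f p y = \sum_j y 0 j * 'd f p (e_ j).
Proof.
rewrite {1}[y]rV_sum_e linear_sum; apply: eq_bigr => j _.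
by rewrite linearZ.
Qed.

Lemma frame_second f p u v : Ck 2 f ->
  sder (fun q => 'd f q (frame g q v)) p (frame g p u)
    (u 0 ord_max * 'd f p (frame g p (v *m ad4 g))
     + 'd (fun q => 'd f q (frame g p v)) p (frame g p u)).
Proof.
move=> cf; have [df c1f] := cf; set w := frame g p u.
have -> : (fun q => 'd f q (frame g q v)) =
    (fun q => \sum_j frame g q v 0 j * 'd f q (e_ j)).
  by apply/funext => q; exact: diff_sum_e.
have dfr j : sder (fun q => frame g q v 0 j) p w
    ((v *m ad4 g *m emx (ad4 g) (p 0 ord_max)) 0 j * u 0 ord_max).
  have dh : is_derive (p 0 ord_max) (1 : R) (fun s => (v *m emx (ad4 g) s) 0 j)
      ((v *m ad4 g *m emx (ad4 g) (p 0 ord_max)) 0 j).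
    have := mx_deriveM (mx_derive_cst v) (mx_derive_emx (ad4 g)) (p 0 ord_max) 0 j.
    by rewrite mul0mx add0r mulmxA.
  apply: sder_eq (sder_comp1 (f := fun q : V => q 0 ord_max) dh (sder_coord _ w _)) _.
  by rewrite /w /frame emx_ad4_col4.
(* Schwarz's theorem moves the fixed direction w inside, so that the sum over j reassembles by
   linearity into one derivative along [frame g p v]; a second use moves it back. *)
have ds j : sder (fun q => 'd f q (e_ j)) p w ('d (fun q => 'd f q w) p (e_ j)).
  by split; [exact: (c1f _).1|exact: schwarz].
apply: sder_eq (sder_sum _ (fun j => sderM (dfr j) (ds j))) _.
rewrite big_split /=; congr (_ + _).
  by rewrite diff_sum_e mulr_sumr; apply: eq_bigr => j _; rewrite mulrA;
    congr (_ * _); exact: mulrC.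
transitivity ('d (fun q => 'd f q w) p (frame g p v)); last exact: schwarz.
exact: esym (diff_sum_e _ _ _).
Qed.

(** Justifies [lie] as the commutator of left-invariant fields: the second-order parts cancel by
    Schwarz's theorem, and the derivatives of the frames leave exactly the [ad4] terms of the
    bracket. *)
Lemma frame_bracket f p u v a b : Ck 2 f ->
  sder (fun q => 'd f q (frame g q v)) p (frame g p u) a ->
  sder (fun q => 'd f q (frame g q u)) p (frame g p v) b ->
  a - b = 'd f p (frame g p (lie g u v)).
Proof.
move=> cf /(sder_uniq (frame_second p u v cf)) <-.
move=> /(sder_uniq (frame_second p v u cf)) <-.
have cancelr (a1 b1 c1 d1 : R) : c1 = d1 -> (a1 + c1) - (b1 + d1) = a1 - b1.
  by move->; rewrite opprD addrACA subrr addr0.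
apply: etrans (cancelr _ _ _ _ (schwarz p (frame g p v) (frame g p u) cf)) _.
by rewrite /frame /lie mulmxBl -!scalemxAl linearB !linearZ.
Qed.

End Frame.

(** * Naturality of the curvature *)

Lemma e_entry (R : realType) (M : 'M[R]_4) i j :
  (e_ i *m M *m (e_ j)^T) 0 0 = M i j.
Proof. by rewrite /e_ trmx_delta -rowE -colE !mxE. Qed.

(** This and the next lemmas isolate, over bare variables, the rearrangements that follow a product
    rule, so that the arithmetic never meets curvature terms. *)
Lemma derivative_balance2 (R : realFieldType) (a b a' b' : R) :
  0 = a - a' + (b - b') -> - a' - b' = - a - b.
Proof. by move=> e; lra. Qed.

Lemma derivative_balance3 (R : realFieldType) (a b d a' b' d' : R) :
  0 = d - d' + (a - a') + (b - b') -> - a' - b' - d' = - a - b - d.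
Proof. by move=> e; lra. Qed.

Lemma derivative_balance_zmod (V : zmodType) (e a b d e' a' b' d' : V) :
  e - e' = a - a' + (b - b') + (d - d') -> e - a - b - d = 0 ->
  e' - a' - b' - d' = 0.
Proof.
move=> h /eqP; rewrite -!addrA -!opprD subr_eq0 => /eqP h2; apply/eqP.
rewrite subr_eq0 -eqr_opp -(inj_eq (addrI e)) h h2.
by rewrite -addrA (addrACA b) (addrACA a) !opprD.
Qed.

Lemma derivative_balance_mx (R : realType) n (B : 'M[R]_n)
    (e a b d e' a' b' d' : 'rV[R]_n) :
  e *m B - e' = a *m B - a' + (b *m B - b') + (d *m B - d') ->
  e - a - b - d = 0 -> e' - a' - b' - d' = 0.
Proof.
move=> h /(congr1 (mulmx ^~ B)); rewrite mul0mx !mulmxBl.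
exact: derivative_balance_zmod.
Qed.

Section Naturality.
Context {R : realType} (g g' : left_inv_metric R) (c : R).
Local Notation V := 'rV[R]_4.
(** [A p] plays the differential of a homothety, read in the left-invariant frames at p and at its
    image. [hip] is conformality with constant factor c; [hd] says that the connections correspond,
    the derivative of [A] being the correction for frames that are not carried to each other by
    constants. *)
Variable A : V -> 'M[R]_4.
Implicit Types (p u v w x y z : V).
Hypothesis c0 : c != 0.
Hypothesis hA : forall i j, Ck 2 (fun p => A p i j).
Hypothesis hip : forall p u v, ip g' (u *m A p) (v *m A p) = c * ip g u v.
Hypothesis hd : forall p u z, vder (fun q => z *m A q) p (frame g p u)
  (nabla g u z *m A p - nabla g' (u *m A p) (z *m A p)).

Lemma mulmxr_lin (B : 'M[R]_4) : linear (fun x : V => x *m B).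
Proof. by move=> a u v; rewrite mulmxDl scalemxAl. Qed.

Lemma Ck_mulmx k (B : V -> 'M[R]_4) z j :
  (forall i j, Ck k (fun p => B p i j)) -> Ck k (fun q => (z *m B q) 0 j).
Proof.
move=> hB; under eq_fun do rewrite mxE.
by apply: Ck_sum => i; apply: Ck_mul => //; exact: Ck_cst.
Qed.

(** Differentiating [hd] once more, with [hd] itself used for the inner terms, gives [second].
    Applying [frame_bracket] to the entries of [z *m A q] supplies the commutator identity that
    [curv_transfer] needs. *)
Lemma curv_natural p x y z :
  curv g' (x *m A p) (y *m A p) (z *m A p) = curv g x y z *m A p.
Proof.
pose sec u v := second (nabla g) (nabla g') (fun x => x *m A p) u v z.
have der2 u v j : sder (fun q => 'd (fun q => (z *m A q) 0 j) q (frame g q v)) p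
    (frame g p u) (sec u v 0 j).
  have -> : (fun q => 'd (fun q => (z *m A q) 0 j) q (frame g q v)) =
    (fun q => (nabla g v z *m A q - nabla g' (v *m A q) (z *m A q)) 0 j).
    by apply/funext => q; exact: (hd q v z j).2.
  have := vderD (hd p u (nabla g v z))
    (vderN (vder_bilin (@nabla_linl _ g') (@nabla_linr _ g') (hd p u v) (hd p u z))).
  by rewrite opprD addrA; exact.
apply: (curv_transfer (@ip_linl _ g') (@ip_inj _ g') (@nabla_linl _ g)
  (@nabla_linl _ g') (@nabla_linr _ g') (@nabla_torsion _ g)
  (@nabla_torsion _ g') (mulmxr_lin (A p))).
apply/rowP => j; rewrite rowDE rowNE.
have cz : Ck 2 (fun q => (z *m A q) 0 j) by exact: Ck_mulmx.
rewrite -[LHS]/(sec x y 0 j - sec y x 0 j).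
rewrite (frame_bracket cz (der2 x y j) (der2 y x j)).
exact: (hd p (lie g x y) z j).2.
Qed.

Lemma A_gram p : A p *m gram g' *m (A p)^T = c *: gram g.
Proof.
apply/matrixP => i j; have := hip p (e_ i) (e_ j).
rewrite /ip trmx_mul !mulmxA -(mulmxA (e_ i)) -(mulmxA (e_ i) (A p *m _)).
by rewrite !e_entry => ->; rewrite [RHS]mxE.
Qed.

Lemma A_unit p : A p \in unitmx.
Proof.
have /(congr1 determinant) := A_gram p.
rewrite !det_mulmx det_tr detZ unitmxE unitfE => e.
apply: contraTneq (gram_unit g) => A0; move: e; rewrite A0 !mul0r => /esym/eqP.
by rewrite mulf_eq0 expf_eq0 (negPf c0) /= unitmxE unitfE => /eqP->; rewrite eqxx.
Qed.

Lemma A_surj p x : exists y, x = y *m A p.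
Proof. by exists (x *m invmx (A p)); rewrite mulmxKV ?A_unit. Qed.

Lemma ginv_natural p : ginv g' = c^-1 *: ((A p)^T *m ginv g *m A p).
Proof.
rewrite /ginv; have := A_gram p; move: (A_unit p) (gram_unit g) (gram_unit g').
move: (A p) (gram g) (gram g') => B G G' uB uG uG' e.
have e' : G' *m B^T = c *: (invmx B *m G).
  by rewrite scalemxAr -e !mulmxA mulVmx // mul1mx.
rewrite -[LHS]mulmx1; have <- : G' *m (c^-1 *: (B^T *m invmx G *m B)) = 1%:M.
  rewrite -scalemxAr !mulmxA e' -!scalemxAl scalerA mulVf // scale1r.
  by rewrite -[_ *m invmx G]mulmxA mulmxV // mulmx1 mulVmx.
by rewrite mulmxA mulVmx // mul1mx.
Qed.

Lemma Riem_natural p x y z w :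
  Riem g' (x *m A p) (y *m A p) (z *m A p) (w *m A p) = c * Riem g x y z w.
Proof. by rewrite /Riem curv_natural hip. Qed.

Lemma bilinear_natural p (b b' : V -> V -> R) a :
  (forall y, scalar (b' ^~ y)) -> (forall x, scalar (b' x)) ->
  (forall x y, b' (x *m A p) (y *m A p) = a * b x y) ->
  A p *m (\matrix_(i, j) b' (e_ i) (e_ j)) *m (A p)^T =
  a *: \matrix_(i, j) b (e_ i) (e_ j).
Proof.
move=> bl br bb; apply/matrixP => i j.
transitivity (a * b (e_ i) (e_ j)); last by rewrite !mxE.
rewrite -bb (bilinear_mxE _ _ bl br).
rewrite trmx_mul !mulmxA -(mulmxA (e_ i)) -(mulmxA (e_ i) (A p *m _)).
by rewrite e_entry.
Qed.

Lemma trace_natural p (b b' : V -> V -> R) a :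
  (forall y, scalar (b' ^~ y)) -> (forall x, scalar (b' x)) ->
  (forall x y, b' (x *m A p) (y *m A p) = a * b x y) ->
  \sum_(k < 4) \sum_(l < 4) ginv g' k l * b' (e_ k) (e_ l) =
  c^-1 * a * \sum_(k < 4) \sum_(l < 4) ginv g k l * b (e_ k) (e_ l).
Proof.
move=> bl br /(bilinear_natural bl br) /contraction_natural.
move=> /(_ _ _ _ (ginv_natural p)).
have sE (X : 'M[R]_4) (F : V -> V -> R) :
    \sum_(k < 4) \sum_(l < 4) X k l * (\matrix_(k, l) F (e_ k) (e_ l)) k l =
    \sum_(k < 4) \sum_(l < 4) X k l * F (e_ k) (e_ l).
  by apply: eq_bigr => k _; apply: eq_bigr => l _; rewrite mxE.
by rewrite !sE.
Qed.

Lemma ricci_natural p x y : ricci g' (x *m A p) (y *m A p) = ricci g x y.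
Proof.
have := @trace_natural p (fun u v => Riem g x u y v)
  (fun u v => Riem g' (x *m A p) u (y *m A p) v) c.
rewrite mulVf // mul1r; apply=> [v|v|u v].
- exact: Riem_lin2.
- exact: Riem_lin4.
- exact: Riem_natural.
Qed.

Lemma ricci_mx_natural p : A p *m ricci_mx g' *m (A p)^T = ricci_mx g.
Proof.
have := @bilinear_natural p (ricci g) (ricci g') 1.
rewrite scale1r; apply=> [v|v|u v]; first exact: ricci_linl.
- exact: ricci_linr.
- by rewrite mul1r ricci_natural.
Qed.

Lemma Ric_natural p : A p *m Ric g' = c^-1 *: (Ric g *m A p).
Proof.
rewrite /Ric (ginv_natural p) -!scalemxAr -(ricci_mx_natural p) !mulmxA.
by [].
Qed.

Lemma Ric_similar p : Ric g' = c^-1 *: (invmx (A p) *m Ric g *m A p).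
Proof.
rewrite -mulmxA scalemxAr -Ric_natural mulmxA mulVmx ?mul1mx //; exact: A_unit.
Qed.

Lemma scal_natural : scal g' = c^-1 * scal g.
Proof.
rewrite /scal (Ric_similar 0) mxtraceZ -mulmxA mxtrace_mulC -mulmxA mulmxV.
  by rewrite mulmx1.
exact: A_unit.
Qed.

Lemma ricci_norm2_natural : ricci_norm2 g' = c^-1 ^+ 2 * ricci_norm2 g.
Proof.
rewrite /ricci_norm2 (Ric_similar 0) -scalemxAl -scalemxAr !mxtraceZ mulrA.
congr (_ * _); rewrite !mulmxA mxtrace_mulC !mulmxA mulmxV ?A_unit // mul1mx.
by rewrite mulmxK ?A_unit // /Ric !mulmxA.
Qed.

Lemma energy_natural t : energy g' t = c^-1 ^+ 2 * energy g t.
Proof.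
by rewrite /energy ricci_norm2_natural scal_natural; ring.
Qed.

Lemma Riem_ricci_natural p x y :
  Riem_ricci g' (x *m A p) (y *m A p) = c^-1 * Riem_ricci g x y.
Proof.
rewrite /Riem_ricci.
have hB : A p *m (\matrix_(k, l) Riem g' (x *m A p) (e_ k) (y *m A p) (e_ l))
    *m (A p)^T =
    c *: \matrix_(k, l) Riem g x (e_ k) y (e_ l).
  apply: (@bilinear_natural p (fun u v => Riem g x u y v)
      (fun u v => Riem g' (x *m A p) u (y *m A p) v)) => [v|v|u v].
  - exact: Riem_lin2.
  - exact: Riem_lin4.
  - exact: Riem_natural.
have hM : ginv g' *m ricci_mx g' *m ginv g' =
    (c^-1 * c^-1) *: ((A p)^T *m (ginv g *m ricci_mx g *m ginv g) *m A p).
  rewrite (ginv_natural p) -!(scalemxAl, scalemxAr) scalerA; congr (_ *: _).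
  by rewrite -[in RHS](ricci_mx_natural p) !mulmxA.
have := contraction_natural hB hM.
rewrite divfK //.
have sE (X : 'M[R]_4) (F : 'I_4 -> 'I_4 -> R) :
    \sum_(k < 4) \sum_(l < 4) X k l * (\matrix_(k, l) F k l) k l =
    \sum_(k < 4) \sum_(l < 4) F k l * X k l.
  by apply: eq_bigr => k _; apply: eq_bigr => l _; rewrite mxE mulrC.
by rewrite !sE.
Qed.

(** The function b'(xA, yA) is constant, so its product-rule derivative vanishes; [hd] turns this
    into equality of the covariant derivatives. Second derivatives and the derivative of the
    curvature are treated in the same way. *)
Lemma cov_natural (b b' : V -> V -> R) :
  (forall y, scalar (b' ^~ y)) -> (forall x, scalar (b' x)) ->
  (forall y, scalar (b ^~ y)) -> (forall x, scalar (b x)) ->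
  (forall p x y, b' (x *m A p) (y *m A p) = b x y) ->
  forall p w x y, cov g' b' (w *m A p) (x *m A p) (y *m A p) = cov g b w x y.
Proof.
move=> bl' br' bl br bb p w x y.
have := sder_bilin bl' br' (hd p w x) (hd p w y).
have -> : (fun q => b' (x *m A q) (y *m A q)) = (fun=> b x y).
  by apply/funext => q; exact: bb.
move=> /(sder_uniq (sder_cst _ _ _)).
rewrite (linearPD (W := R^o) _ _ (bl' _)) (linearPN (W := R^o) _ (bl' _)).
rewrite (linearPD (W := R^o) _ _ (br' _)) (linearPN (W := R^o) _ (br' _)).
rewrite /cov !bb; exact: derivative_balance2.
Qed.

Lemma cov2_natural (b b' : V -> V -> R) :
  (forall y, scalar (b' ^~ y)) -> (forall x, scalar (b' x)) ->
  (forall y, scalar (b ^~ y)) -> (forall x, scalar (b x)) ->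
  (forall p x y, b' (x *m A p) (y *m A p) = b x y) ->
  forall p v w x y, cov2 g' b' (v *m A p) (w *m A p) (x *m A p) (y *m A p) =
    cov2 g b v w x y.
Proof.
move=> bl' br' bl br bb p v w x y; have cc := cov_natural bl' br' bl br bb.
have := sder_trilin (fun y z => @cov_lin1 _ g' _ bl' br' y z)
  (fun x z => @cov_lin2 _ g' _ bl' x z) (fun x y => @cov_lin3 _ g' _ br' x y)
  (hd p v w) (hd p v x) (hd p v y).
have -> : (fun q => cov g' b' (w *m A q) (x *m A q) (y *m A q)) =
    (fun=> cov g b w x y) by apply/funext => q; exact: cc.
move=> /(sder_uniq (sder_cst _ _ _)).
have l1 y z := @cov_lin1 _ g' _ bl' br' y z.
have l2 y z := @cov_lin2 _ g' _ bl' y z.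
have l3 y z := @cov_lin3 _ g' _ br' y z.
rewrite (linearPD (W := R^o) _ _ (l1 _ _)) (linearPN (W := R^o) _ (l1 _ _)).
rewrite (linearPD (W := R^o) _ _ (l2 _ _)) (linearPN (W := R^o) _ (l2 _ _)).
rewrite (linearPD (W := R^o) _ _ (l3 _ _)) (linearPN (W := R^o) _ (l3 _ _)).
rewrite !cc => e; rewrite /cov2 /(cov _ (cov _ _ _)) /(cov _ (cov _ _ _)).
exact: derivative_balance3 e.
Qed.

Lemma rough_laplacian_natural p x y :
  rough_laplacian g' (ricci g') (x *m A p) (y *m A p) =
  c^-1 * rough_laplacian g (ricci g) x y.
Proof.
have rl h y := @ricci_linl R h y; have rr h y := @ricci_linr R h y.
have := @trace_natural p (fun u v => cov2 g (ricci g) u v x y)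
  (fun u v => cov2 g' (ricci g') u v (x *m A p) (y *m A p)) 1.
rewrite mulr1; apply=> [v|v|u v].
- exact: (@cov2_lin1 _ g' _ (rl g') (rr g')).
- exact: (@cov2_lin2 _ g' _ (rl g') (rr g')).
- rewrite mul1r; apply: cov2_natural; [exact: rl|exact: rr|exact: rl|exact: rr|].
  exact: ricci_natural.
Qed.

(** Every term of the equation scales by c^-1: in the metric term the energy contributes c^-2 and
    the metric c. *)
Lemma critical_natural t : critical g t -> critical g' t.
Proof.
move=> cg x' y'; have [x ->] := A_surj 0 x'; have [y ->] := A_surj 0 y'.
rewrite rough_laplacian_natural energy_natural hip Riem_ricci_natural scal_natural.
rewrite ricci_natural -[RHS](mulr0 c^-1) -(cg x y).
have : c^-1 ^+ 2 * c = c^-1 by rewrite expr2 mulrVK ?unitfE.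
move: (rough_laplacian _ _ _ _) (energy _ _) (ip _ _ _) (Riem_ricci _ _ _).
move: (scal _) (ricci _ _ _) c^-1 => sc ri ci la en inn rr e.
have -> : ci ^+ 2 * en / 2 * (c * inn) = ci ^+ 2 * c * (en / 2 * inn) by ring.
by rewrite e; ring.
Qed.

Lemma locally_symmetric_natural : locally_symmetric g -> locally_symmetric g'.
Proof.
move=> sg v' x' y' z'; pose p : V := 0.
have [v ->] := A_surj p v'; have [x ->] := A_surj p x'.
have [y ->] := A_surj p y'; have [z ->] := A_surj p z'.
have := vder_trilin (@curv_lin1 _ g') (@curv_lin2 _ g') (@curv_lin3 _ g')
  (hd p v x) (hd p v y) (hd p v z).
have -> : (fun q => curv g' (x *m A q) (y *m A q) (z *m A q)) =
    (fun q => curv g x y z *m A q) by apply/funext => q; exact: curv_natural.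
move=> /(vder_uniq (hd p v (curv g x y z))).
have l1 y z := @curv_lin1 _ g' y z.
have l2 y z := @curv_lin2 _ g' y z.
have l3 y z := @curv_lin3 _ g' y z.
rewrite (linearPD _ _ (l1 _ _)) (linearPN _ (l1 _ _)).
rewrite (linearPD _ _ (l2 _ _)) (linearPN _ (l2 _ _)).
rewrite (linearPD _ _ (l3 _ _)) (linearPN _ (l3 _ _)).
rewrite !curv_natural => e.
exact: derivative_balance_mx e (sg v x y z).
Qed.

End Naturality.

Lemma symmetric_difference (V : zmodType) (e e' l l' n1 n2 n1' n2' : V) :
  e - e' + l' = l -> n1 - n2 = l -> n1' - n2' = l' ->
  e - (n1 - n1') = e' - (n2 - n2').
Proof.
move=> h1 h2 h3.
have -> : e = l - l' + e' by rewrite -h1 addrK subrK.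
have -> : n1 - n1' = (l - l') + (n2 - n2').
  by rewrite -h2 -h3 opprB addrAC !subrKA.
by rewrite opprD addrACA subrr add0r.
Qed.

Lemma skew_difference (R : realFieldType) (e e' n1 n2 n1' n2' : R) :
  e + e' = 0 -> n1 + n2 = 0 -> n1' + n2' = 0 ->
  e - (n1 - n1') = - (e' - (n2 - n2')).
Proof. by move=> h1 h2 h3; lra. Qed.

Lemma emxN (R : realType) n (M : 'M[R]_n.+1) s : emx M (- s) = emx (- M) s.
Proof. by rewrite -[- M]scaleN1r emxZ mulN1r. Qed.

(** * The differential of a homothety in left-invariant frames *)

Section HomothetyFrame.
Context {R : realType} (g g' : left_inv_metric R) (c : R).
Local Notation V := 'rV[R]_4.
Variable phi : V -> V.
Implicit Types (p u v w x y z : V).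
Hypothesis c0 : c != 0.
Hypothesis phi_smooth : smooth phi.
Hypothesis phi_homothety : forall p u v,
  metric_at g' (phi p) ('d phi p u) ('d phi p v) = c * metric_at g p u v.

(** The first exponential passes from the frame of g at p to coordinates, the last one from
    coordinates to the frame of g' at [phi p]. *)
Definition frame_mx p : 'M[R]_4 :=
  emx (ad4 g) (p 0 ord_max) *m jacobian phi p
  *m emx (ad4 g') (- (phi p) 0 ord_max).

Lemma Ck_mulmx2 k (B C : V -> 'M[R]_4) :
  (forall i j, Ck k (fun p => B p i j)) -> (forall i j, Ck k (fun p => C p i j)) ->
  forall i j, Ck k (fun p => (B p *m C p) i j).
Proof.
move=> hB hC i j; under eq_fun do rewrite mxE.
by apply: Ck_sum => l; apply: Ck_mul.
Qed.

Lemma Ck_emx k (M : 'M[R]_4) (f : V -> R) i j : Ck k f ->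
  Ck k (fun p => emx M (f p) i j).
Proof.
move=> cf; apply: (Ck_comp (h := fun s => emx M s i j)) => //.
by have := Ck1_emx M 1%:M k i j; under eq_fun do rewrite mul1mx.
Qed.

Lemma Ck_phi k j : Ck k (fun p => phi p 0 j).
Proof. exact: class_C_entry. Qed.

Lemma frame_mx_smooth k i j : Ck k (fun p => frame_mx p i j).
Proof.
apply: Ck_mulmx2 => {i j}; first apply: Ck_mulmx2 => i j.
- by apply: Ck_emx; exact: Ck_coord.
- have [_ /(_ (delta_mx 0 i)) /(class_C_entry j)] := phi_smooth k.+1.
  by congr Ck; apply/funext => p; rewrite !mxE.
- move=> i j; rewrite (_ : (fun p => _) =
    (fun p => emx (- ad4 g') (phi p 0 ord_max) i j)).
    by apply: Ck_emx; exact: Ck_phi.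
  by apply/funext => p; rewrite emxN.
Qed.

Lemma diff_phi_frame p u :
  'd phi p (frame g p u) = frame g' (phi p) (u *m frame_mx p).
Proof.
rewrite /frame_mx /frame !mulmxA -(mulmxA _ (emx _ (- _))) emxNK mulmx1.
by rewrite /jacobian mul_rV_lin1.
Qed.

Lemma ip_frame_mx p u v :
  ip g' (u *m frame_mx p) (v *m frame_mx p) = c * ip g u v.
Proof.
have := phi_homothety p (frame g p u) (frame g p v).
rewrite /metric_at !dtranslE !diff_phi_frame /frame.
by rewrite -!(mulmxA _ (emx _ _) (emx _ (- _))) !emxKN !mulmx1.
Qed.

Definition dframe p w : 'M[R]_4 := \matrix_(i, j) 'd (fun q => frame_mx q i j) p w.

Lemma vder_mul_frame_mx p w z : vder (fun q => z *m frame_mx q) p w (z *m dframe p w).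
Proof.
move=> j; rewrite mxE.
have -> : (fun q => (z *m frame_mx q) 0 j) =
    (fun q => \sum_i z 0 i * frame_mx q i j) by apply/funext => q; rewrite mxE.
apply: sder_sum => i; rewrite mxE.
apply: sder_eq (sderM (sder_cst _ _ _) _) _.
  by split; first exact: (frame_mx_smooth 1 i j).1.
by rewrite mul0r add0r.
Qed.

(** [frame_bracket] applied to the coordinate functions of [phi]: the differential preserves
    commutators, but the images of left-invariant fields have variable coefficients, whence the two
    [dframe] terms. *)
Lemma frame_mx_torsion p u v :
  v *m dframe p (frame g p u) - u *m dframe p (frame g p v)
  + lie g' (u *m frame_mx p) (v *m frame_mx p) = lie g u v *m frame_mx p.
Proof.
pose L := emx (ad4 g') (phi p 0 ord_max).
pose E u v := v *m dframe p (frame g p u).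
have dphi q w j : 'd (fun q => phi q 0 j) q (frame g q w) =
    (w *m frame_mx q *m emx (ad4 g') (phi q 0 ord_max)) 0 j.
  by rewrite diff_mxE ?diff_phi_frame //; exact: (phi_smooth 1).1.
have key x y j : sder (fun q => 'd (fun q => phi q 0 j) q (frame g q y)) p (frame g p x)
    (((E x y + (x *m frame_mx p) 0 ord_max *: (y *m frame_mx p *m ad4 g')) *m L) 0 j).
  have -> : (fun q => 'd (fun q => phi q 0 j) q (frame g q y)) =
      (fun q => \sum_l (y *m frame_mx q) 0 l * emx (ad4 g') (phi q 0 ord_max) l j).
    by apply/funext => q; rewrite dphi mxE.
  have d4 : sder (fun q => phi q 0 ord_max) p (frame g p x)
      ((x *m frame_mx p) 0 ord_max).
    split; first exact: (Ck_phi 1 ord_max).1.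
    by rewrite dphi emx_ad4_col4.
  have dl l : sder (fun q => emx (ad4 g') (phi q 0 ord_max) l j) p (frame g p x)
      ((ad4 g' *m L) l j * (x *m frame_mx p) 0 ord_max).
    exact: (sder_comp1 (f := fun q => phi q 0 ord_max)
      (is_derive_emx (ad4 g') l j (phi p 0 ord_max)) d4).
  apply: sder_eq (sder_sum _ (fun l => sderM (vder_mul_frame_mx _ _ _ l) (dl l))) _.
  rewrite big_split mulmxDl /= [RHS]mxE; congr (_ + _); first by rewrite mxE.
  rewrite -scalemxAl -mulmxA [RHS]mxE [X in _ = _ * X]mxE mulr_sumr.
  by apply: eq_bigr => l _; rewrite mulrA mulrC.
have uL : L *m emx (ad4 g') (- phi p 0 ord_max) = 1%:M by exact: emxKN.
suff e : (E u v + (u *m frame_mx p) 0 ord_max *: (v *m frame_mx p *m ad4 g')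
    - (E v u + (v *m frame_mx p) 0 ord_max *: (u *m frame_mx p *m ad4 g'))) *m L =
    lie g u v *m frame_mx p *m L.
  have := congr1 (fun M => M *m emx (ad4 g') (- phi p 0 ord_max)) e.
  by rewrite -!(mulmxA _ L) uL !mulmx1 => <-; rewrite opprD addrACA.
apply/rowP => j; rewrite mulmxBl rowDE rowNE.
by rewrite (frame_bracket (Ck_phi 2 j) (key u v j) (key v u j)) dphi.
Qed.

Lemma frame_mx_metric p w u v :
  ip g' (u *m dframe p w) (v *m frame_mx p)
  + ip g' (u *m frame_mx p) (v *m dframe p w) = 0.
Proof.
have := sder_bilin (@ip_linl _ g') (@ip_linr _ g') (vder_mul_frame_mx p w u)
  (vder_mul_frame_mx p w v).
have -> : (fun q => ip g' (u *m frame_mx q) (v *m frame_mx q)) =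
    (fun=> c * ip g u v) by apply/funext => q; exact: ip_frame_mx.
by move=> /(sder_uniq (sder_cst _ _ _)).
Qed.

(** The discrepancy [B] is symmetric because both connections are torsion-free, and skew after
    pairing because both are metric and the factor c is constant. Such a tensor vanishes. *)
Lemma vder_frame_mx p u z : vder (fun q => z *m frame_mx q) p (frame g p u)
  (nabla g u z *m frame_mx p - nabla g' (u *m frame_mx p) (z *m frame_mx p)).
Proof.
apply: vder_eq (vder_mul_frame_mx p (frame g p u) z) _.
pose F := frame_mx p; pose E u v := v *m dframe p (frame g p u).
pose B u v := E u v - (nabla g u v *m F - nabla g' (u *m F) (v *m F)).
suff B0 : forall u v, B u v = 0 by apply/eqP; rewrite -subr_eq0; apply/eqP/B0.
clear u z.
have Bs x y : B x y = B y x.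
  have h1 := frame_mx_torsion p x y.
  have h2 := congr1 (fun t => t *m F) (nabla_torsion g x y); rewrite /= mulmxBl in h2.
  have h3 := nabla_torsion g' (x *m F) (y *m F).
  exact: symmetric_difference h1 h2 h3.
have Bk x y z : ip g' (B x y) (z *m F) = - ip g' (B x z) (y *m F).
  have h1 := frame_mx_metric p (frame g p x) y z; rewrite [X in _ + X]ipC in h1.
  have h2 : ip g' (nabla g x y *m F) (z *m F) + ip g' (nabla g x z *m F) (y *m F) = 0.
    rewrite !ip_frame_mx -mulrDr [X in _ * (_ + X)]ipC nabla_metric; exact: mulr0.
  have h3 := nabla_metric g' (x *m F) (y *m F) (z *m F); rewrite [X in _ + X]ipC in h3.
  rewrite /B !(ipDl _ (E _ _)) !(ipNl _ (_ - _)) !(ipDl _ (_ *m F)) !(ipNl _ (nabla _ _ _)).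
  exact: skew_difference h1 h2 h3.
move=> x y; apply: (@ip_inj _ g') => w.
have [z ->] := A_surj c0 ip_frame_mx p w.
have Ts a b d : ip g' (B a b) (d *m F) = ip g' (B b a) (d *m F) by rewrite Bs.
apply: etrans (symmetric_skew_eq0 Ts Bk x y z) _.
by rewrite -[0 in RHS](scale0r w) ipZl mul0r.
Qed.

End HomothetyFrame.

Lemma diff_idE (R : realType) (V : normedModType R) (p v : V) :
  'd (@id V) p v = v.
Proof. by rewrite diff_val. Qed.

Section HomothetyInvariance.
Context {R : realType}.
Implicit Types (g : left_inv_metric R) (t : R).

Lemma homothetic_sym g g' : homothetic g g' -> homothetic g' g.
Proof.
move=> [phi [psi [c [[sphi spsi phiK psiK] [c0 hphi]]]]].
exists psi, phi, c^-1; split; first by split.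
split=> [|q u v]; first by rewrite invr_gt0.
have dK w : 'd phi (psi q) ('d psi q w) = w.
  have idE : phi \o psi = id by apply/funext => x /=.
  have := congr1 (fun F => F w)
    (diff_comp ((spsi 1).1 q) ((sphi 1).1 (psi q))).
  by rewrite {1}idE => /esym h; exact: etrans h (diff_idE q w).
have h : metric_at g' q u v = c * metric_at g (psi q) ('d psi q u) ('d psi q v).
  apply: etrans (hphi (psi q) ('d psi q u) ('d psi q v)).
  have cong x y x' y' : x' = x -> y' = y ->
      metric_at g' q x y = metric_at g' (phi (psi q)) x' y'.
    by move=> -> ->; rewrite psiK.
  exact: cong (dK u) (dK v).
by rewrite h mulrA mulVf ?mul1r // gt_eqF.
Qed.

Lemma homothetic_natural g g' t : homothetic g g' ->
  [/\ critical g t -> critical g' t,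
      locally_symmetric g -> locally_symmetric g' &
      energy g t = 0 -> energy g' t = 0].
Proof.
move=> [phi [psi [c [[sphi _ _ _] [cgt0 hphi]]]]].
have c0 : c != 0 by rewrite gt_eqF.
have sA i j : Ck 2 (fun p => frame_mx g g' phi p i j) by exact: frame_mx_smooth.
have iA p u v := ip_frame_mx hphi p u v.
have dA p u z := vder_frame_mx c0 sphi hphi p u z.
split; first exact: critical_natural c0 sA iA dA t.
- exact: locally_symmetric_natural c0 sA iA dA.
- by move=> e; rewrite (energy_natural c0 sA iA dA) e mulr0.
Qed.

Lemma homothetic_critical g g' t : homothetic g g' -> critical g t <-> critical g' t.
Proof.
move=> h; split; first by case: (homothetic_natural t h).
by case: (homothetic_natural t (homothetic_sym h)).
Qed.

Lemma homothetic_locally_symmetric g g' :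
  homothetic g g' -> locally_symmetric g <-> locally_symmetric g'.
Proof.
move=> h; split; first by case: (homothetic_natural 0 h).
by case: (homothetic_natural 0 (homothetic_sym h)).
Qed.

Lemma homothetic_energy0 g g' t :
  homothetic g g' -> energy g t = 0 <-> energy g' t = 0.
Proof.
move=> h; split; first by case: (homothetic_natural t h).
by case: (homothetic_natural t (homothetic_sym h)).
Qed.

End HomothetyInvariance.

(** * Homotheties between left-invariant metrics *)

(** The primitive is a block of the exponential of an enlarged matrix, so no inverse of M is
    involved; in the application M is a multiple of [ad4], which is singular. *)
Lemma mx_derive_primitive (R : realType) m n (f : 'M[R]_(m.+1, n.+1)) (M : 'M[R]_n.+1) :
  exists G : R -> 'M[R]_(m.+1, n.+1), mx_derive G (fun s => f *m emx M s) /\ G 0 = 0.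
Proof.
pose B : 'M[R]_(n.+1 + m.+1) := block_mx M 0 f 0.
pose E s : 'M[R]_(n.+1 + m.+1) := @emx R (n + m.+1) B s.
have dE s i j : is_derive s (1 : R) (fun s => E s i j) ((B *m E s) i j).
  exact: (@is_derive_emx R (n + m.+1) B i j s).
have Eul s : ulsubmx (E s) = emx M s.
  pose P : 'M[R]_(n.+1, n.+1 + m.+1) := row_mx 1%:M 0.
  have h0 : P *m B = M *m P.
    rewrite /P /B mul_row_block mul_mx_row.
    by rewrite !mul1mx !mul0mx mulmx1 mulmx0 !addr0.
  have h : P *m E s = emx M s *m P := @emx_intertwine R n (n + m.+1) M B P s h0.
  have := congr1 lsubmx h; rewrite /P mul_mx_row mulmx1 row_mxKl => <-.
  rewrite -{2}[E s]submxK mul_row_block row_mxKl.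
  by rewrite mul1mx mul0mx addr0.
exists (fun s => dlsubmx (E s)); split=> [s i j|]; last first.
  by rewrite /E emx0 -[1%:M]/(1%:M : 'M[R]_(n.+1 + m.+1)) scalar_mx_block block_mxKdl.
have -> : (f *m emx M s) i j = (B *m E s) (rshift _ i) (lshift _ j).
  rewrite -Eul -{2}[E s]submxK /B mulmx_block block_mxEdl.
  by rewrite mul0mx addr0.
have := dE s (rshift _ i) (lshift _ j).
by rewrite (_ : (fun s => dlsubmx (E s) i j) = (fun s => E s (rshift _ i) (lshift _ j)))
  //; apply/funext => x; rewrite !mxE.
Qed.

Section SmoothMaps.
Context {R : realType}.
Local Notation V := 'rV[R]_4.
Implicit Types (F : V -> V) (p u v w : V).

Lemma differentiable_rV F p :
  (forall j, differentiable (fun q => F q 0 j) p) -> differentiable F p.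
Proof.
move=> dF; have -> : F = \sum_(j < 4) (fun q => F q 0 j *: e_ j).
  by apply/funext => q; rewrite fct_sumE; exact: rV_sum_e.
by apply: differentiable_sum => j; exact: differentiableZl.
Qed.

Lemma diff_vder F p : (forall w, exists d, vder F p w d) ->
  differentiable F p /\ forall w d, vder F p w d -> 'd F p w = d.
Proof.
move=> hF; have dF : differentiable F p.
  by apply: differentiable_rV => j; have [d /(_ j) []] := hF 0.
split=> // w d Fd; apply/rowP => j.
by rewrite -diff_mxE // (Fd j).2.
Qed.

Lemma vder_curve (H H' : R -> 'rV[R]_4) p w : mx_derive H H' ->
  vder (fun q => H (q 0 ord_max)) p w (w 0 ord_max *: H' (p 0 ord_max)).
Proof.
move=> dH j; rewrite rowZE mulrC.
exact: (sder_comp1 (f := fun q : V => q 0 ord_max) (dH (p 0 ord_max) 0 j)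
  (sder_coord _ _ _)).
Qed.

Lemma vder_affine (N : 'M[R]_4) (H H' : R -> 'rV[R]_4) p w : mx_derive H H' ->
  vder (fun q => q *m N + H (q 0 ord_max)) p w
    (w *m N + w 0 ord_max *: H' (p 0 ord_max)).
Proof.
move=> dH; apply: vderD; last exact: vder_curve.
move=> j; rewrite mxE; under eq_fun do rewrite mxE.
apply: sder_sum => i.
apply: sder_eq (sderM (sder_coord _ _ _) (sder_cst _ _ _)) _.
by rewrite mulr0 addr0.
Qed.

Section ExponentialCurves.
Variables (M C : 'M[R]_4) (a : R).

(** A family closed under differentiation, so that smoothness of all orders follows by induction
    without formulas for higher derivatives. *)
Let curve (y x : V) (s : R) : V := y + x *m emx M (a * s) *m C.

Lemma mx_derive_curve y x :
  mx_derive (curve y x) (fun s => curve 0 (a *: x *m M) s).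
Proof.
move=> s i j; rewrite /curve add0r.
have := mx_deriveM (mx_deriveM (mx_derive_cst x) (mx_derive_emxa M a))
  (mx_derive_cst C).
move=> /(mx_derive_eq (F'' := fun s => a *: x *m M *m emx M (a * s) *m C)) h.
have {}h : mx_derive (fun s => x *m emx M (a * s) *m C)
    (fun s => a *: x *m M *m emx M (a * s) *m C).
  apply: h => t.
  by rewrite mul0mx add0r mulmx0 addr0 -scalemxAr !mulmxA -!scalemxAl.
have -> : (fun s => (y + x *m emx M (a * s) *m C) i j) =
    cst (y i j) + (fun s => (x *m emx M (a * s) *m C) i j).
  by apply/funext => t; rewrite mxE.
by rewrite -[X in is_derive _ _ _ X]add0r; exact: is_deriveD.
Qed.

Lemma class_C_curve k y x : class_C k (fun q : V => curve y x (q 0 ord_max)).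
Proof.
have hv y1 x1 q w := @vder_curve _ _ q w (mx_derive_curve y1 x1).
have hd y1 x1 q := diff_vder (fun w => ex_intro _ _ (hv y1 x1 q w)).
elim: k y x => [|k IH] y x.
  by move=> q; apply: differentiable_continuous; exact: (hd y x q).1.
split=> [q|v]; first exact: (hd y x q).1.
rewrite (_ : (fun q => 'd _ q v) =
  (fun q => curve 0 (v 0 ord_max *: (a *: x *m M)) (q 0 ord_max))); first exact: IH.
apply/funext => q; rewrite ((hd y x q).2 _ _ (hv y x q v)).
by rewrite /curve !add0r !scalemxAl.
Qed.

Lemma smooth_affine (N : 'M[R]_4) (H : R -> V) y x : mx_derive H (curve y x) ->
  smooth (fun q => q *m N + H (q 0 ord_max)).
Proof.
move=> dH k; have hv q w := @vder_affine N _ _ q w dH.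
have hd q := diff_vder (fun w => ex_intro _ _ (hv q w)).
case: k => [|k].
  by move=> q; apply: differentiable_continuous; exact: (hd q).1.
split=> [q|v]; first exact: (hd q).1.
rewrite (_ : (fun q => 'd _ q v) = (fun q => curve (v *m N + v 0 ord_max *: y)
  (v 0 ord_max *: x) (q 0 ord_max))); first exact: class_C_curve.
apply/funext => q; rewrite ((hd q).2 _ _ (hv q v)).
by rewrite /curve scalerDr !scalemxAl addrA.
Qed.

End ExponentialCurves.
End SmoothMaps.

(** * Adapted bases, and the homothety that removes a commuting skew part *)

Definition orth_metric (R : realType) (M : 'M[R]_3) : left_inv_metric R :=
  LeftInvMetric (- M) (trmx1 R 4) gram1_pos.

(* The rows of [adapted Q v a] are a basis whose first three vectors span the
   Abelian ideal. *)
Definition adapted (R : realType) (Q : 'M[R]_3) (v : 'rV[R]_3) (a : R) : 'M[R]_4 :=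
  block_mx Q 0 v a%:M : 'M[R]_(3 + 1).

(* In some adapted basis, orthonormal up to the factor [c], the derivation
   becomes [- M]. *)
Definition rep (R : realType) (g : left_inv_metric R) (M : 'M[R]_3) : Prop :=
  exists (Q : 'M[R]_3) (v : 'rV[R]_3) (a c : R),
    [/\ Q \in unitmx, a != 0, 0 < c, a *: (Q *m der g) = - (M *m Q) &
        adapted Q v a *m gram g *m (adapted Q v a)^T = c%:M].

Section Blocks.
Context {R : realType}.
Implicit Types (X Y : 'M[R]_3) (x : 'rV[R]_4).

Definition blk X (b : R) : 'M[R]_4 := block_mx X 0 0 b%:M : 'M[R]_(3 + 1).

Lemma blkM X Y a b : blk X a *m blk Y b = blk (X *m Y) (a * b).
Proof.
apply: etrans (@mulmx_block _ 3 1 3 1 3 1 _ _ _ _ _ _ _ _) _.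
by rewrite !mulmx0 !mul0mx !addr0 add0r -scalar_mxM.
Qed.

Lemma blkD X Y a b : blk X a + blk Y b = blk (X + Y) (a + b).
Proof.
by rewrite /blk (@add_block_mx _ 3 1 3 1) !addr0 -raddfD.
Qed.

Lemma blk1 : blk 1%:M 1 = 1%:M.
Proof. exact: esym (@scalar_mx_block R 3 1 1). Qed.

Lemma blk_tr X a : (blk X a)^T = blk X^T a.
Proof.
by apply: etrans (@tr_block_mx _ 3 1 3 1 _ _ _ _) _; rewrite !trmx0 tr_scalar_mx.
Qed.

Lemma blk01 : blk 0 1 = delta_mx ord_max ord_max.
Proof.
apply/matrixP => i j; rewrite !mxE.
case: splitP => k ek; rewrite !mxE; case: splitP => l el; rewrite !mxE -!val_eqE /= ek el.
- by rewrite (ltn_eqF (ltn_ord k)).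
- by rewrite (ltn_eqF (ltn_ord k)).
- by rewrite (ltn_eqF (ltn_ord l)) andbF.
- by rewrite !ord1.
Qed.

Lemma mul_blk01 x : x *m blk 0 1 = x 0 ord_max *: e_ ord_max.
Proof.
rewrite blk01; apply/rowP => j; rewrite !mxE (bigD1 ord_max) //= big1 ?addr0.
  by rewrite !mxE eqxx.
by move=> i; rewrite mxE => /negPf->; rewrite mulr0.
Qed.

Lemma blk00 : blk 0 0 = 0.
Proof. by rewrite /blk raddf0 block_mx0. Qed.

Lemma e4E : e_ ord_max = row_mx 0 1%:M :> 'rV[R]_(3 + 1).
Proof.
apply/rowP => j; rewrite !mxE; case: splitP => k ek; rewrite !mxE -!val_eqE /= ek.
  by rewrite (ltn_eqF (ltn_ord k)).
by rewrite !ord1.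
Qed.

Lemma mul_blk0_col4 X x : (x *m blk X 0) 0 ord_max = 0.
Proof.
have e4 (y : 'rV[R]_4) : y 0 ord_max = (y *m blk 0 1) 0 ord_max.
  by rewrite mul_blk01 !mxE !eqxx mulr1.
rewrite e4 -mulmxA blkM mulmx0 mul0r.
by rewrite blk00 mulmx0 mxE.
Qed.

Lemma mul_blk10 x : x *m blk 1%:M 0 = x - x 0 ord_max *: e_ ord_max.
Proof.
apply/eqP; rewrite eq_sym subr_eq -mul_blk01 -mulmxDr blkD addr0 add0r blk1.
by rewrite mulmx1.
Qed.

Lemma dtransl_blk (g : left_inv_metric R) s : dtransl g s = blk (emx (der g) s) 1.
Proof. by rewrite /dtransl expmxE. Qed.

Lemma mul_blk0_adapted X Q v a : blk X 0 *m adapted Q v a = blk (X *m Q) 0.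
Proof.
apply: etrans (@mulmx_block _ 3 1 3 1 3 1 _ _ _ _ _ _ _ _) _.
rewrite /blk (_ : 0%:M = 0 :> 'M[R]_1); last exact: raddf0.
by rewrite !mulmx0 !mul0mx !addr0.
Qed.

Lemma mul_e4_adapted (Q : 'M[R]_3) v a : e_ ord_max *m adapted Q v a = row_mx v a%:M.
Proof.
rewrite e4E; apply: etrans (@mul_row_block _ 1 3 1 3 1 _ _ _ _ _ _) _.
by rewrite !mul0mx !add0r !mul1mx.
Qed.

End Blocks.

Lemma emx_skew_orth (R : realType) n (A : 'M[R]_n.+1) s :
  A^T = - A -> emx A s *m (emx A s)^T = 1%:M.
Proof. by move=> At; rewrite emx_tr At -emxN emxKN. Qed.

Section RepHomothety.
Context {R : realType} (g : left_inv_metric R) (S A : 'M[R]_3).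
Local Notation V := 'rV[R]_4.

(** [H] is the one-parameter subgroup of the fourth adapted vector, and [chi] sends (x, s) to the
    product of (x Q, 0) with [H s]. In left-invariant frames its differential is the adapted basis
    preceded by the rotation [O] = exp(s A) of the ideal, which keeps orthonormality. Commutation of
    S and A lets the exponential of S + A split. *)
Lemma rep_homothetic_normal : rep g (S + A) -> S *m A = A *m S -> A^T = - A ->
  homothetic g (orth_metric S).
Proof.
move=> [Q [v [a [c [uQ a0 c0 QD]]]]]; set P := adapted _ _ _ => PG SA At.
apply: homothetic_sym.
pose f4 : 'rV[R]_4 := row_mx v a%:M : 'rV[R]_(3 + 1).
have [H [dH H0]] := mx_derive_primitive (f4 : 'M[R]_(1, 4)) (a *: ad4 g).
have {}dH : mx_derive H (fun s => f4 *m emx (ad4 g) (a * s)).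
  by apply: mx_derive_eq dH _ => s; rewrite emxZ.
have H4 s : H s 0 ord_max = a * s.
  have d s' : is_derive s' (1 : R) (fun s => H s 0 ord_max - a * s) 0.
    have h := dH s' 0 ord_max; rewrite emx_ad4_col4 in h.
    rewrite (_ : (fun s => _) = (fun s => H s 0 ord_max) - (a *: @id R)) //.
    apply: is_derive_eq; rewrite [a *: 1]mulr1 /f4.
    by rewrite mxE; case: splitP => j //= ej; rewrite ?mxE ?ord1 ?eqxx ?subrr //;
      have := ltn_ord j; rewrite -ej.
  have := is_derive_0_is_cst s 0 d.
  by rewrite H0 mxE mulr0 subrr => /eqP; rewrite subr_eq0 => /eqP.
pose N0 := blk (invmx Q) 0.
have a1 : blk 0 a^-1 = a^-1 *: blk 0 1 :> 'M[R]_4.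
  by apply: esym; apply: etrans (@scale_block_mx _ 3 1 3 1 _ _ _ _ _) _;
    rewrite !scaler0 scale_scalar_mx mulr1.
pose chi q := q *m blk Q 0 + H (q 0 ord_max).
pose psi q := q *m (N0 + blk 0 a^-1) + H (a^-1 * q 0 ord_max) *m - N0.
have chi4 q : chi q 0 ord_max = a * q 0 ord_max.
  by rewrite /chi rowDE mul_blk0_col4 H4 add0r.
have psi4 q : psi q 0 ord_max = a^-1 * q 0 ord_max.
  rewrite /psi mulmxDr mulmxN 2!rowDE rowNE !mul_blk0_col4 a1 -scalemxAr rowZE.
  by rewrite mul_blk01 rowZE !mxE !eqxx /=; ring.
exists chi, psi, c; split; last split=> // q u w.
  split.
  - apply: (@smooth_affine _ (ad4 g) 1%:M a _ _ 0 f4).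
    by apply: mx_derive_eq dH _ => s; rewrite mulmx1 add0r.
  - apply: (@smooth_affine _ (ad4 g) (- N0) 1 _ (fun s => H (a^-1 * s) *m - N0) 0
      (a^-1 *: (f4 : 'rV[R]_4))).
    apply: mx_derive_eq (mx_deriveM (mx_derive_scale a^-1 dH) (mx_derive_cst (- N0))) _.
    by move=> s; rewrite mulmx0 addr0 add0r mul1r mulVKf // -!scalemxAl.
  - move=> q; rewrite {1}/psi chi4 mulKf // mulmxDr a1 -scalemxAr mul_blk01 chi4.
    rewrite scalerA mulKf // addrAC mulmxN {1}/chi mulmxDl addrK.
    by rewrite -mulmxA blkM mulr0 mulmxV // mul_blk10 subrK.
  - move=> q; rewrite {1}/chi psi4 /psi mulmxN mulmxDr addrAC -mulmxBl.
    set h := H _; rewrite mulmxDl -!mulmxA !blkM mul0mx !mulr0 mulVmx //.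
    rewrite blk00 mulmx0 addr0 mul_blk10 rowDE rowNE H4 mulVKf // subrr scale0r subr0.
    by rewrite subrK.
pose s := q 0 ord_max.
have dchi w1 : 'd chi q w1 = w1 *m blk Q 0 + w1 0 ord_max *: (f4 *m emx (ad4 g) (a * s)).
  have hv w2 := @vder_affine _ (blk Q 0) _ _ q w2 dH.
  exact: (diff_vder (fun w2 => ex_intro _ _ (hv w2))).2.
pose O := emx (- A) (- s).
have OO : O *m O^T = 1%:M by apply: emx_skew_orth; rewrite linearN /= At.
have key w1 : 'd chi q w1 *m dtransl g (- (a * s)) =
    w1 *m dtransl (orth_metric S) (- s) *m blk O 1 *m P.
  have e4P : e_ ord_max *m P = f4 by exact: mul_e4_adapted.
  have blkP X : blk X 0 *m P = blk (X *m Q) 0 by exact: mul_blk0_adapted.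
  have QO : Q *m emx (der g) (- (a * s)) = emx (- S) (- s) *m O *m Q.
    rewrite -mulrN -emxZ -emxD; last by rewrite !mulmxN !mulNmx SA.
    by apply: emx_intertwine; rewrite -scalemxAr QD -opprD mulNmx.
  rewrite dchi mulmxDl dtranslE -scalemxAl -(mulmxA f4) emxKN mulmx1.
  rewrite -dtranslE !dtransl_blk -!mulmxA blkM mulmxA QO mul0r.
  have -> : w1 *m blk (emx (der (orth_metric S)) (- s)) 1 *m (blk O 1 *m P) =
      w1 *m (blk (emx (- S) (- s) *m O) 0 + blk 0 1) *m P.
    by rewrite blkD addr0 add0r -[1 in RHS]mulr1 -blkM !mulmxA.
  by rewrite mulmxDr mulmxDl -(mulmxA w1 _ P) blkP mul_blk01 -scalemxAl e4P.
have ipP (x y : V) : x *m blk O 1 *m P *m gram g *m (y *m blk O 1 *m P)^T =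
    c *: (x *m y^T).
  transitivity (x *m blk O 1 *m (P *m gram g *m P^T) *m (blk O 1)^T *m y^T).
    by rewrite !trmx_mul !mulmxA.
  rewrite PG mul_mx_scalar -!scalemxAl; congr (c *: _).
  by rewrite -(mulmxA x) blk_tr blkM OO mulr1 blk1 mulmx1.
by rewrite /metric_at chi4 -/s !key /ip ipP /= !mulmx1 mxE.
Qed.

End RepHomothety.

(** * Orthogonal diagonalization and bases *)

Section RealSpectral.
Context {R : realType}.

Definition dotp n (x y : 'rV[R]_n) : R := (x *m y^T) 0 0.

Lemma dotpE n (x y : 'rV[R]_n) : dotp x y = \sum_i x 0 i * y 0 i.
Proof. by rewrite /dotp mxE; apply: eq_bigr => i _; rewrite mxE. Qed.

Lemma dotp_ge0 n (x : 'rV[R]_n) : 0 <= dotp x x.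
Proof. by rewrite dotpE; apply: sumr_ge0 => i _; rewrite -expr2 sqr_ge0. Qed.

Lemma dotp_eq0 n (x : 'rV[R]_n) : dotp x x = 0 -> x = 0.
Proof.
rewrite dotpE => /eqP; rewrite psumr_eq0 => [/allP h|i _]; last first.
  by rewrite -expr2 sqr_ge0.
apply/rowP => i; have := h i (mem_index_enum i).
by rewrite mxE -expr2 sqrf_eq0 => /eqP.
Qed.

Lemma dotpDl n (x y z : 'rV[R]_n) : dotp (x + y) z = dotp x z + dotp y z.
Proof. by rewrite /dotp mulmxDl mxE. Qed.

Lemma dotpZl n a (x z : 'rV[R]_n) : dotp (a *: x) z = a * dotp x z.
Proof. by rewrite /dotp -scalemxAl mxE. Qed.

Lemma dotpC n (x y : 'rV[R]_n) : dotp x y = dotp y x.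
Proof. by rewrite !dotpE; apply: eq_bigr => i _; rewrite mulrC. Qed.

Lemma dotpDr n (x y z : 'rV[R]_n) : dotp z (x + y) = dotp z x + dotp z y.
Proof. by rewrite dotpC dotpDl !(dotpC z). Qed.

Lemma dotpZr n a (x z : 'rV[R]_n) : dotp z (a *: x) = a * dotp z x.
Proof. by rewrite dotpC dotpZl dotpC. Qed.

Lemma continuous_quadratic n (S : 'M[R]_n) :
  continuous (fun x : 'rV[R]_n => dotp (x *m S) x).
Proof.
have csum (F : 'I_n -> 'rV[R]_n -> R) : (forall i, continuous (F i)) ->
    continuous (fun x => \sum_i F i x).
  move=> cF x; elim: (index_enum _) => [|i r IH].
    by under eq_fun do rewrite big_nil; exact: cst_continuous.
  under eq_fun do rewrite big_cons.
  by apply: (@continuousD R R^o _ (F i) (fun x => \sum_(i <- r) F i x) x);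
    [exact: cF|exact: IH].
have -> : (fun x : 'rV[R]_n => dotp (x *m S) x) =
    (fun x => \sum_i (\sum_j x 0 j * S j i) * x 0 i).
  by apply/funext => x; rewrite dotpE; apply: eq_bigr => i _; rewrite mxE.
have cc i : continuous (fun x : 'rV[R]_n => x 0 i) by exact: coord_continuous.
have cs i : continuous (fun x : 'rV[R]_n => \sum_j x 0 j * S j i).
  apply: (csum (fun j x => x 0 j * S j i)) => j y.
  apply: (@continuousM _ _ (fun x : 'rV[R]_n => x 0 j) (fun=> S j i) y (cc j y)).
  exact: cst_continuous.
apply: (csum (fun i x => (\sum_j x 0 j * S j i) * x 0 i)) => i x.
exact: (@continuousM _ _ (fun x : 'rV[R]_n => \sum_j x 0 j * S j i) _ x
  (cs i x) (cc i x)).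
Qed.

Lemma compact_sphere n : compact [set x : 'rV[R]_n | dotp x x = 1].
Proof.
apply: bounded_closed_compact.
  exists 1; split => // M M1 x /= x1.
  rewrite [leLHS]/Num.Def.normr /= mx_normrE; apply: bigmax_le.
    by apply: ltW; apply: lt_trans M1.
  move=> [i j] _ /=; rewrite ord1; apply: le_trans (ltW M1).
  rewrite -(@ler_pXn2r _ 2) ?nnegrE // expr1n -normrX ger0_norm ?sqr_ge0 //.
  rewrite -x1 dotpE (bigD1 j) //= -expr2 lerDl.
  by apply: sumr_ge0 => k _; rewrite -expr2 sqr_ge0.
have cq := @continuous_quadratic n 1%:M.
rewrite (_ : [set _ | _]%classic = (fun x => dotp (x *m 1%:M) x) @^-1` [set 1])%classic.
  by apply: preimage_closed => //; exact: closed_eq.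
by apply/seteqP; split=> x /=; rewrite mulmx1.
Qed.

(* The maximum of [x S x^T] on the unit sphere is an eigenvalue. *)
Lemma sym_eigenvector n (S : 'M[R]_n.+1) : S^T = S ->
  exists (x : 'rV[R]_n.+1) (l : R), dotp x x = 1 /\ x *m S = l *: x.
Proof.
move=> St; pose q x := dotp (x *m S) x.
have [||x xA xmax] := @EVT_max_rV R _ q _ _ (@compact_sphere n.+1) _.
- exists (delta_mx 0 0) => /=; rewrite dotpE (bigD1 ord0) //= big1 ?addr0.
    by rewrite !mxE !eqxx mulr1.
  by move=> i /negPf i0; rewrite !mxE /= i0 mulr0.
- exact/continuous_subspaceT/continuous_quadratic.
have x1 : dotp x x = 1 by rewrite inE in xA.
exists x, (q x); split=> //.
(* By maximality [B] is positive semidefinite, and it vanishes at (x, x); hence x lies in its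
   kernel, which is the eigenvector equation. *)
pose B y z := q x * dotp y z - dotp (y *m S) z.
have B0 y : 0 <= B y y.
  have [y0|y0] := eqVneq (dotp y y) 0.
    by rewrite /B (dotp_eq0 y0) /q /dotp !mul0mx !mxE mulr0 subrr.
  have ygt : 0 < dotp y y by rewrite lt_def y0 dotp_ge0.
  pose r := (Num.sqrt (dotp y y))^-1.
  have r2 : r ^+ 2 * dotp y y = 1 by rewrite exprVn sqr_sqrtr ?dotp_ge0 // mulVf.
  have := xmax (r *: y); rewrite inE /= dotpZl dotpZr mulrA -expr2 => /(_ r2).
  rewrite /q -scalemxAl dotpZl dotpZr mulrA -expr2 -/(q x) => h.
  rewrite /B subr_ge0 -(ler_pM2l (_ : 0 < r ^+ 2)).
    by rewrite mulrCA r2 mulr1.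
  by rewrite exprn_gt0 // invr_gt0 sqrtr_gt0.
have Bx y : B x y = 0.
  have BC : B y x = B x y.
    rewrite /B [dotp y x]dotpC; congr (_ - _).
    by rewrite dotpC /dotp trmx_mul St mulmxA.
  have h t : 0 <= 2 * t * B x y + t ^+ 2 * B y y.
    have := B0 (x + t *: y).
    have -> : B (x + t *: y) (x + t *: y) =
        B x x + t * B x y + t * B y x + t ^+ 2 * B y y.
      by rewrite /B mulmxDl -scalemxAl !(dotpDl, dotpDr, dotpZl, dotpZr); ring.
    by rewrite BC {1}/B /q x1 mulr1 subrr add0r -/q => /le_trans; apply; lra.
  have h1 := B0 y; set b := B x y in h *; set d := B y y in h h1.
  (* The quadratic in t is negative here unless b = 0; the denominator d + 1 instead of d also
     covers d = 0. *)
  have := h (- b / (d + 1)); have d1 : d + 1 != 0 by rewrite gt_eqF // ltr_wpDl.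
  have -> : 2 * (- b / (d + 1)) * b + (- b / (d + 1)) ^+ 2 * d =
     - (b ^+ 2 * ((d + 2) / (d + 1) ^+ 2)) by field.
  rewrite oppr_ge0 pmulr_lle0 => [|]; last first.
    by rewrite divr_gt0 ?exprn_gt0 ?ltr_wpDl.
  by move=> b2; apply/eqP; rewrite -sqrf_eq0 eq_le b2 sqr_ge0.
apply/esym/eqP; rewrite -subr_eq0; apply/eqP/dotp_eq0.
set y := _ - _; have := Bx y.
by rewrite /B -dotpZl -[- dotp _ _]mulN1r -dotpZl scaleN1r -dotpDl.
Qed.

(** The Householder reflection in the hyperplane orthogonal to w. *)
Definition reflection n (w : 'rV[R]_n) : 'M[R]_n :=
  1%:M - (2 / dotp w w) *: (w^T *m w).

Lemma reflection_orth n (w : 'rV[R]_n) : dotp w w != 0 ->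
  reflection w *m (reflection w)^T = 1%:M.
Proof.
move=> w0; set a := 2 / dotp w w.
have Ot : (reflection w)^T = reflection w.
  by rewrite /reflection linearB linearZ /= trmx1 trmx_mul trmxK.
have ww : w^T *m w *m (w^T *m w) = dotp w w *: (w^T *m w).
  rewrite -(mulmxA w^T) (mulmxA w) [w *m w^T]mx11_scalar mul_scalar_mx.
  by rewrite -scalemxAr.
rewrite Ot /reflection -/a mulmxBl mul1mx mulmxBr mulmx1 -scalemxAl -scalemxAr.
rewrite ww !scalerA.
have -> : a * a * dotp w w = a + a by rewrite /a; field.
by rewrite scalerDl opprB addrK subrK.
Qed.

Lemma reflection_swap n (x e : 'rV[R]_n) : dotp x x = 1 -> dotp e e = 1 ->
  dotp (x - e) (x - e) != 0 -> e *m reflection (x - e) = x.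
Proof.
move=> x1 e1 w0; set w := x - e in w0 *.
have ew : dotp e w = - (dotp w w / 2).
  rewrite /w -scaleN1r !(dotpDl, dotpDr, dotpZl, dotpZr) x1 e1.
  by rewrite [dotp e x]dotpC; field.
rewrite /reflection mulmxBr mulmx1 -scalemxAr mulmxA [e *m w^T]mx11_scalar.
rewrite -/(dotp e w) ew mul_scalar_mx scalerA.
have -> : 2 / dotp w w * - (dotp w w / 2) = -1 by field.
by rewrite scaleN1r opprK /w addrC subrK.
Qed.

Lemma orth_with_first_row n (x : 'rV[R]_n.+1) : dotp x x = 1 ->
  exists O : 'M[R]_n.+1, O *m O^T = 1%:M /\ delta_mx 0 0 *m O = x.
Proof.
move=> x1; pose e : 'rV[R]_n.+1 := delta_mx 0 0.
have ee : dotp e e = 1.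
  rewrite dotpE (bigD1 ord0) //= big1 ?addr0 ?mxE ?eqxx ?mulr1 //.
  by move=> i /negPf i0; rewrite !mxE /= i0 mulr0.
have [xe|w0] := eqVneq (dotp (x - e) (x - e)) 0.
  exists 1%:M; rewrite trmx1 !mulmx1; split=> //.
  by apply/esym/eqP; rewrite -subr_eq0; apply/eqP/dotp_eq0.
exists (reflection (x - e)); split; first exact: reflection_orth.
exact: reflection_swap.
Qed.

Lemma sym_spectral n (S : 'M[R]_n) : S^T = S ->
  exists (O : 'M[R]_n) (d : 'rV[R]_n), O *m O^T = 1%:M /\ O *m S *m O^T = diag_mx d.
Proof.
elim: n S => [|n IH] S St.
  by exists 1%:M, 0; split; apply/matrixP => -[].
have [x [l [x1 xS]]] := sym_eigenvector St.
have [Q [QQ eQ]] := orth_with_first_row x1.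
(* The existential retypes the conjugate as a matrix of size [1 + n], ready for block operations,
   and keeps its body hidden. *)
have [S1 S1E] : exists S1 : 'M[R]_(1 + n), S1 = Q *m S *m Q^T by eexists.
have S1t : S1^T = S1 by rewrite S1E !trmx_mul trmxK St mulmxA.
have eS1 : delta_mx 0 0 *m S1 = l *: (delta_mx 0 0 : 'rV[R]_(1 + n)).
  by rewrite S1E !mulmxA eQ xS -scalemxAl -eQ -mulmxA QQ mulmx1.
have S10 j : S1 0 j = l * (j == 0)%:R.
  have := congr1 (fun u : 'rV[R]_(1 + n) => u 0 j) eS1.
  by rewrite -rowE !mxE eqxx.
have S10' j : S1 j 0 = l * (j == 0)%:R by rewrite -S1t mxE.
have S1b : S1 = block_mx l%:M 0 0 (drsubmx S1).
  rewrite -[LHS]submxK; congr block_mx.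
  - by apply/matrixP => i j; rewrite !ord1 !mxE lshift0 S10 !eqxx mulr1.
  - by apply/matrixP => i j; rewrite !ord1 !mxE lshift0 S10 mulr0.
  - by apply/matrixP => i j; rewrite !ord1 !mxE lshift0 S10' mulr0.
have S2t : (drsubmx S1)^T = drsubmx S1 by rewrite -[in RHS]S1t trmx_drsub.
have [Q2 [d [Q2Q Q2S]]] := IH _ S2t.
pose W : 'M[R]_(1 + n) := block_mx 1%:M 0 0 Q2.
have WW : W *m W^T = 1%:M.
  by rewrite /W tr_block_mx !trmx0 trmx1 mulmx_block !mulmx0 !mul0mx !addr0 add0r
    mulmx1 Q2Q -scalar_mx_block.
have WSW : W *m S1 *m W^T = diag_mx (row_mx l%:M d).
  rewrite S1b /W tr_block_mx !trmx0 trmx1 !mulmx_block !(mulmx0, mul0mx).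
  rewrite !(addr0, add0r) mul1mx mulmx1 Q2S diag_mx_row.
  by rewrite !mul0mx; congr block_mx; apply/matrixP => i j; rewrite !ord1 !mxE !eqxx.
exists (W *m Q), (row_mx l%:M d); split.
  by rewrite trmx_mul mulmxA -(mulmxA W) QQ mulmx1.
by rewrite -WSW S1E trmx_mul !mulmxA.
Qed.

End RealSpectral.

Section RepExists.
Context {R : realType}.
Implicit Types (g : left_inv_metric R) (M O : 'M[R]_3).

Lemma rep_scale g M (b : R) : b != 0 -> rep g M -> rep g (b *: M).
Proof.
move=> b0 [Q [v [a [c [uQ a0 c0 QD PG]]]]].
exists (b *: Q), (b *: v), (b * a), (b ^+ 2 * c); split.
- by rewrite unitmxZ ?unitfE.
- by rewrite mulf_neq0.
- by rewrite mulr_gt0 // exprn_even_gt0.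
- transitivity ((b * b) *: (a *: (Q *m der g))).
    by rewrite -scalemxAl !scalerA mulrAC.
  by rewrite QD scalerN -scalemxAl -scalemxAr scalerA.
have -> : adapted (b *: Q) (b *: v) (b * a) = b *: adapted Q v a.
  rewrite /adapted; apply: esym; apply: etrans (@scale_block_mx _ 3 1 3 1 _ _ _ _ _) _.
  by rewrite scaler0 scale_scalar_mx.
rewrite linearZ /= -!scalemxAl -scalemxAr PG scalerA -expr2.
by rewrite scale_scalar_mx.
Qed.

Lemma rep_orth g M O : O *m O^T = 1%:M -> rep g M -> rep g (O *m M *m O^T).
Proof.
move=> OO [Q [v [a [c [uQ a0 c0 QD PG]]]]].
have uO : O \in unitmx by have [] := mulmx1_unit OO.
have OtO : O^T *m O = 1%:M by exact: mulmx1C.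
exists (O *m Q), v, a, c; split=> //.
- by rewrite unitmx_mul uO.
- rewrite -mulmxA scalemxAr QD mulmxN !mulmxA -(mulmxA _ O^T) OtO mulmx1.
  by [].
have -> : adapted (O *m Q) v a = blk O 1 *m adapted Q v a.
  apply: esym; apply: etrans (@mulmx_block _ 3 1 3 1 3 1 _ _ _ _ _ _ _ _) _.
  by rewrite !mulmx0 !mul0mx !addr0 !add0r !mul1mx.
rewrite trmx_mul !mulmxA -(mulmxA _ (adapted Q v a)) -(mulmxA _ (_ *m _) (_^T)) PG.
by rewrite mul_mx_scalar -scalemxAl blk_tr blkM OO mulr1 blk1 scalemx1.
Qed.

Lemma spd_orthonormalize n (G : 'M[R]_n) : G^T = G ->
  (forall x : 'rV[R]_n, x != 0 -> 0 < (x *m G *m x^T) 0 0) ->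
  exists2 Q : 'M[R]_n, Q \in unitmx & Q *m G *m Q^T = 1%:M.
Proof.
move=> Gt Gpos; have [Q [d [QQ QG]]] := sym_spectral Gt.
have d0 i : 0 < d 0 i.
  have ei : (delta_mx 0 i : 'rV[R]_n) *m Q != 0.
    apply: contraTneq (oner_neq0 R) => h; rewrite negbK.
    have := congr1 (fun u => (u *m Q^T) 0 i) h.
    by rewrite -mulmxA QQ mulmx1 mul0mx !mxE !eqxx => /eqP.
  have := Gpos _ ei; rewrite trmx_mul !mulmxA -2!(mulmxA (delta_mx 0 i)) QG.
  by rewrite trmx_delta -rowE -colE !mxE eqxx.
pose r : 'rV[R]_n := \row_i (Num.sqrt (d 0 i))^-1.
exists (diag_mx r *m Q).
  rewrite unitmx_mul; have [-> _] := mulmx1_unit QQ; rewrite andbT unitmxE det_diag.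
  rewrite unitfE prodf_seq_neq0; apply/allP => i _ /=.
  by rewrite mxE invr_neq0 // gt_eqF // sqrtr_gt0.
rewrite trmx_mul !mulmxA -2!(mulmxA (diag_mx r)) QG tr_diag_mx.
rewrite !mulmx_diag; apply/matrixP => i j; rewrite !mxE.
case: eqP => // _; rewrite !mulr1n.
by rewrite -{2}(sqr_sqrtr (ltW (d0 i))); field; rewrite gt_eqF // sqrtr_gt0.
Qed.

Lemma rep_exists g : exists M, rep g M.
Proof.
pose G : 'M[R]_(3 + 1) := gram g.
have Gt : G^T = G := gram_sym g.
have [Q uQ QG] : exists2 Q : 'M[R]_3, Q \in unitmx & Q *m ulsubmx G *m Q^T = 1%:M.
  apply: spd_orthonormalize => [|x x0]; first by rewrite trmx_ulsub Gt.
  have := @gram_pos _ g (row_mx x 0 : 'rV[R]_(3 + 1)).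
  have h : row_mx x (0 : 'rV[R]_1) != 0.
    by apply: contra x0 => /eqP; rewrite -row_mx0 => /eq_row_mx[-> _].
  move=> /(_ h); rewrite -[gram g]/G -{1}[G]submxK.
  have -> : row_mx x 0 *m block_mx (ulsubmx G) (ursubmx G) (dlsubmx G) (drsubmx G) *m
     (row_mx x (0 : 'rV[R]_1))^T = x *m ulsubmx G *m x^T.
    by rewrite mul_row_block tr_row_mx mul_row_col !mul0mx trmx0 mulmx0 !addr0.
  by [].
(* The metric dual of the last coordinate: w pairs with any vector to that vector's last coordinate,
   so it is orthogonal to the ideal. Only its length remains to be normalised. *)
pose w : 'rV[R]_4 := e_ ord_max *m invmx (gram g).
have wG : w *m gram g = e_ ord_max by rewrite mulmxKV // gram_unit.
have w4 : (w *m gram g *m w^T) 0 0 = w 0 ord_max.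
  by rewrite wG -rowE !mxE.
have wn0 : w != 0.
  apply: contraTneq (oner_neq0 R) => w0; rewrite negbK.
  have := congr1 (fun u : 'rV[R]_4 => u 0 ord_max) wG.
  by rewrite w0 mul0mx !mxE !eqxx => /esym/eqP.
have w4gt : 0 < w 0 ord_max by rewrite -w4; exact: gram_pos.
pose b := (Num.sqrt (w 0 ord_max))^-1.
have b0 : 0 < b by rewrite invr_gt0 sqrtr_gt0.
pose f : 'rV[R]_(3 + 1) := b *: w.
pose a := f 0 ord_max.
have a0 : 0 < a by rewrite /a mxE mulr_gt0.
exists (- (a *: (Q *m der g *m invmx Q))), Q, (lsubmx f), a, 1; split=> //.
- by rewrite gt_eqF.
- by rewrite mulNmx opprK -scalemxAl mulmxKV.
have fE : f = row_mx (lsubmx f) a%:M.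
  rewrite -[LHS]hsubmxK; congr row_mx.
  apply/matrixP => i j; rewrite !ord1 [LHS]mxE [RHS]mxE eqxx mulr1n.
  by congr (f 0 _); exact/val_inj.
have -> : adapted Q (lsubmx f) a = col_mx (row_mx Q 0) f by rewrite {2}fE.
have fG : f *m G = b *: (e_ ord_max : 'rV[R]_(3 + 1)).
  by rewrite -scalemxAl; congr (_ *: _).
have fGQ : f *m G *m (row_mx Q 0)^T = 0.
  rewrite fG -scalemxAl e4E tr_row_mx trmx0.
  by rewrite (mul_row_col 0 1%:M Q^T 0) mul0mx mulmx0 addr0 scaler0.
have fGf : f *m G *m f^T = 1%:M.
  rewrite [LHS]mx11_scalar; congr (_ %:M).
  rewrite -scalemxAl linearZ /= -scalemxAr -scalemxAl 2!mxE.
  rewrite -[X in b * (b * X)]/((w *m gram g *m w^T) 0 0) w4.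
  by rewrite mulrA -expr2 exprVn sqr_sqrtr ?ltW // mulVf // gt_eqF.
have QGf : row_mx Q 0 *m G *m f^T = 0.
  by apply: trmx_inj; rewrite trmx0 !trmx_mul trmxK Gt mulmxA.
have QGQ : row_mx Q 0 *m G *m (row_mx Q 0)^T = 1%:M.
  rewrite -{1}[G]submxK mul_row_block tr_row_mx mul_row_col.
  by rewrite !mul0mx trmx0 mulmx0 !addr0.
pose P : 'M[R]_(3 + 1) := col_mx (row_mx Q 0) f.
have PGP : P *m G *m P^T = 1%:M.
  rewrite /P tr_col_mx mul_col_mx mul_col_row fGQ fGf QGf QGQ.
  by rewrite scalar_mx_block.
exact: PGP.
Qed.

Lemma rep_exists_diag g : exists (d : 'rV[R]_3) (A : 'M[R]_3),
  A^T = - A /\ rep g (diag_mx d + A).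
Proof.
have [M gM] := rep_exists g.
pose S := 2^-1 *: (M + M^T).
have St : S^T = S by rewrite /S linearZ /= linearD /= trmxK addrC.
have [Q [d [QQ QS]]] := sym_spectral St.
exists d, (Q *m (2^-1 *: (M - M^T)) *m Q^T); split.
  by rewrite !trmx_mul trmxK linearZ /= linearB /= trmxK mulmxA -opprB scalerN
    mulmxN mulNmx.
rewrite -QS -mulmxDl -mulmxDr -scalerDr addrACA subrr addr0.
rewrite (_ : 2^-1 *: (M + M) = M); first exact: rep_orth.
rewrite -{1 2}[M]scale1r -scalerDl scalerA.
have -> : 2^-1 * (1 + 1) = 1 :> R by field.
exact: scale1r.
Qed.

End RepExists.

(** * Curvature in a diagonalizing orthonormal basis *)

Section Coordinates.
Context {R : realType}.

Definition v4 (a b c d : R) : 'rV[R]_4 := \row_(j < 4) nth 0 [:: a; b; c; d] j.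

Lemma sum4 (F : 'I_4 -> R) : \sum_i F i =
  F (inord 0) + F (inord 1) + F (inord 2) + F (inord 3).
Proof.
rewrite !big_ord_recl big_ord0 addr0 !addrA.
by congr (F _ + F _ + F _ + F _); apply/val_inj; rewrite /= inordK.
Qed.

Lemma v4P (x : 'rV[R]_4) : exists a b c d, x = v4 a b c d.
Proof.
exists (x 0 (inord 0)), (x 0 (inord 1)), (x 0 (inord 2)), (x 0 (inord 3)).
by apply/rowP => j; rewrite mxE; case: j => -[|[|[|[|]]]] //= h;
  congr (x 0 _); apply/val_inj; rewrite /= inordK.
Qed.

Lemma v4E a b c d : (v4 a b c d 0 (inord 0) = a) * (v4 a b c d 0 (inord 1) = b)
  * (v4 a b c d 0 (inord 2) = c) * (v4 a b c d 0 (inord 3) = d).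
Proof. by rewrite !mxE !inordK. Qed.

Lemma v4_inj a b c d a' b' c' d' : a = a' -> b = b' -> c = c' -> d = d' ->
  v4 a b c d = v4 a' b' c' d'.
Proof. by move=> -> -> -> ->. Qed.

Lemma v4D a b c d a' b' c' d' :
  v4 a b c d + v4 a' b' c' d' = v4 (a + a') (b + b') (c + c') (d + d').
Proof. by apply/rowP => j; rewrite !mxE; case: j => -[|[|[|[|]]]]. Qed.

Lemma v4N a b c d : - v4 a b c d = v4 (- a) (- b) (- c) (- d).
Proof. by apply/rowP => j; rewrite !mxE; case: j => -[|[|[|[|]]]]. Qed.

Lemma v4Z k a b c d : k *: v4 a b c d = v4 (k * a) (k * b) (k * c) (k * d).
Proof. by apply/rowP => j; rewrite !mxE; case: j => -[|[|[|[|]]]]. Qed.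

Lemma e_v4 : (e_ (inord 0) = v4 1 0 0 0) * (e_ (inord 1) = v4 0 1 0 0)
  * (e_ (inord 2) = v4 0 0 1 0) * (e_ (inord 3) = v4 0 0 0 1).
Proof.
by do !split; apply/rowP => j; rewrite !mxE -!val_eqE /= inordK //;
  case: j => -[|[|[|[|]]]].
Qed.

Definition mx3 (a b c a' b' c' a'' b'' c'' : R) : 'M[R]_3 :=
  \matrix_(i < 3, j < 3)
    nth 0 (nth [::] [:: [:: a; b; c]; [:: a'; b'; c']; [:: a''; b''; c'']] i) j.

Lemma mul_v4_ad4 (g : left_inv_metric R) a b c a' b' c' a'' b'' c'' x y z t :
  der g = mx3 a b c a' b' c' a'' b'' c'' ->
  v4 x y z t *m ad4 g = v4 (x * a + y * a' + z * a'') (x * b + y * b' + z * b'')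
    (x * c + y * c' + z * c'') 0.
Proof.
move=> dg; apply/rowP => j; rewrite mxE sum4 !v4E.
have adE i k : ad4 g i k = nth 0 (nth [::] [:: [:: a; b; c; 0]; [:: a'; b'; c'; 0];
    [:: a''; b''; c''; 0]; [:: 0; 0; 0; 0]] i) k.
  rewrite /ad4 dg mxE; case: splitP => [p ->|p ->]; rewrite mxE;
    case: splitP => [q ->|q ->]; rewrite mxE.
  - by case: p q => -[|[|[|]]] // ? [[|[|[|]]] ?].
  - by rewrite ord1; case: p => -[|[|[|]]].
  - by rewrite ord1; case: q => -[|[|[|]]].
  - by rewrite !ord1.
rewrite !adE !inordK // mxE.
by case: j => -[|[|[|[|]]]] h //=; rewrite ?mulr0 ?addr0.
Qed.

End Coordinates.

Section StandardMetric.
Context {R : realType} (x1 x2 x3 u1 u2 u3 : R).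

(* The symmetric part of the derivation is diagonal, and the skew part has
   entries epsilon_ijk u_k. *)
Definition std_mx : 'M[R]_3 := mx3 x1 u3 (- u2) (- u3) x2 u1 u2 (- u1) x3.

Definition std : left_inv_metric R := orth_metric std_mx.

Lemma ip_std a b c d a' b' c' d' : ip std (v4 a b c d) (v4 a' b' c' d') =
  a * a' + b * b' + c * c' + d * d'.
Proof.
rewrite /ip mulmx1 mxE sum4 !v4E.
by rewrite ![_^T _ _]mxE !v4E.
Qed.

Lemma lie_std a b c d a' b' c' d' : lie std (v4 a b c d) (v4 a' b' c' d') =
  v4 (d' * (a * x1 - b * u3 + c * u2) - d * (a' * x1 - b' * u3 + c' * u2))
     (d' * (a * u3 + b * x2 - c * u1) - d * (a' * u3 + b' * x2 - c' * u1))
     (d' * (- a * u2 + b * u1 + c * x3) - d * (- a' * u2 + b' * u1 + c' * x3)) 0.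
Proof.
have dg : der std = mx3 (- x1) (- u3) u2 u3 (- x2) (- u1) (- u2) u1 (- x3).
  apply/matrixP => i j; rewrite !mxE.
  by case: i j => -[|[|[|]]] // ? [[|[|[|]]] ?] //=; rewrite ?opprK.
rewrite /lie (_ : ord_max = inord 3); last by apply/val_inj; rewrite /= inordK.
rewrite !v4E !(mul_v4_ad4 _ _ _ _ dg) !(v4Z, v4N, v4D).
by apply: v4_inj; ring.
Qed.

(** The ideal is a flat hypersurface with normal e_4 and second fundamental form given by S, while
    differentiation along e_4 rotates it by the skew part A. *)
Lemma nabla_std a b c d a' b' c' d' : nabla std (v4 a b c d) (v4 a' b' c' d') =
  v4 (d' * (a * x1) - d * (c' * u2 - b' * u3))
     (d' * (b * x2) - d * (a' * u3 - c' * u1))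
     (d' * (c * x3) - d * (b' * u1 - a' * u2))
     (- (a * a' * x1 + b * b' * x2 + c * c' * x3)).
Proof.
apply: (@ip_inj _ std) => z; have [p [q [r [s ->]]]] := v4P z.
by rewrite ip_nabla /koszul !lie_std !ip_std; field.
Qed.

Lemma ginv_std : ginv std = 1%:M.
Proof. exact: invmx1. Qed.

Lemma trace_std (b : 'rV[R]_4 -> 'rV[R]_4 -> R) :
  \sum_(i < 4) \sum_(j < 4) ginv std i j * b (e_ i) (e_ j) =
  b (v4 1 0 0 0) (v4 1 0 0 0) + b (v4 0 1 0 0) (v4 0 1 0 0)
  + b (v4 0 0 1 0) (v4 0 0 1 0) + b (v4 0 0 0 1) (v4 0 0 0 1).
Proof.
rewrite ginv_std -!e_v4 -(sum4 (fun i => b (e_ i) (e_ i))).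
apply: eq_bigr => i _; rewrite (bigD1 i) //= big1 ?addr0 ?mxE ?eqxx ?mul1r // => j ji.
by rewrite mxE eq_sym (negPf ji) mul0r.
Qed.

Let T := x1 + x2 + x3.
Let s := x1 ^+ 2 + x2 ^+ 2 + x3 ^+ 2.
Let k1 := u1 * (x2 - x3).
Let k2 := u2 * (x3 - x1).
Let k3 := u3 * (x1 - x2).

(* [S_ S_ - S_ S_] is the Gauss term of the flat ideal, and [bS] the normal
   curvature operator [K - S^2]. *)
Let bS a b c a' b' c' := k1 * (b * c' + c * b') + k2 * (c * a' + a * c')
  + k3 * (a * b' + b * a') - (x1 ^+ 2 * a * a' + x2 ^+ 2 * b * b' + x3 ^+ 2 * c * c').
Let S_ a b c a' b' c' := x1 * a * a' + x2 * b * b' + x3 * c * c'.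

Lemma Riem_std a b c d a' b' c' d' a2 b2 c2 d2 a3 b3 c3 d3 :
  Riem std (v4 a b c d) (v4 a' b' c' d') (v4 a2 b2 c2 d2) (v4 a3 b3 c3 d3) =
  S_ a b c a3 b3 c3 * S_ a' b' c' a2 b2 c2 - S_ a b c a2 b2 c2 * S_ a' b' c' a3 b3 c3
  + bS a b c a2 b2 c2 * d' * d3 - bS a' b' c' a2 b2 c2 * d * d3
  - bS a b c a3 b3 c3 * d' * d2 + bS a' b' c' a3 b3 c3 * d * d2.
Proof.
rewrite /Riem /curv !lie_std !nabla_std !v4N !v4D ip_std /bS /S_ /k1 /k2 /k3.
by ring.
Qed.

Lemma ricci_std a b c d a' b' c' d' : ricci std (v4 a b c d) (v4 a' b' c' d') =
  - T * (x1 * a * a' + x2 * b * b' + x3 * c * c') - s * d * d'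
  + k1 * (b * c' + c * b') + k2 * (c * a' + a * c') + k3 * (a * b' + b * a').
Proof.
rewrite /ricci (trace_std (fun u v => Riem std _ u _ v)) !Riem_std.
by rewrite /bS /S_ /T /s /k1 /k2 /k3; ring.
Qed.

Lemma ricci_mx_std i j : ricci_mx std i j = ricci std (e_ i) (e_ j).
Proof. by rewrite mxE. Qed.

Lemma Ric_std : Ric std = ricci_mx std.
Proof. by rewrite /Ric ginv_std mulmx1. Qed.

Lemma scal_std : scal std = - T ^+ 2 - s.
Proof.
rewrite /scal Ric_std /mxtrace sum4 !ricci_mx_std !e_v4 !ricci_std /T /s /k1 /k2 /k3.
by ring.
Qed.

Lemma ricci_norm2_std : ricci_norm2 std =
  T ^+ 2 * s + s ^+ 2 + 2 * (k1 ^+ 2 + k2 ^+ 2 + k3 ^+ 2).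
Proof.
rewrite /ricci_norm2 Ric_std /mxtrace sum4 ![(_ *m _) _ _]mxE !sum4.
rewrite !ricci_mx_std !e_v4 !ricci_std /T /s /k1 /k2 /k3.
by ring.
Qed.

(** Indices are taken in cyclic order (i, j, l); [di] is x_j - x_l and [wi] is u_j k_j - u_l k_l.
    The variable q stands for t tau, so s - q is m. Leaving q and en free makes the expansion below
    a polynomial identity. *)
Definition eq_diag (q en xi di wi : R) : R :=
  6 * (u1 * u2 * u3) * di + 4 * T * wi - 2 * (s - q) * T * xi + en / 2.

Definition eq_off (q xi xj xl ui uj ul di : R) : R :=
  ui * (- uj ^+ 2 * (7 * xl + 2 * xj - 3 * T) + ul ^+ 2 * (7 * xj + 2 * xl - 3 * T)
    + 4 * ui ^+ 2 * di + di ^+ 3 + (2 * (s - q) - T ^+ 2) * di)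
  - 6 * T * uj * ul * (xi - T / 3).

Lemma critical_expr_std q en a b c d a' b' c' d' :
  let v := v4 a b c d in let v' := v4 a' b' c' d' in
  - rough_laplacian std (ricci std) v v' + en / 2 * ip std v v'
  - 2 * Riem_ricci std v v' - 2 * q * ricci std v v' =
  eq_diag q en x1 (x2 - x3) (u2 * k2 - u3 * k3) * a * a'
  + eq_diag q en x2 (x3 - x1) (u3 * k3 - u1 * k1) * b * b'
  + eq_diag q en x3 (x1 - x2) (u1 * k1 - u2 * k2) * c * c'
  + eq_off q x1 x2 x3 u1 u2 u3 (x2 - x3) * (b * c' + c * b')
  + eq_off q x2 x3 x1 u2 u3 u1 (x3 - x1) * (c * a' + a * c')
  + eq_off q x3 x1 x2 u3 u1 u2 (x1 - x2) * (a * b' + b * a')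
  + (en / 2 - 2 * s * (s - q) - 4 * (k1 ^+ 2 + k2 ^+ 2 + k3 ^+ 2)) * d * d'.
Proof.
move=> v v'.
rewrite /rough_laplacian (trace_std (fun u v => cov2 std _ u v _ _)) /cov2 /cov.
rewrite !nabla_std !ricci_std ip_std.
rewrite /Riem_ricci ginv_std mul1mx mulmx1 !sum4 !ricci_mx_std !e_v4 !ricci_std.
rewrite !Riem_std /bS /S_ /eq_diag /eq_off /T /s /k1 /k2 /k3.
by field.
Qed.

End StandardMetric.

(** * The scalar system equivalent to criticality *)

Section CriticalSystem.
Context {R : realType}.

Definition trS (x1 x2 x3 : R) : R := x1 + x2 + x3.
Definition nrmS (x1 x2 x3 : R) : R := x1 ^+ 2 + x2 ^+ 2 + x3 ^+ 2.
(** Half of |K|^2: up to sign, the symmetric matrix K = [A, S] has each of the three numbers as two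
    off-diagonal entries. *)
Definition nrmK (x1 x2 x3 u1 u2 u3 : R) : R :=
  (u1 * (x2 - x3)) ^+ 2 + (u2 * (x3 - x1)) ^+ 2 + (u3 * (x1 - x2)) ^+ 2.

Definition diag_eq (T m xi uj ul di dj dl w : R) : Prop :=
  3 * w * di + 2 * T * (uj ^+ 2 * dj - ul ^+ 2 * dl) = m * T * (xi - T / 3).

Definition off_eq (T m xi xj xl ui uj ul : R) : Prop :=
  ui * (- uj ^+ 2 * (7 * xl + 2 * xj - 3 * T) + ul ^+ 2 * (7 * xj + 2 * xl - 3 * T)
    + 4 * ui ^+ 2 * (xj - xl) + (xj - xl) ^+ 3 + (2 * m - T ^+ 2) * (xj - xl)) =
  6 * T * uj * ul * (xi - T / 3).

(* The seven scalar equations equivalent to criticality; [m] stands for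
   [|S|^2 - t tau]. *)
Definition crit_sys (m x1 x2 x3 u1 u2 u3 : R) : Prop :=
  let T := trS x1 x2 x3 in let w := u1 * u2 * u3 in
  let d1 := x2 - x3 in let d2 := x3 - x1 in let d3 := x1 - x2 in
  [/\ m * (T ^+ 2 - 3 * nrmS x1 x2 x3) = 6 * nrmK x1 x2 x3 u1 u2 u3,
      [/\ diag_eq T m x1 u2 u3 d1 d2 d3 w, diag_eq T m x2 u3 u1 d2 d3 d1 w &
          diag_eq T m x3 u1 u2 d3 d1 d2 w] &
      [/\ off_eq T m x1 x2 x3 u1 u2 u3, off_eq T m x2 x3 x1 u2 u3 u1 &
          off_eq T m x3 x1 x2 u3 u1 u2]].

Lemma scal_stdE x1 x2 x3 u1 u2 u3 : scal (std x1 x2 x3 u1 u2 u3) =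
  - (trS x1 x2 x3 ^+ 2 + nrmS x1 x2 x3).
Proof. by rewrite scal_std /trS /nrmS; ring. Qed.

Lemma energy_std x1 x2 x3 u1 u2 u3 t :
  energy (std x1 x2 x3 u1 u2 u3) t =
  trS x1 x2 x3 ^+ 2 * nrmS x1 x2 x3 + nrmS x1 x2 x3 ^+ 2
  + 2 * nrmK x1 x2 x3 u1 u2 u3 + t * (trS x1 x2 x3 ^+ 2 + nrmS x1 x2 x3) ^+ 2.
Proof. by rewrite /energy ricci_norm2_std scal_stdE /trS /nrmS /nrmK; ring. Qed.

(** Pairs of basis vectors isolate the seven coefficients of the bilinear expression. The (e_4, e_4)
    coefficient gives the first equation, which reduces the energy to 4/3 m T^2; the diagonal
    coefficients then take the trace-free form of [diag_eq]. *)
Lemma critical_stdE x1 x2 x3 u1 u2 u3 t m :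
  - t * (trS x1 x2 x3 ^+ 2 + nrmS x1 x2 x3) = nrmS x1 x2 x3 - m ->
  critical (std x1 x2 x3 u1 u2 u3) t <-> crit_sys m x1 x2 x3 u1 u2 u3.
Proof.
move=> tm; set g := std _ _ _ _ _ _.
have en : energy g t = 2 * nrmK x1 x2 x3 u1 u2 u3 +
    m * (trS x1 x2 x3 ^+ 2 + nrmS x1 x2 x3).
  rewrite energy_std; move: tm.
  move: (trS _ _ _) (nrmS _ _ _) (nrmK _ _ _ _ _ _) => T s K tm.
  have -> : t * (T ^+ 2 + s) ^+ 2 = - (- t * (T ^+ 2 + s)) * (T ^+ 2 + s) by ring.
  by rewrite tm; ring.
have q : t * scal g = nrmS x1 x2 x3 - m by rewrite scal_stdE mulrN -mulNr.
have q2 : 2 * t * scal g = 2 * (nrmS x1 x2 x3 - m) by rewrite -mulrA q.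
have expr a b c d a' b' c' d' := critical_expr_std x1 x2 x3 u1 u2 u3
  (nrmS x1 x2 x3 - m) (2 * nrmK x1 x2 x3 u1 u2 u3 +
    m * (trS x1 x2 x3 ^+ 2 + nrmS x1 x2 x3)) a b c d a' b' c' d'.
split=> [cg|[e0 [d1 d2 d3] [f1 f2 f3]] v v']; last first.
  have [a [b [c [d ->]]]] := v4P v; have [a' [b' [c' [d' ->]]]] := v4P v'.
  rewrite q2 en; apply: etrans (expr a b c d a' b' c' d') _.
  rewrite (_ : eq_diag _ _ _ _ _ _ _ _ x1 _ _ = 0); last first.
    by move: d1 e0; rewrite /eq_diag /diag_eq /trS /nrmS /nrmK => d1 e0; lra.
  rewrite (_ : eq_diag _ _ _ _ _ _ _ _ x2 _ _ = 0); last first.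
    by move: d2 e0; rewrite /eq_diag /diag_eq /trS /nrmS /nrmK => d2 e0; lra.
  rewrite (_ : eq_diag _ _ _ _ _ _ _ _ x3 _ _ = 0); last first.
    by move: d3 e0; rewrite /eq_diag /diag_eq /trS /nrmS /nrmK => d3 e0; lra.
  rewrite (_ : eq_off _ _ _ _ x1 _ _ _ _ _ _ = 0); last first.
    by move: f1; rewrite /eq_off /off_eq /trS /nrmS /nrmK => f1; lra.
  rewrite (_ : eq_off _ _ _ _ x2 _ _ _ _ _ _ = 0); last first.
    by move: f2; rewrite /eq_off /off_eq /trS /nrmS /nrmK => f2; lra.
  rewrite (_ : eq_off _ _ _ _ x3 _ _ _ _ _ _ = 0); last first.
    by move: f3; rewrite /eq_off /off_eq /trS /nrmS /nrmK => f3; lra.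
  rewrite !mul0r !add0r; apply: etrans (congr1 (fun r => r * d * d') _) _.
    instantiate (1 := 0).
    by move: e0; rewrite /trS /nrmS /nrmK => e0; lra.
  by rewrite !mul0r.
have z v v' r : - rough_laplacian g (ricci g) v v'
    + (2 * nrmK x1 x2 x3 u1 u2 u3 + m * (trS x1 x2 x3 ^+ 2 + nrmS x1 x2 x3)) / 2
      * ip g v v'
    - 2 * Riem_ricci g v v' - 2 * (nrmS x1 x2 x3 - m) * ricci g v v' = r -> r = 0.
  by move=> <-; have := cg v v'; rewrite q2 en.
have e44 := z _ _ _ (expr 0 0 0 1 0 0 0 1).
have d1 := z _ _ _ (expr 1 0 0 0 1 0 0 0).
have d2 := z _ _ _ (expr 0 1 0 0 0 1 0 0).
have d3 := z _ _ _ (expr 0 0 1 0 0 0 1 0).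
have f1 := z _ _ _ (expr 0 1 0 0 0 0 1 0).
have f2 := z _ _ _ (expr 0 0 1 0 1 0 0 0).
have f3 := z _ _ _ (expr 1 0 0 0 0 1 0 0).
rewrite !(mulr0, mul0r, mulr1, addr0, add0r) in e44 d1 d2 d3 f1 f2 f3.
move: e44 d1 d2 d3 f1 f2 f3; clear.
rewrite /crit_sys /diag_eq /off_eq /eq_diag /eq_off /trS /nrmS /nrmK.
move=> e0 d1 d2 d3 f1 f2 f3.
split; first by lra.
  by split; lra.
by split; lra.
Qed.

End CriticalSystem.

Section ListedMetricsAsStandard.
Context {R : realType}.

Lemma brackets_std (l : seq (seq R)) x1 x2 x3 u1 u2 u3 :
  (forall i j : 'I_3, nth 0 (nth [::] l i) j = std_mx x1 x2 x3 u1 u2 u3 i j) ->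
  brackets l = std x1 x2 x3 u1 u2 u3.
Proof.
move=> h; rewrite /brackets /std /orth_metric.
rewrite (_ : \matrix_(i, j) _ = std_mx x1 x2 x3 u1 u2 u3) //.
by apply/matrixP => i j; rewrite mxE h.
Qed.

Ltac std_entries :=
  apply: brackets_std; do 2 (case=> -[|[|[|]]] // ?);
  rewrite mxE /= ?oppr0 ?opprK.

(** The (1, 3) entry of [std_mx] is -u2, so a coefficient of e_3 in [e_1, e_4] enters [std] with the
    opposite sign. *)
Lemma metric1E : metric1 = std 1 0 (-1) 0 (-1) 0 :> left_inv_metric R.
Proof. by std_entries. Qed.

Lemma metric2E : metric2 = std 1 (-1) 0 (1 / Num.sqrt 2) (- (1 / Num.sqrt 2)) 0
  :> left_inv_metric R.
Proof. by std_entries. Qed.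

Lemma metric3E f p : metric3 f p = std 1 f p 0 0 0 :> left_inv_metric R.
Proof. by std_entries. Qed.

Lemma metric4E k h : metric4 k h = std 1 (- (k + 1 / 2)) (k - 1 / 2) h 0 0
  :> left_inv_metric R.
Proof. by std_entries. Qed.

Lemma metric5E p c h : metric5 p c h = std 1 (- (p + 1)) p h (- c) 0
  :> left_inv_metric R.
Proof. by std_entries. Qed.

Lemma metric6E h f : metric6 h f = std (1 / 3) f (- (f - 2 / 3)) h 0 0
  :> left_inv_metric R.
Proof. by std_entries. Qed.

Lemma metric7E b a : metric7 b a = std a (1 / 3) (- (a - 2 / 3)) b 0 b
  :> left_inv_metric R.
Proof. by std_entries. Qed.

End ListedMetricsAsStandard.

Section StandardSymmetric.
Context {R : realType}.

Lemma curv_std0 (x1 x2 x3 : R) a b c d a' b' c' d' a2 b2 c2 d2 :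
  curv (std x1 x2 x3 0 0 0) (v4 a b c d) (v4 a' b' c' d') (v4 a2 b2 c2 d2) =
  let s := x1 * a * a2 + x2 * b * b2 + x3 * c * c2 in
  let s' := x1 * a' * a2 + x2 * b' * b2 + x3 * c' * c2 in
  let e := d' * d2 in let e' := d * d2 in
  v4 (x1 * (s * a' - s' * a) - x1 ^+ 2 * (a * e - a' * e'))
     (x2 * (s * b' - s' * b) - x2 ^+ 2 * (b * e - b' * e'))
     (x3 * (s * c' - s' * c) - x3 ^+ 2 * (c * e - c' * e'))
     ((x1 ^+ 2 * a * a2 + x2 ^+ 2 * b * b2 + x3 ^+ 2 * c * c2) * d'
      - (x1 ^+ 2 * a' * a2 + x2 ^+ 2 * b' * b2 + x3 ^+ 2 * c' * c2) * d).
Proof.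
rewrite /curv !lie_std !nabla_std !v4N !v4D.
by apply: v4_inj; ring.
Qed.

(* Hyperbolic spaces, their products with a flat factor, and flat space. *)
Lemma std_locally_symmetric (x1 x2 x3 : R) :
  x1 ^+ 2 = x1 -> x2 ^+ 2 = x2 -> x3 ^+ 2 = x3 ->
  locally_symmetric (std x1 x2 x3 0 0 0).
Proof.
move=> h1 h2 h3 v x y z.
have [a [b [c [d ->]]]] := v4P v; have [a' [b' [c' [d' ->]]]] := v4P x.
have [a2 [b2 [c2 [d2 ->]]]] := v4P y; have [a3 [b3 [c3 [d3 ->]]]] := v4P z.
rewrite !nabla_std !curv_std0 /= !nabla_std !v4N !v4D.
have -> : 0 = v4 0 0 0 0 :> 'rV[R]_4.
  by apply/rowP => j; rewrite !mxE; case: j => -[|[|[|[|]]]].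
have x01 (t : R) : t ^+ 2 = t -> t = 0 \/ t = 1.
  move=> /eqP; rewrite -subr_eq0 expr2 -{3}[t]mulr1 -mulrBr mulf_eq0 subr_eq0.
  by move=> /orP[] /eqP ->; [left|right].
by case: (x01 _ h1) => ->; case: (x01 _ h2) => ->; case: (x01 _ h3) => ->;
  apply: v4_inj; ring.
Qed.

End StandardSymmetric.

(** * The parameters of the listed metrics *)

Section ParameterEquations.
Context {R : realType}.

Lemma exuniq_sqrt (A B : R) : 0 < A * B ->
  exists! h : R, 0 < h /\ h ^+ 2 * A = B.
Proof.
move=> AB; have A0 : A != 0 by apply: contraTneq AB => ->; rewrite mul0r ltxx.
have q0 : 0 < B / A.
  rewrite -(pmulr_rgt0 _ (_ : 0 < A ^+ 2)) ?exprn_even_gt0 //.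
  by rewrite (_ : A ^+ 2 * (B / A) = A * B) //; field.
exists (Num.sqrt (B / A)); split.
  by rewrite sqrtr_gt0 sqr_sqrtr ?ltW // divfK.
move=> h [h0 hA]; rewrite -hA mulfK // sqrtr_sqr gtr0_norm //.
Qed.

(** The bound 1/9 < q makes the other root, 1/3 minus the square root of q, negative. *)
Lemma exuniq_shifted_sqrt (q : R) : 1 / 9 < q ->
  exists! f : R, 0 < f /\ (f - 1 / 3) ^+ 2 = q.
Proof.
move=> q9; have q0 : 0 <= q by lra.
have s2 := sqr_sqrtr q0; set s := Num.sqrt q in s2.
have s0 : 0 <= s := sqrtr_ge0 q.
have s3 : 1 / 3 < s.
  by rewrite ltNge; apply/negP => s3; nra.
exists (s + 1 / 3); split; first by split; [lra|rewrite addrK].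
move=> f [f0 fq]; have : (f - 1 / 3 - s) * (f - 1 / 3 + s) = 0.
  by rewrite -subr_sqr fq s2 subrr.
by move/eqP; rewrite mulf_eq0 => /orP[] /eqP h; lra.
Qed.

Lemma range4_sq (k : R) : range4 k -> 0 < k /\ 3 < 4 * k ^+ 2.
Proof.
move=> h; have s0 := sqrtr_ge0 (3 : R).
have s2 : Num.sqrt 3 ^+ 2 = 3 :> R by rewrite sqr_sqrtr.
rewrite /range4 in h; split; [lra|nra].
Qed.

Lemma eqn4_exuniq (k : R) : range4 k -> exists! h : R, 0 < h /\ eqn4 k h.
Proof.
move=> /range4_sq [k0 k3].
have [|h [hP hU]] := @exuniq_sqrt (4 * k ^+ 2 - 3) (k ^+ 2 * (4 * k ^+ 2 + 3)).
  by apply: mulr_gt0; [lra|apply: mulr_gt0; nra].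
exists h; split; first by split; [exact: hP.1|rewrite /eqn4 hP.2 subrr].
by move=> h' [h'0 e]; apply: hU; split=> //; apply/eqP; rewrite -subr_eq0; apply/eqP.
Qed.

(* The cofactor of [x - y] in [cubic5 x - cubic5 y]. *)
Definition cubic5_slope (x y : R) := 8 * (x ^+ 2 + x * y + y ^+ 2) + 15 * (x + y) + 3.

Lemma cubic5B (x y : R) : cubic5 x - cubic5 y = (x - y) * cubic5_slope x y.
Proof. by rewrite /cubic5 /cubic5_slope; ring. Qed.

(** Completing the square in x leaves a quadratic in y alone, positive on this interval around the
    root. Since x is arbitrary, the sign of [cubic5 x - cubic5 y] is the sign of x - y for such
    y. *)
Lemma cubic5_slope_gt0 (x y : R) : -17/10 <= y <= -169/100 -> 0 < cubic5_slope x y.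
Proof.
move=> /andP[y1 y2].
have -> : cubic5_slope x y =
    8 * (x + (8 * y + 15) / 16) ^+ 2 + (6 * y ^+ 2 + 15 / 2 * y + 3 - 225 / 32).
  by rewrite /cubic5_slope; field.
have := sqr_ge0 (x + (8 * y + 15) / 16); nra.
Qed.

Lemma cubic5_root_bounds (z : R) : cubic5 z = 0 ->
  - (1 + 697 / 10 ^+ 3 + 465 / 10 ^+ 6) < z
  /\ z < - (1 + 697 / 10 ^+ 3 + 464 / 10 ^+ 6).
Proof.
move=> z0; set a := - _; set b := - (_ + _ / _).
have ca : cubic5 a < 0 by rewrite /cubic5 /a; lra.
have cb : 0 < cubic5 b by rewrite /cubic5 /b; lra.
have := cubic5B z a; have := cubic5B z b; rewrite z0 => eb ea.
have Qa : 0 < cubic5_slope z a by apply: cubic5_slope_gt0; rewrite /a; lra.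
have Qb : 0 < cubic5_slope z b by apply: cubic5_slope_gt0; rewrite /b; lra.
split; rewrite ltNge; apply/negP => h; nra.
Qed.

Lemma cubic5_exuniq : exists! z : R, cubic5 z = 0.
Proof.
pose p : {poly R} := 8%:P * 'X^3 + 15%:P * 'X^2 + 3%:P * 'X + 1%:P.
have pE x : p.[x] = cubic5 x by rewrite /p /cubic5 !(hornerE, hornerXn).
have [||z _ /rootP pz] := @poly_ivt R p (-2) (-1); first by lra.
  by rewrite !pE /cubic5; lra.
have z0 : cubic5 z = 0 by rewrite -pE.
exists z; split=> // y y0.
have [z1 z2] := cubic5_root_bounds z0.
have Q : 0 < cubic5_slope y z by apply: cubic5_slope_gt0; lra.
have := cubic5B y z; rewrite y0 z0 subrr => /esym/eqP.
by rewrite mulf_eq0 (gt_eqF Q) orbF subr_eq0 => /eqP.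
Qed.

(* The common leading coefficient and the constant terms of the equations for
   [c] and [h]. *)
Definition den5 (p : R) := (p + 2) * (5 * p ^+ 2 - p - 1).
Definition numc5 (p : R) := - (2 * p + 1) * cubic5 p.
Definition numh5 (p : R) := (p + 1) * (p - 1) * (5 * p ^+ 3 + 12 * p ^+ 2 + 1).

(** Positive c and h exist when both numerators share the sign of [den5]. All three are positive on
    the first interval and negative on the second, whose left end is the negative root of 5 p^2 - p
    - 1. *)
Lemma range5_signs (p : R) : range5 p ->
  [/\ p < 0, 0 < den5 p * numc5 p & 0 < den5 p * numh5 p].
Proof.
case=> [[z [z0 /andP[zp p1]]]|/andP[p1 p0]].
  have [z1 z2] := cubic5_root_bounds z0.
  have Q : 0 < cubic5_slope p z by apply: cubic5_slope_gt0; lra.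
  have cp : 0 < cubic5 p.
    by have := cubic5B p z; rewrite z0 subr0 => ->; apply: mulr_gt0 => //; lra.
  have pl : -17/10 < p by lra.
  have d0 : 0 < den5 p by apply: mulr_gt0; [lra|nra].
  split; first by lra.
    by apply: mulr_gt0 => //; apply: mulr_gt0 => //; lra.
  apply: mulr_gt0 => //; apply: mulr_gt0; first by nra.
  have -> : 5 * p ^+ 3 + 12 * p ^+ 2 + 1 = p ^+ 2 * (5 * p + 12) + 1 by ring.
  by rewrite ltr_wpDl // mulr_ge0 ?sqr_ge0 //; lra.
have s0 := sqrtr_ge0 (21 : R).
have s2 : Num.sqrt 21 ^+ 2 = 21 :> R by rewrite sqr_sqrtr.
set s := Num.sqrt 21 in p1 s0 s2.
(* The square of 46/10 is 21.16, so the left end of the interval lies above -36/100 and 2 p + 1 is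
   positive. *)
have sl : s < 46 / 10 by rewrite ltNge; apply/negP => h; nra.
have pl : - 36/100 < p by lra.
have q0 : 5 * p ^+ 2 - p - 1 < 0 by nra.
have d0 : den5 p < 0 by rewrite /den5 pmulr_rlt0 //; lra.
have c0 : 0 < cubic5 p.
  have -> : cubic5 p = p ^+ 2 * (8 * p + 6) + (9 * p ^+ 2 + 3 * p + 1).
    by rewrite /cubic5; ring.
  by apply: ltr_wpDl; [rewrite mulr_ge0 ?sqr_ge0 //; lra|nra].
split=> //; rewrite -mulrNN; apply: mulr_gt0; rewrite ?oppr_gt0 //.
  by rewrite /numc5 mulNr oppr_lt0 mulr_gt0 //; lra.
have h0 : 0 < 5 * p ^+ 3 + 12 * p ^+ 2 + 1.
  have -> : 5 * p ^+ 3 + 12 * p ^+ 2 + 1 = p ^+ 2 * (5 * p + 12) + 1 by ring.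
  by rewrite ltr_wpDl // mulr_ge0 ?sqr_ge0 //; lra.
by rewrite /numh5 pmulr_llt0 //; nra.
Qed.

(** A zero of [den5] other than -2 would be a common root of 5 p^2 - p - 1 and [numc5]; there is
    none. *)
Lemma den5_neq0 (p x : R) : p != -2 -> x * den5 p = numc5 p -> den5 p != 0.
Proof.
move=> p2 xc; apply/eqP => d0; move: xc; rewrite d0 mulr0 => /esym.
move: d0; rewrite /den5 => /eqP; rewrite mulf_eq0 addr_eq0 (negPf p2) /= => /eqP q.
rewrite /numc5 => /eqP; rewrite mulf_eq0 oppr_eq0 => /orP[] /eqP e.
  have pE : p = - (1 / 2) by lra.
  by move: q; rewrite pE; lra.
(* Reducing the cubic modulo 5 p^2 - p - 1 makes it linear in p, with root -6/11. *)
have p3 : p ^+ 3 = (p ^+ 2 + p) / 5.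
  have -> : p ^+ 3 = p * p ^+ 2 by ring.
  have -> : p ^+ 2 = (p + 1) / 5 by lra.
  by lra.
have pE : p = - (6 / 11) by move: e; rewrite /cubic5 p3; lra.
by move: q; rewrite pE; lra.
Qed.

(** Left of -1 the sign condition for c gives the bound by the root of the cubic; right of -1 the
    condition for h makes 5 p^2 - p - 1 negative. *)
Lemma range5P (p : R) : -2 < p < 0 -> p != -1 -> 0 < den5 p * numc5 p ->
  0 < den5 p * numh5 p -> range5 p.
Proof.
move=> /andP[p2 p0] p1 hc hh; have [pm|pm] := ltP p (-1).
  left; have [z [z0 _]] := cubic5_exuniq; exists z; split=> //; rewrite pm andbT.
  have d0 : 0 < den5 p by apply: mulr_gt0; [lra|nra].
  move: hc; rewrite pmulr_rgt0 // /numc5 pmulr_rgt0; last by lra.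
  have [z1 z2] := cubic5_root_bounds z0.
  have Q : 0 < cubic5_slope p z by apply: cubic5_slope_gt0; lra.
  have := cubic5B p z; rewrite z0 subr0 => ->.
  by rewrite pmulr_lgt0 // subr_gt0.
right; rewrite p0 andbT.
have {}pm : -1 < p by rewrite lt_neqAle eq_sym p1.
have n0 : numh5 p < 0.
  have h0 : 0 < 5 * p ^+ 3 + 12 * p ^+ 2 + 1.
    have -> : 5 * p ^+ 3 + 12 * p ^+ 2 + 1 = p ^+ 2 * (5 * p + 12) + 1 by ring.
    by rewrite ltr_wpDl // mulr_ge0 ?sqr_ge0 //; lra.
  by rewrite /numh5 pmulr_llt0 //; nra.
move: hh; rewrite nmulr_lgt0 // /den5 pmulr_rlt0; last by lra.
have s0 := sqrtr_ge0 (21 : R).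
have s2 : Num.sqrt 21 ^+ 2 = 21 :> R by rewrite sqr_sqrtr.
move=> q0; rewrite ltNge; apply/negP => ps; nra.
Qed.

Lemma eqn5cE (p c : R) : eqn5c p c <-> c ^+ 2 * den5 p = numc5 p.
Proof. by rewrite /eqn5c /den5 /numc5; split=> h; lra. Qed.

Lemma eqn5hE (p h : R) : eqn5h p h <-> h ^+ 2 * den5 p = numh5 p.
Proof. by rewrite /eqn5h /den5 /numh5; split=> e; lra. Qed.

Lemma eqn5_exuniq (p : R) : range5 p ->
  (exists! c : R, 0 < c /\ eqn5c p c) /\ (exists! h : R, 0 < h /\ eqn5h p h).
Proof.
move=> /range5_signs[_ sc sh]; split.
  have [c [[c0 ce] cU]] := exuniq_sqrt sc.
  exists c; split=> [|c' [c'0 /eqn5cE e]]; last exact: cU.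
  by split=> //; exact/eqn5cE.
have [c [[c0 ce] cU]] := exuniq_sqrt sh.
exists c; split=> [|c' [c'0 /eqn5hE e]]; last exact: cU.
by split=> //; exact/eqn5hE.
Qed.

Lemma eqn6E (h f : R) : eqn6 h f <-> (f - 1 / 3) ^+ 2 = 1 / 4 + h ^+ 2.
Proof. by rewrite /eqn6; split=> e; lra. Qed.

Lemma eqn6_exuniq (h : R) : 0 < h -> exists! f : R, 0 < f /\ eqn6 h f.
Proof.
move=> h0; have [|f [[f0 fe] fU]] := @exuniq_shifted_sqrt (1 / 4 + h ^+ 2).
  by have := sqr_ge0 h; lra.
exists f; split=> [|f' [f'0 /eqn6E e]]; last exact: fU.
by split=> //; exact/eqn6E.
Qed.

Lemma eqn7E (b a : R) : eqn7 b a <-> (a - 1 / 3) ^+ 2 = 1 + 2 * b ^+ 2.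
Proof. by rewrite /eqn7; split=> e; lra. Qed.

Lemma eqn7_exuniq (b : R) : 0 < b -> exists! a : R, 0 < a /\ eqn7 b a.
Proof.
move=> b0; have [|f [[f0 fe] fU]] := @exuniq_shifted_sqrt (1 + 2 * b ^+ 2).
  by have := sqr_ge0 b; lra.
exists f; split=> [|f' [f'0 /eqn7E e]]; last exact: fU.
by split=> //; exact/eqn7E.
Qed.

End ParameterEquations.

(** * The listed metrics are critical *)

Section ListedCritical.
Context {R : realType}.

(** Substituting m for t leaves m (T^2 + s) plus |K|^2, and the first equation of the system removes
    |K|^2. The listed energies are values of this formula. *)
Lemma energy_crit (m x1 x2 x3 u1 u2 u3 t : R) :
  - t * (trS x1 x2 x3 ^+ 2 + nrmS x1 x2 x3) = nrmS x1 x2 x3 - m ->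
  crit_sys m x1 x2 x3 u1 u2 u3 ->
  energy (std x1 x2 x3 u1 u2 u3) t = 4 / 3 * m * trS x1 x2 x3 ^+ 2.
Proof.
move=> tm [e _ _]; rewrite energy_std; move: tm e.
move: (trS _ _ _) (nrmS _ _ _) (nrmK _ _ _ _ _ _) => T s K tm e.
have -> : t * (T ^+ 2 + s) ^+ 2 = - (- t * (T ^+ 2 + s)) * (T ^+ 2 + s) by ring.
by rewrite tm; lra.
Qed.

Definition crit_with (t : R) (g : left_inv_metric R) (en : R) : Prop :=
  critical g t /\ energy g t = en.

(** In each application below the explicit first argument is m = s - t tau, computed from the listed
    t. *)
Lemma crit_withP (m x1 x2 x3 u1 u2 u3 t en : R) :
  - t * (trS x1 x2 x3 ^+ 2 + nrmS x1 x2 x3) = nrmS x1 x2 x3 - m ->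
  crit_sys m x1 x2 x3 u1 u2 u3 -> 4 / 3 * m * trS x1 x2 x3 ^+ 2 = en ->
  crit_with t (std x1 x2 x3 u1 u2 u3) en.
Proof.
by move=> tm cs <-; split; [exact/(critical_stdE _ _ _ tm)|exact: energy_crit].
Qed.

Lemma crit_metric1 : crit_with (-3) metric1 0.
Proof.
rewrite metric1E; apply: (@crit_withP (-4)); rewrite /trS /nrmS /nrmK; try lra.
by rewrite /crit_sys /trS /nrmS /nrmK /diag_eq /off_eq; do !split; lra.
Qed.

Lemma crit_metric2 : crit_with (- (3 / 2)) metric2 0.
Proof.
rewrite metric2E; set r := 1 / Num.sqrt 2.
have r2 : r ^+ 2 = 1 / 2.
  by rewrite /r expr_div_n sqr_sqrtr // expr1n.
have r3 : r ^+ 3 = r / 2 by rewrite exprS r2 mulrA mulr1.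
apply: (@crit_withP (-1)); rewrite /trS /nrmS /nrmK; try lra.
by rewrite /crit_sys /trS /nrmS /nrmK /diag_eq /off_eq; do !split; lra.
Qed.

Lemma crit_metric3 (f p : R) : crit_with (t3 f p) (metric3 f p) 0.
Proof.
have D0 : f ^+ 2 + p ^+ 2 + f * p + f + p + 1 != 0.
  rewrite gt_eqF //.
  have := sqr_ge0 (f + p); have := sqr_ge0 (f + 1); have := sqr_ge0 (p + 1).
  by rewrite !expr2 => h1 h2 h3; nra.
rewrite metric3E; apply: (@crit_withP 0); rewrite /trS /nrmS /nrmK; last by lra.
  by rewrite /t3; field.
by rewrite /crit_sys /trS /nrmS /nrmK /diag_eq /off_eq; do !split; lra.
Qed.

Lemma crit_metric4 (k h : R) : param4 k h -> crit_with (t4 k) (metric4 k h) 0.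
Proof.
move=> [/range4_sq[k0 k3] [h0 e]]; rewrite /eqn4 in e.
have D1 : 4 * k ^+ 2 - 3 != 0 by rewrite gt_eqF // subr_gt0.
have D2 : 16 * k ^+ 4 - 9 != 0.
  have -> : 16 * k ^+ 4 - 9 = (4 * k ^+ 2 - 3) * (4 * k ^+ 2 + 3) by ring.
  by rewrite mulf_neq0 // gt_eqF // addr_gt0 // mulr_gt0 // exprn_gt0.
have hE : h ^+ 2 = k ^+ 2 * (4 * k ^+ 2 + 3) / (4 * k ^+ 2 - 3).
  by apply: (mulIf D1); rewrite divfK //; lra.
rewrite metric4E; apply: (@crit_withP (- 2 * h ^+ 2 - 2 * k ^+ 2));
  rewrite /trS /nrmS /nrmK; last by lra.
  by rewrite /t4 hE; field; rewrite D1 D2.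
by rewrite /crit_sys /trS /nrmS /nrmK /diag_eq /off_eq; do !split; lra.
Qed.

Lemma crit_metric6 (h f : R) : param6 h f ->
  crit_with (t6 h) (metric6 h f) (- (16 / 3) * h ^+ 2).
Proof.
move=> [h0 [f0 /eqn6E e]].
have D : 12 * h ^+ 2 + 11 != 0.
  by rewrite gt_eqF // ltr_wpDl // mulr_ge0 // sqr_ge0.
have fE : f ^+ 2 = 2 / 3 * f + 5 / 36 + h ^+ 2 by lra.
have f3 : f ^+ 3 = 2 / 3 * f ^+ 2 + 5 / 36 * f + h ^+ 2 * f.
  have -> : f ^+ 3 = f ^+ 2 * f by ring.
  by rewrite {1}fE; ring.
rewrite metric6E; apply: (@crit_withP (- 4 * h ^+ 2)); rewrite /trS /nrmS /nrmK.
- rewrite /t6.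
  have -> : (1 / 3) ^+ 2 + f ^+ 2 + (- (f - 2 / 3)) ^+ 2 = 5 / 6 + 2 * h ^+ 2 by lra.
  by field.
(* The final goals are linear once monomials count as atoms, so the relation between f and h is
   supplied already multiplied by the monomials that occur. *)
- have hf2 : h * f ^+ 2 = h * (2 / 3 * f + 5 / 36 + h ^+ 2) by rewrite fE.
  have hf3 : h * f ^+ 3 = h * (2 / 3 * f ^+ 2 + 5 / 36 * f + h ^+ 2 * f) by rewrite f3.
  have h2f2 : h ^+ 2 * f ^+ 2 = h ^+ 2 * (2 / 3 * f + 5 / 36 + h ^+ 2) by rewrite fE.
  by rewrite /crit_sys /trS /nrmS /nrmK /diag_eq /off_eq; do !split; lra.
- by lra.
Qed.

Lemma crit_metric7 (b a : R) : param7 b a ->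
  crit_with (t7 b) (metric7 b a) (- (8 / 3) * b ^+ 2).
Proof.
move=> [b0 [a0 /eqn7E e]].
have D : 12 * b ^+ 2 + 10 != 0.
  by rewrite gt_eqF // ltr_wpDl // mulr_ge0 // sqr_ge0.
have aE : a ^+ 2 = 2 / 3 * a + 8 / 9 + 2 * b ^+ 2 by lra.
have a3 : a ^+ 3 = 2 / 3 * a ^+ 2 + 8 / 9 * a + 2 * b ^+ 2 * a.
  have -> : a ^+ 3 = a ^+ 2 * a by ring.
  by rewrite {1}aE; ring.
rewrite metric7E; apply: (@crit_withP (- 2 * b ^+ 2)); rewrite /trS /nrmS /nrmK.
- rewrite /t7.
  have -> : a ^+ 2 + (1 / 3) ^+ 2 + (- (a - 2 / 3)) ^+ 2 = 7 / 3 + 4 * b ^+ 2 by lra.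
  by field.
- have ba2 : b * a ^+ 2 = b * (2 / 3 * a + 8 / 9 + 2 * b ^+ 2) by rewrite aE.
  have ba3 : b * a ^+ 3 = b * (2 / 3 * a ^+ 2 + 8 / 9 * a + 2 * b ^+ 2 * a) by rewrite a3.
  have b2a2 : b ^+ 2 * a ^+ 2 = b ^+ 2 * (2 / 3 * a + 8 / 9 + 2 * b ^+ 2) by rewrite aE.
  by rewrite /crit_sys /trS /nrmS /nrmK /diag_eq /off_eq; do !split; lra.
- by lra.
Qed.

Lemma crit_metric5 (p c h : R) : param5 p c h -> crit_with (t5 p) (metric5 p c h) 0.
Proof.
move=> [/range5_signs[p0 sc _] [[c0 /eqn5cE ec] [h0 /eqn5hE eh]]].
have D : den5 p != 0 by apply: contraTneq sc => ->; rewrite mul0r ltxx.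
have [D1 D2] : p + 2 != 0 /\ 5 * p ^+ 2 - p - 1 != 0.
  by move: D; rewrite /den5 mulf_eq0 negb_or => /andP.
have D3 : p ^+ 2 + p + 1 != 0.
  by rewrite gt_eqF //; have := sqr_ge0 (p + 1 / 2); rewrite !expr2 => ?; lra.
have cE : c ^+ 2 = numc5 p / den5 p by rewrite -ec mulfK.
have hE : h ^+ 2 = numh5 p / den5 p by rewrite -eh mulfK.
have c3 : c ^+ 3 = numc5 p / den5 p * c by rewrite exprSr cE.
have h3 : h ^+ 3 = numh5 p / den5 p * h by rewrite exprSr hE.
rewrite metric5E.
apply: (@crit_withP ((- 20 * p ^+ 4 + 8 * p ^+ 3 + 9 * p ^+ 2 + 2 * p + 1)
    / (5 * p ^+ 2 - p - 1))); rewrite /trS /nrmS /nrmK.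
- by rewrite /t5; field; rewrite D2.
- rewrite /crit_sys /trS /nrmS /nrmK /diag_eq /off_eq; split; last split.
  + rewrite !exprMn !sqrrN hE cE /numh5 /numc5 /den5 /cubic5; field.
    by rewrite D2.
  + by split; ring.
  + rewrite !sqrrN cE hE /numh5 /numc5 /den5 /cubic5; field.
    by rewrite D2.
  + rewrite !sqrrN cE hE /numh5 /numc5 /den5 /cubic5; field.
    by rewrite D2.
  + by ring.
- by field; rewrite D2.
Qed.

End ListedCritical.

(** * Algebraic Ricci solitons *)

Section Solitons.
Context {R : realType}.

Lemma v4_inv (a b c d a' b' c' d' : R) : v4 a b c d = v4 a' b' c' d' ->
  [/\ a = a', b = b', c = c' & d = d'].
Proof.
move=> e; have h i : v4 a b c d 0 i = v4 a' b' c' d' 0 i by rewrite e.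
by split; [have := h (inord 0)|have := h (inord 1)|have := h (inord 2)|
  have := h (inord 3)]; rewrite !v4E.
Qed.

Lemma mul_Ric_std (x1 x2 x3 u1 u2 u3 a b c d : R) :
  let T := x1 + x2 + x3 in
  let k1 := u1 * (x2 - x3) in let k2 := u2 * (x3 - x1) in
  let k3 := u3 * (x1 - x2) in
  v4 a b c d *m Ric (std x1 x2 x3 u1 u2 u3) =
  v4 (- T * x1 * a + k2 * c + k3 * b) (- T * x2 * b + k1 * c + k3 * a)
     (- T * x3 * c + k1 * b + k2 * a) (- (x1 ^+ 2 + x2 ^+ 2 + x3 ^+ 2) * d).
Proof.
move=> T k1 k2 k3; rewrite Ric_std; set g := std _ _ _ _ _ _.
have E j : (v4 a b c d *m ricci_mx g) 0 j = ricci g (v4 a b c d) (e_ j).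
  rewrite mxE [v4 a b c d in RHS]rV_sum_e.
  elim/big_rec2: _ => [|i y z _ ->].
    by have := @ricci_linl _ g (e_ j) (-1) 0 0; rewrite scaler0 addr0 mulN1r addNr.
  by rewrite ricci_linl [ricci_mx g i j]mxE.
have [p [q [r [s e]]]] := v4P (v4 a b c d *m ricci_mx g).
have := E (inord 0); have := E (inord 1); have := E (inord 2); have := E (inord 3).
rewrite e !v4E !e_v4 !ricci_std => -> -> -> ->.
by apply: v4_inj; rewrite /T /k1 /k2 /k3; ring.
Qed.

Lemma soliton_std (x1 x2 x3 u1 u2 u3 l : R) :
  derivation (std x1 x2 x3 u1 u2 u3)
    (Ric (std x1 x2 x3 u1 u2 u3) - l%:M) ->
  algebraic_soliton (std x1 x2 x3 u1 u2 u3).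
Proof.
move=> d; exists l, (Ric (std x1 x2 x3 u1 u2 u3) - l%:M).
by rewrite addrCA subrr addr0.
Qed.

Ltac expand_derivation :=
  rewrite !mulmxBr !mul_mx_scalar !lie_std !mul_Ric_std !v4Z !v4N !v4D !lie_std
    ?mul_Ric_std ?v4Z ?v4N ?v4D.

Ltac check_derivation :=
  let v := fresh in let w := fresh in
  move=> v w; have [? [? [? [? ->]]]] := v4P v; have [? [? [? [? ->]]]] := v4P w;
  expand_derivation.

Lemma soliton1 : algebraic_soliton (metric1 : left_inv_metric R).
Proof.
(* The constant is -s - mu: Ric acts on e_4 by -s, and the derivation acts there by the mu for which
   [M, Ric] = mu M. Here s = 2 and mu = 4; for [soliton2] mu is 1, for [soliton3] it is 0. *)
rewrite metric1E; apply: (@soliton_std _ _ _ _ _ _ (-6)); check_derivation.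
by apply: v4_inj; ring.
Qed.

Lemma soliton2 : algebraic_soliton (metric2 : left_inv_metric R).
Proof.
rewrite metric2E.
have : (1 / Num.sqrt 2 : R) ^+ 2 = 1 / 2 by rewrite expr_div_n sqr_sqrtr // expr1n.
move: (1 / Num.sqrt 2) => r r2.
apply: (@soliton_std _ _ _ _ _ _ (-3)) => v w.
have [a [b [c [d ->]]]] := v4P v; have [a' [b' [c' [d' ->]]]] := v4P w.
expand_derivation.
have E x : r ^+ 2 * x = x / 2 by rewrite r2; field.
have E1 := E (a * d'); have E2 := E (b * d'); have E3 := E (c * d').
have E4 := E (a' * d); have E5 := E (b' * d); have E6 := E (c' * d).
by apply: v4_inj; lra.
Qed.

Lemma soliton3 (f p : R) : algebraic_soliton (metric3 f p).
Proof.
rewrite metric3E; apply: (@soliton_std _ _ _ _ _ _ (- (1 + f ^+ 2 + p ^+ 2))).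
check_derivation.
by apply: v4_inj; ring.
Qed.

(* The entries of [[M, Ric] = mu M], with its symmetric off-diagonal part. *)
Lemma soliton_std_eqs (x1 x2 x3 u1 u2 u3 : R) :
  algebraic_soliton (std x1 x2 x3 u1 u2 u3) ->
  let T := x1 + x2 + x3 in
  let k1 := u1 * (x2 - x3) in let k2 := u2 * (x3 - x1) in
  let k3 := u3 * (x1 - x2) in
  exists mu, [/\ 2 * (u3 * k3 - u2 * k2) = mu * x1,
    2 * (u1 * k1 - u3 * k3) = mu * x2, 2 * (u2 * k2 - u1 * k1) = mu * x3 &
    [/\ T * k1 = u3 * k2 - u2 * k3, T * k2 = u1 * k3 - u3 * k1 &
        T * k3 = u2 * k1 - u1 * k2]].
Proof.
move=> [l [P [dP RicP]]] T k1 k2 k3; set g := std _ _ _ _ _ _ in dP RicP.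
have PE : P = Ric g - l%:M by rewrite RicP addrC addKr.
have D a b c := dP (v4 a b c 0) (v4 0 0 0 1).
have {}D a b c : lie g (v4 a b c 0) (v4 0 0 0 1) *m Ric g
   - l *: lie g (v4 a b c 0) (v4 0 0 0 1) =
   lie g (v4 a b c 0 *m Ric g - l *: v4 a b c 0) (v4 0 0 0 1)
   + lie g (v4 a b c 0) (v4 0 0 0 1 *m Ric g - l *: v4 0 0 0 1).
  by have := D a b c; rewrite PE !mulmxBr !mul_mx_scalar.
have D1 := D 1 0 0; have D2 := D 0 1 0; have D3 := D 0 0 1.
rewrite !lie_std !mul_Ric_std !v4Z !v4N !v4D !lie_std !v4D in D1 D2 D3.
have [a1 b1 c1 _] := v4_inv D1; have [a2 b2 c2 _] := v4_inv D2.
have [a3 b3 c3 _] := v4_inv D3.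
exists (- (x1 ^+ 2 + x2 ^+ 2 + x3 ^+ 2) - l).
move: a1 b1 c1 a2 b2 c2 a3 b3 c3; rewrite /T /k1 /k2 /k3; clear.
move=> *; split; [lra|lra|lra|split; lra].
Qed.

Lemma not_soliton4 (k h : R) : param4 k h -> ~ algebraic_soliton (metric4 k h).
Proof.
move=> [/range4_sq[k0 _] [h0 _]]; rewrite metric4E => /soliton_std_eqs[mu] [e1 e2 _ _].
have mu0 : mu = 0 by lra.
move: e2; rewrite mu0 => e2.
have : h ^+ 2 * k = 0 by lra.
by move/eqP; rewrite mulf_eq0 expf_eq0 !gt_eqF.
Qed.

(** With T = 0 and u3 = 0 the third off-diagonal soliton equation reads 3 h c p = 0. *)
Lemma not_soliton5 (p c h : R) : param5 p c h -> ~ algebraic_soliton (metric5 p c h).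
Proof.
move=> [/range5_signs[p0 _ _] [[c0 _] [h0 _]]]; rewrite metric5E.
move=> /soliton_std_eqs[mu] [_ _ _ [_ _ e]].
have : h * c * p = 0 by lra.
by move/eqP; rewrite !mulf_eq0 !(gt_eqF h0, gt_eqF c0, lt_eqF p0).
Qed.

Lemma not_soliton6 (h f : R) : param6 h f -> ~ algebraic_soliton (metric6 h f).
Proof.
move=> [h0 [f0 /eqn6E e]]; rewrite metric6E => /soliton_std_eqs[mu] [_ _ _ [e1 _ _]].
have : h * (f - 1 / 3) = 0 by lra.
move/eqP; rewrite mulf_eq0 gt_eqF //= => /eqP f3; move: e; rewrite f3.
by have := sqr_ge0 h; lra.
Qed.

Lemma not_soliton7 (b a : R) : param7 b a -> ~ algebraic_soliton (metric7 b a).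
Proof.
move=> [b0 [a0 /eqn7E e]]; rewrite metric7E => /soliton_std_eqs[mu] [_ _ _ [_ _ e1]].
have : b * (a - 1 / 3) = 0 by lra.
move/eqP; rewrite mulf_eq0 gt_eqF //= => /eqP a3; move: e; rewrite a3.
by have := sqr_ge0 b; lra.
Qed.

End Solitons.

(** * Classification *)

Section NormalForms.
Context {R : realType}.
Implicit Types (g : left_inv_metric R) (x y z u v w b c s : R).

Lemma mx3_eq a1 a2 a3 a4 a5 a6 a7 a8 a9 b1 b2 b3 b4 b5 b6 b7 b8 b9 :
  a1 = b1 -> a2 = b2 -> a3 = b3 -> a4 = b4 -> a5 = b5 -> a6 = b6 ->
  a7 = b7 -> a8 = b8 -> a9 = b9 ->
  mx3 a1 a2 a3 a4 a5 a6 a7 a8 a9 = mx3 b1 b2 b3 b4 b5 b6 b7 b8 b9 :> 'M[R]_3.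
Proof. by do 9 move=> ->. Qed.

Lemma mx3M a1 a2 a3 a4 a5 a6 a7 a8 a9 b1 b2 b3 b4 b5 b6 b7 b8 b9 :
  mx3 a1 a2 a3 a4 a5 a6 a7 a8 a9 *m mx3 b1 b2 b3 b4 b5 b6 b7 b8 b9 =
  mx3 (a1 * b1 + a2 * b4 + a3 * b7) (a1 * b2 + a2 * b5 + a3 * b8)
      (a1 * b3 + a2 * b6 + a3 * b9)
      (a4 * b1 + a5 * b4 + a6 * b7) (a4 * b2 + a5 * b5 + a6 * b8)
      (a4 * b3 + a5 * b6 + a6 * b9)
      (a7 * b1 + a8 * b4 + a9 * b7) (a7 * b2 + a8 * b5 + a9 * b8)
      (a7 * b3 + a8 * b6 + a9 * b9) :> 'M[R]_3.
Proof.
apply/matrixP => i j; rewrite mxE !big_ord_recl big_ord0 addr0 addrA !mxE.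
by case: i => -[|[|[|]]] // ?; case: j => -[|[|[|]]].
Qed.

Lemma mx3_tr a1 a2 a3 a4 a5 a6 a7 a8 a9 :
  (mx3 a1 a2 a3 a4 a5 a6 a7 a8 a9)^T = mx3 a1 a4 a7 a2 a5 a8 a3 a6 a9 :> 'M[R]_3.
Proof.
by apply/matrixP => -[[|[|[|]]] // ?] [[|[|[|]]] // ?]; rewrite !mxE.
Qed.

Lemma mx3_1 : mx3 1 0 0 0 1 0 0 0 1 = 1%:M :> 'M[R]_3.
Proof.
by apply/matrixP => -[[|[|[|]]] // ?] [[|[|[|]]] // ?]; rewrite !mxE.
Qed.

Definition srep g x1 x2 x3 u1 u2 u3 : Prop := rep g (std_mx x1 x2 x3 u1 u2 u3).

Lemma srep_exists g : exists x1 x2 x3 u1 u2 u3, srep g x1 x2 x3 u1 u2 u3.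
Proof.
have [d [A [At gA]]] := rep_exists_diag g.
pose o0 : 'I_3 := @Ordinal 3 0 isT; pose o1 : 'I_3 := @Ordinal 3 1 isT.
pose o2 : 'I_3 := @Ordinal 3 2 isT.
exists (d 0 o0), (d 0 o1), (d 0 o2), (A o1 o2), (- A o0 o2), (A o0 o1).
have E i j : A j i = - A i j by have /matrixP/(_ i j) := At; rewrite !mxE.
have Z i : A i i = 0 by have := E i i; lra.
rewrite /srep (_ : std_mx _ _ _ _ _ _ = diag_mx d + A) //.
by apply/matrixP => -[[|[|[|]]] // p] [[|[|[|]]] // q]; rewrite !mxE /=
  !(bool_irrelevance p isT) !(bool_irrelevance q isT) ?mulr1n ?mulr0n ?Z ?addr0 ?add0r
  ?opprK // E.
Qed.

Lemma srep_orth g x1 x2 x3 u1 u2 u3 y1 y2 y3 v1 v2 v3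
    a1 a2 a3 a4 a5 a6 a7 a8 a9 :
  srep g x1 x2 x3 u1 u2 u3 ->
  mx3 a1 a2 a3 a4 a5 a6 a7 a8 a9 *m mx3 a1 a4 a7 a2 a5 a8 a3 a6 a9 = 1%:M ->
  mx3 a1 a2 a3 a4 a5 a6 a7 a8 a9 *m std_mx x1 x2 x3 u1 u2 u3
    *m mx3 a1 a4 a7 a2 a5 a8 a3 a6 a9 = std_mx y1 y2 y3 v1 v2 v3 ->
  srep g y1 y2 y3 v1 v2 v3.
Proof. rewrite -(mx3_tr a1 a2 a3 a4 a5 a6 a7 a8 a9) => gx QQ QE.
by rewrite /srep -QE; exact: rep_orth. Qed.

Lemma srep_scale g b x1 x2 x3 u1 u2 u3 : b != 0 -> srep g x1 x2 x3 u1 u2 u3 ->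
  srep g (b * x1) (b * x2) (b * x3) (b * u1) (b * u2) (b * u3).
Proof.
move=> b0 /(rep_scale b0); rewrite /srep (_ : _ *: _ = std_mx (b * x1) (b * x2)
  (b * x3) (b * u1) (b * u2) (b * u3)) //.
by apply/matrixP => -[[|[|[|]]] // ?] [[|[|[|]]] // ?]; rewrite !mxE //= mulrN.
Qed.

Lemma srep_cycle g x1 x2 x3 u1 u2 u3 :
  srep g x1 x2 x3 u1 u2 u3 -> srep g x2 x3 x1 u2 u3 u1.
Proof.
move/(@srep_orth g _ _ _ _ _ _ _ _ _ _ _ _ 0 1 0 0 0 1 1 0 0); apply.
  by rewrite mx3M -mx3_1; apply: mx3_eq; ring.
by rewrite !mx3M; apply: mx3_eq; ring.
Qed.

Lemma srep_swap g x1 x2 x3 u1 u2 u3 :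
  srep g x1 x2 x3 u1 u2 u3 -> srep g x2 x1 x3 (- u2) (- u1) (- u3).
Proof.
move/(@srep_orth g _ _ _ _ _ _ _ _ _ _ _ _ 0 1 0 1 0 0 0 0 1); apply.
  by rewrite mx3M -mx3_1; apply: mx3_eq; ring.
by rewrite !mx3M; apply: mx3_eq; ring.
Qed.

Lemma srep_flip g x1 x2 x3 u1 u2 u3 :
  srep g x1 x2 x3 u1 u2 u3 -> srep g x1 x2 x3 u1 (- u2) (- u3).
Proof.
move/(@srep_orth g _ _ _ _ _ _ _ _ _ _ _ _ (-1) 0 0 0 1 0 0 0 1); apply.
  by rewrite mx3M -mx3_1; apply: mx3_eq; ring.
by rewrite !mx3M; apply: mx3_eq; ring.
Qed.

(** A double eigenvalue leaves the rotations of its plane free; they act on (u1, u2) and can make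
    one of the two vanish. *)
Lemma srep_rotate g x x3 u1 u2 u3 c s : c ^+ 2 + s ^+ 2 = 1 ->
  srep g x x x3 u1 u2 u3 ->
  srep g x x x3 (c * u1 + s * u2) (c * u2 - s * u1) u3.
Proof.
move=> cs; move/(@srep_orth g _ _ _ _ _ _ _ _ _ _ _ _ c s 0 (- s) c 0 0 0 1).
have E a : s ^+ 2 * a = (1 - c ^+ 2) * a by congr (_ * a); lra.
have E1 := E x; have E2 := E u3.
apply; first by rewrite mx3M -mx3_1; apply: mx3_eq; lra.
by rewrite !mx3M; apply: mx3_eq; lra.
Qed.

Lemma srep_homothetic_diag g x1 x2 x3 u1 u2 u3 : srep g x1 x2 x3 u1 u2 u3 ->
  u1 * (x2 - x3) = 0 -> u2 * (x3 - x1) = 0 -> u3 * (x1 - x2) = 0 ->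
  homothetic g (std x1 x2 x3 0 0 0).
Proof.
move=> gx e1 e2 e3; apply: (@rep_homothetic_normal _ _ _ (std_mx 0 0 0 u1 u2 u3)).
- rewrite (_ : _ + _ = std_mx x1 x2 x3 u1 u2 u3) //.
  by apply/matrixP => -[[|[|[|]]] // ?] [[|[|[|]]] // ?];
    rewrite !mxE //= ?oppr0 ?addr0 ?add0r.
- by rewrite !mx3M; apply: mx3_eq; lra.
- rewrite mx3_tr; apply/matrixP => -[[|[|[|]]] // ?] [[|[|[|]]] // ?];
    by rewrite !mxE //= ?oppr0 ?opprK.
Qed.

Lemma srep_homothetic g x1 x2 x3 u1 u2 u3 : srep g x1 x2 x3 u1 u2 u3 ->
  homothetic g (std x1 x2 x3 u1 u2 u3).
Proof.
move=> gx; apply: (@rep_homothetic_normal _ _ _ 0).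
- by rewrite addr0.
- by rewrite mulmx0 mul0mx.
- by rewrite trmx0 oppr0.
Qed.

Lemma srep_crit_sys g t x1 x2 x3 u1 u2 u3 : srep g x1 x2 x3 u1 u2 u3 ->
  critical g t ->
  crit_sys (nrmS x1 x2 x3 + t * (trS x1 x2 x3 ^+ 2 + nrmS x1 x2 x3))
    x1 x2 x3 u1 u2 u3.
Proof.
move=> /srep_homothetic/(homothetic_critical t)-> /critical_stdE; apply.
by ring.
Qed.

Lemma nrmS_ge0 x1 x2 x3 : 0 <= nrmS x1 x2 x3.
Proof. by rewrite !addr_ge0 // sqr_ge0. Qed.

Lemma nrmS_tracefree x1 x2 x3 : 3 * nrmS x1 x2 x3 - trS x1 x2 x3 ^+ 2 =
  (x2 - x3) ^+ 2 + (x3 - x1) ^+ 2 + (x1 - x2) ^+ 2.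
Proof. by rewrite /nrmS /trS; ring. Qed.

(* The first equation of the system determines [m], hence [t]. *)
Lemma critical_std_t_unique x1 x2 x3 u1 u2 u3 t t' :
  trS x1 x2 x3 ^+ 2 != 3 * nrmS x1 x2 x3 ->
  critical (std x1 x2 x3 u1 u2 u3) t -> critical (std x1 x2 x3 u1 u2 u3) t' ->
  t = t'.
Proof.
have := nrmS_ge0 x1 x2 x3; have := sqr_ge0 (trS x1 x2 x3).
have := nrmS_tracefree x1 x2 x3.
set T2 := _ ^+ 2; set s := nrmS _ _ _ => e T0 s0 Ts.
have P : T2 + s != 0.
  apply: contra_neq Ts => Ts.
  have -> : s = 0 by lra.
  by lra.
have C t0 : critical (std x1 x2 x3 u1 u2 u3) t0 ->
    (s + t0 * (T2 + s)) * (T2 - 3 * s) = 6 * nrmK x1 x2 x3 u1 u2 u3.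
  move=> /(@critical_stdE _ _ _ _ _ _ _ _ (s + t0 * (T2 + s)))[|->] //.
  by rewrite /T2 -/s; ring.
move=> /C e1 /C e2; apply: (mulIf P); apply: (addrI s).
by apply: (@mulIf _ (T2 - 3 * s)); [rewrite subr_eq0|rewrite e1 e2].
Qed.

End NormalForms.

(** * Case analysis of the critical system *)

Section Classification.
Context {R : realType} (g : left_inv_metric R) (t : R).
Context (critg : critical g t) (nsg : ~ locally_symmetric g).
Implicit Types (x y z u v w b c h f p m : R).

Definition classified : Prop :=
  exists g', (listed_a t g' \/ listed_b t g') /\ homothetic g g'.

Local Notation srep := (srep g).

Lemma srep_crit x1 x2 x3 u1 u2 u3 : srep x1 x2 x3 u1 u2 u3 ->
  exists m, crit_sys m x1 x2 x3 u1 u2 u3.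
Proof.
move=> gx; exists (nrmS x1 x2 x3 + t * (trS x1 x2 x3 ^+ 2 + nrmS x1 x2 x3)).
exact: srep_crit_sys gx critg.
Qed.

(** The formula for t never has to be derived: the model is critical for t and for the listed value,
    and these agree when S is not scalar. *)
Lemma srep_listed g' x1 x2 x3 u1 u2 u3 t' en : srep x1 x2 x3 u1 u2 u3 ->
  trS x1 x2 x3 ^+ 2 != 3 * nrmS x1 x2 x3 ->
  g' = std x1 x2 x3 u1 u2 u3 -> crit_with t' g' en -> t = t' /\ homothetic g g'.
Proof.
move=> /srep_homothetic gx Ts -> [ct' _]; split=> //.
by apply: critical_std_t_unique Ts _ ct'; apply/(homothetic_critical t gx).
Qed.

Lemma srep_swap23 x1 x2 x3 u1 u2 u3 :
  srep x1 x2 x3 u1 u2 u3 -> srep x1 x3 x2 (- u1) (- u3) (- u2).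
Proof. by move/srep_cycle/srep_swap/srep_cycle/srep_cycle. Qed.

Lemma srep_flip2 x1 x2 x3 u1 u2 u3 :
  srep x1 x2 x3 u1 u2 u3 -> srep x1 x2 x3 (- u1) u2 (- u3).
Proof. by move/srep_cycle/srep_flip/srep_cycle/srep_cycle. Qed.

Lemma trS_sq_eq x1 x2 x3 : trS x1 x2 x3 ^+ 2 = 3 * nrmS x1 x2 x3 -> x1 = x2 /\ x2 = x3.
Proof.
move=> e; have := nrmS_tracefree x1 x2 x3; rewrite e subrr => /esym e0.
have h1 := sqr_ge0 (x2 - x3); have h2 := sqr_ge0 (x3 - x1).
have h3 := sqr_ge0 (x1 - x2).
split; apply/eqP; rewrite -subr_eq0 -sqrf_eq0; apply/eqP; lra.
Qed.

Definition commuting x1 x2 x3 u1 u2 u3 : Prop :=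
  [/\ u1 * (x2 - x3) = 0, u2 * (x3 - x1) = 0 & u3 * (x1 - x2) = 0].

(** For f <= p the removed pairs (0, 0), (0, 1), (1, 1) are exactly those with f^2 = f and p^2 = p,
    whose metrics are locally symmetric. *)
Lemma classified_diag_ordered f p u1 u2 u3 : srep 1 f p u1 u2 u3 ->
  commuting 1 f p u1 u2 u3 -> -1 <= f <= p -> p <= 1 -> ~ (f = -1 /\ p < 0) ->
  classified.
Proof.
move=> gx [e1 e2 e3] fp p1 nfp.
have gm := srep_homothetic_diag gx e1 e2 e3.
have ns : f ^+ 2 = f -> p ^+ 2 = p -> False.
  move=> ff pp; apply: nsg; apply/(homothetic_locally_symmetric gm).
  by apply: std_locally_symmetric => //; ring.
have par : param3 f p.
  split=> //; split=> //; split; first by move=> [f1 /andP[_ p0]]; apply: nfp.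
  by do !split; move=> [ff pp]; apply: ns; rewrite ?ff ?pp; ring.
exists (metric3 f p); split; last by rewrite metric3E.
left; right; right; left; exists f, p; split=> //.
have [] := crit_metric3 f p; rewrite metric3E => c3 _.
apply: critical_std_t_unique _ c3; last exact/(homothetic_critical t gm).
by apply/eqP => /trS_sq_eq[f1 fp1]; apply: ns; rewrite -?fp1 -f1; ring.
Qed.

Lemma classified_diag_max x1 x2 x3 u1 u2 u3 : srep x1 x2 x3 u1 u2 u3 ->
  commuting x1 x2 x3 u1 u2 u3 -> x1 != 0 -> x2 ^+ 2 <= x1 ^+ 2 -> x3 ^+ 2 <= x1 ^+ 2 ->
  classified.
Proof.
move=> gx [e1 e2 e3] x0 h2 h3.
have b0 : x1^-1 != 0 by rewrite invr_eq0.
have unit_sq z : z ^+ 2 <= x1 ^+ 2 -> -1 <= x1^-1 * z <= 1.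
  move=> h; have : (x1^-1 * z) ^+ 2 <= 1.
    rewrite exprMn exprVn mulrC ler_pdivrMr ?mul1r //.
    by rewrite exprn_even_gt0.
  by move: (_ * z) => w w1; apply/andP; split; rewrite leNgt; apply/negP => ?; nra.
have := srep_scale b0 gx; rewrite mulVf //.
have {e1} := congr1 (fun a => x1^-1 ^+ 2 * a) e1.
have {e2} := congr1 (fun a => x1^-1 ^+ 2 * a) e2.
have {e3} := congr1 (fun a => x1^-1 ^+ 2 * a) e3.
have := mulVf x0; have := unit_sq _ h2; have := unit_sq _ h3.
rewrite !mulr0.
have -> : x1^-1 ^+ 2 * (u3 * (x1 - x2)) =
  x1^-1 * u3 * (x1^-1 * x1 - x1^-1 * x2) by ring.
have -> : x1^-1 ^+ 2 * (u2 * (x3 - x1)) =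
  x1^-1 * u2 * (x1^-1 * x3 - x1^-1 * x1) by ring.
have -> : x1^-1 ^+ 2 * (u1 * (x2 - x3)) =
  x1^-1 * u1 * (x1^-1 * x2 - x1^-1 * x3) by ring.
move: (x1^-1 * x1) (x1^-1 * x2) (x1^-1 * x3) (x1^-1 * u1) (x1^-1 * u2) (x1^-1 * u3).
clear - critg nsg => a f p v1 v2 v3 p1 f1 ->.
wlog fp : f p v1 v2 v3 p1 f1 / f <= p.
  move=> W e3 e2 e1 gx; have [fp|/ltW pf] := leP f p; first exact: (W f p v1 v2 v3).
  by apply: (W p f (- v1) (- v3) (- v2)) => //;
    [lra|lra|lra|exact: srep_swap23].
move=> e3 e2 e1 gx.
(* The removed segment f = -1, p < 0 repeats the half with p > 0: a change of sign and an exchange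
   of the first two eigenvalues turn (1, -1, p) into (1, -1, -p). *)
have [[f0 p0]|h] := pselect (f = -1 /\ p < 0).
  rewrite f0 in e1 e3; have n1 : -1 != 0 :> R by rewrite oppr_eq0 oner_eq0.
  have := srep_swap (srep_scale n1 gx).
  have -> : -1 * f = 1 by rewrite f0; ring.
  have -> : -1 * 1 = -1 :> R by ring.
  move/classified_diag_ordered; apply; [split; lra|lra|lra|lra].
by apply: (classified_diag_ordered gx) => //; lra.
Qed.

Lemma classified_diag x1 x2 x3 u1 u2 u3 : srep x1 x2 x3 u1 u2 u3 ->
  commuting x1 x2 x3 u1 u2 u3 -> classified.
Proof.
move=> gx [e1 e2 e3].
have sq0 z z' : z' ^+ 2 <= z ^+ 2 -> z = 0 -> z' = 0.
  move=> h z0'; apply/eqP; rewrite -sqrf_eq0; apply/eqP; apply: le_anti.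
  by rewrite sqr_ge0 andbT (le_trans h) // z0' expr0n.
have main y1 y2 y3 v1 v2 v3 : srep y1 y2 y3 v1 v2 v3 -> commuting y1 y2 y3 v1 v2 v3 ->
    y2 ^+ 2 <= y1 ^+ 2 -> y3 ^+ 2 <= y1 ^+ 2 -> classified.
  move=> gy cy h2 h3; have [y0|/eqP y0] := pselect (y1 = 0); last first.
    exact: classified_diag_max gy cy y0 h2 h3.
  have [c1 c2 c3] := cy; exfalso; apply: nsg.
  have gm := srep_homothetic_diag gy c1 c2 c3.
  apply/(homothetic_locally_symmetric gm).
  by rewrite y0 (sq0 _ _ h2 y0) (sq0 _ _ h3 y0); apply: std_locally_symmetric; ring.
have gx1 := srep_cycle gx; have gx2 := srep_cycle gx1.
have [h12|/ltW h12] := leP (x2 ^+ 2) (x1 ^+ 2).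
  have [h13|/ltW h13] := leP (x3 ^+ 2) (x1 ^+ 2); first exact: (main _ _ _ _ _ _ gx).
  exact: (main _ _ _ _ _ _ gx2 (And3 e3 e1 e2) h13 (le_trans h12 h13)).
have [h23|/ltW h23] := leP (x3 ^+ 2) (x2 ^+ 2); first exact: (main _ _ _ _ _ _ gx1).
exact: (main _ _ _ _ _ _ gx2 (And3 e3 e1 e2) (le_trans h12 h23) h23).
Qed.

Lemma tracefree_neq x1 x2 x3 : x2 <> x3 ->
  trS x1 x2 x3 ^+ 2 != 3 * nrmS x1 x2 x3.
Proof. by move=> n; apply/eqP => /trS_sq_eq[_]. Qed.

Lemma classified4 k h : srep 1 (- (k + 1 / 2)) (k - 1 / 2) h 0 0 ->
  0 < k -> 0 < h -> classified.
Proof.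
move=> gx k0 h0; have [m [e _ [f1 _ _]]] := srep_crit gx.
rewrite /off_eq /trS /nrmS /nrmK in e f1.
have mE : m = - 2 * h ^+ 2 - 2 * k ^+ 2.
  apply: (mulfI (mulf_neq0 (lt0r_neq0 k0) (lt0r_neq0 h0))); lra.
have eq4 : eqn4 k h by rewrite /eqn4; move: e; rewrite mE; lra.
(* [eqn4] equates h^2 (4 k^2 - 3) with a positive quantity. *)
have k3 : 3 < 4 * k ^+ 2.
  have h2 : 0 < h ^+ 2 by rewrite exprn_gt0.
  have k2 : 0 < k ^+ 2 by rewrite exprn_gt0.
  move: eq4; rewrite /eqn4; move: (h ^+ 2) (k ^+ 2) h2 k2 => H K h2 k2 eq4.
  rewrite ltNge; apply/negP => k3; have : 0 < K * (4 * K + 3).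
    by apply: mulr_gt0 => //; lra.
  have : H * (4 * K - 3) <= 0 by rewrite pmulr_rle0 //; lra.
  by lra.
have par : param4 k h.
  split=> //; rewrite /range4 ltNge; apply/negP => ks.
  have s0 := sqrtr_ge0 (3 : R).
  have s2 : Num.sqrt 3 ^+ 2 = 3 :> R by rewrite sqr_sqrtr.
  by nra.
have [|tE gm] := srep_listed gx _ (metric4E k h) (crit_metric4 par).
  by apply: tracefree_neq => ?; lra.
by exists (metric4 k h); split=> //; left; do 3 right; left; exists k, h.
Qed.

Lemma classified_single x1 x2 x3 u1 : srep x1 x2 x3 u1 0 0 -> x1 + x2 + x3 = 0 ->
  u1 != 0 -> x2 != x3 -> classified.
Proof.
move=> gx T0 u0 x23; have [x0|x0] := eqVneq x1 0.
  (* When the eigenvalue on the axis of rotation vanishes, the system forces u1 = x2 or u1 = - x2;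
     cycling and dividing by - x2 gives [metric1] up to a reflection. *)
  have x3E : x3 = - x2 by lra.
  move: gx x23; rewrite {}x0 {}x3E => {T0} gx x23.
  have y0 : x2 != 0 by apply: contra_neq x23 => ->; rewrite oppr0.
  have [m [e _ [f1 _ _]]] := srep_crit gx.
  rewrite /off_eq /trS /nrmS /nrmK in e f1.
  have mE : m = - 2 * u1 ^+ 2 - 2 * x2 ^+ 2.
    apply: (mulfI (mulf_neq0 u0 y0)); lra.
  have : x2 ^+ 2 * (u1 ^+ 2 - x2 ^+ 2) = 0 by move: e; rewrite mE; lra.
  move/eqP; rewrite mulf_eq0 sqrf_eq0 (negPf y0) /= subr_eq0 eqf_sqr => u1E.
  have gx2 : srep 1 0 (-1) 0 (- x2^-1 * u1) 0.
    have b0 : - x2^-1 != 0 by rewrite oppr_eq0 invr_eq0.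
    have := srep_scale b0 (srep_cycle (srep_cycle gx)).
    by rewrite !mulr0 mulrNN mulNr mulVf.
  have {}gx2 : srep 1 0 (-1) 0 (-1) 0.
    case/orP: u1E gx2 => /eqP ->; rewrite mulNr; first by rewrite mulVf.
    by rewrite mulrN opprK mulVf // => /srep_flip; rewrite oppr0.
  have [|tE gm] := srep_listed gx2 _ metric1E crit_metric1.
    by apply: tracefree_neq => ?; lra.
  by exists metric1; split=> //; left; left.
have b0 : x1^-1 != 0 by rewrite invr_eq0.
have := srep_scale b0 gx; rewrite mulVf // !mulr0.
have : x1^-1 * x2 = - (x1^-1 * x3 + 1).
  have -> : x2 = - (x1 + x3) by lra.
  by rewrite mulrN mulrDr mulVf // [1 + _]addrC.
have : x1^-1 * x2 != x1^-1 * x3 by rewrite (inj_eq (mulfI b0)).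
have : x1^-1 * u1 != 0 by rewrite mulf_neq0.
move: (x1^-1 * x2) (x1^-1 * x3) (x1^-1 * u1).
clear gx T0 x23 u0 x0 b0 => a p h h0 ap aE; rewrite {}aE in ap *.
(* The eigenvalues p and - (p + 1) are symmetric about -1/2. With k measuring the distance from it,
   exchanging them is the change of sign of k. *)
have -> : - (p + 1) = - ((p + 1 / 2) + 1 / 2) by lra.
have pE : p = (p + 1 / 2) - 1 / 2 by lra.
have : p + 1 / 2 != 0 by apply: contra_neq ap; lra.
rewrite [X in srep _ _ X](pE); move: (p + 1 / 2) => k; clear ap pE p.
wlog k0 : k h h0 / 0 < k.
  move=> W kn gx; have [k0|k0] := ltP 0 k; first exact: (W k h).
  apply: (W (- k) (- h)); rewrite ?oppr_eq0 //; first by rewrite oppr_gt0 lt_neqAle kn.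
  have := srep_swap23 gx; rewrite oppr0.
  have -> : - (- k + 1 / 2) = k - 1 / 2 by ring.
  by have -> : - k - 1 / 2 = - (k + 1 / 2) by ring.
move=> _; wlog h1 : h h0 / 0 < h.
  move=> W gx; have [h1|h1] := ltP 0 h; first exact: (W h).
  apply: (W (- h)); rewrite ?oppr_eq0 //; first by rewrite oppr_gt0 lt_neqAle h0.
  by have := srep_flip2 gx; rewrite oppr0.
by move=> gx; exact: classified4 gx k0 h1.
Qed.

(** After division by h and c, the off-diagonal equations and the first equation are linear in m, U
    = h^2 and V = c^2. Eliminating m leaves a system in U and V with determinant 3 (p + 2) q
    [den5 p], where [D0] is the part cancelled after Cramer's rule. The value p = -2 is that of a
    double eigenvalue. *)
Lemma double_eqs p h c : srep 1 (- (p + 1)) p h (- c) 0 -> h != 0 -> c != 0 ->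
  p != - 2 -> c ^+ 2 * den5 p = numc5 p /\ h ^+ 2 * den5 p = numh5 p.
Proof.
move=> gx h0 c0 p2; have [m [e _ [f1 f2 _]]] := srep_crit gx.
rewrite /off_eq /trS /nrmS /nrmK in e f1 f2.
pose q := p ^+ 2 + p + 1.
have q0 : q != 0.
  by rewrite gt_eqF //; have := sqr_ge0 (p + 1 / 2); rewrite /q !expr2 => ?; lra.
have D0 : 3 * (p + 2) * q != 0.
  by rewrite !mulf_neq0 // ?addr_eq0 // pnatr_eq0.
set V := c ^+ 2; set U := h ^+ 2.
have E : m * q = - U * (2 * p + 1) ^+ 2 - V * (p - 1) ^+ 2.
  by rewrite /q /U /V; lra.
have F1 : V * (5 * p - 2) + 4 * U * (2 * p + 1) + (2 * p + 1) ^+ 3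
    + 2 * m * (2 * p + 1) = 0.
  by apply: (mulfI h0); rewrite mulr0 /U /V; lra.
have F2 : U * (7 * p + 2) + 4 * V * (p - 1) + (p - 1) ^+ 3 + 2 * m * (p - 1) = 0.
  by apply: (mulfI c0); rewrite mulr0 /U /V; lra.
pose a11 := 2 * (2 * p + 1) * (2 * p ^+ 2 + 2 * p - 1).
pose a12 := - p ^+ 3 - 9 * p ^+ 2 - 3 * p + 4.
pose a21 := - p ^+ 3 + 9 * p ^+ 2 + 15 * p + 4.
pose a22 := 2 * (p - 1) * (p ^+ 2 + 4 * p + 1).
have A1 : a11 * U + a12 * V - (2 * p + 1) ^+ 3 * q = 0.
  have -> : a11 * U + a12 * V - (2 * p + 1) ^+ 3 * q =
    - q * (V * (5 * p - 2) + 4 * U * (2 * p + 1) + (2 * p + 1) ^+ 3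
    + 2 * m * (2 * p + 1)) + 2 * (2 * p + 1) * (m * q -
      (- U * (2 * p + 1) ^+ 2 - V * (p - 1) ^+ 2)).
    by rewrite /a11 /a12 /q; ring.
  by rewrite F1 E; ring.
have A2 : a21 * U + a22 * V + (p - 1) ^+ 3 * q = 0.
  have -> : a21 * U + a22 * V + (p - 1) ^+ 3 * q =
    q * (U * (7 * p + 2) + 4 * V * (p - 1) + (p - 1) ^+ 3 + 2 * m * (p - 1))
    - 2 * (p - 1) * (m * q - (- U * (2 * p + 1) ^+ 2 - V * (p - 1) ^+ 2)).
    by rewrite /a21 /a22 /q; ring.
  by rewrite F2 E; ring.
split; apply/eqP; rewrite -subr_eq0; apply/eqP; apply: (mulfI D0); rewrite mulr0.
  rewrite -[RHS](_ : a11 * (a21 * U + a22 * V + (p - 1) ^+ 3 * q)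
    - a21 * (a11 * U + a12 * V - (2 * p + 1) ^+ 3 * q) = 0).
    by rewrite /den5 /numc5 /cubic5 /a11 /a21 /a12 /a22 /q; ring.
  by rewrite A1 A2; ring.
rewrite -[RHS](_ : a22 * (a11 * U + a12 * V - (2 * p + 1) ^+ 3 * q)
  - a12 * (a21 * U + a22 * V + (p - 1) ^+ 3 * q) = 0).
  by rewrite /den5 /numh5 /a11 /a21 /a12 /a22 /q; ring.
by rewrite A1 A2; ring.
Qed.

Lemma positive_wlog x1 x2 x3 h c : srep x1 x2 x3 h (- c) 0 -> h != 0 -> c != 0 ->
  exists h' c', [/\ 0 < h', 0 < c' & srep x1 x2 x3 h' (- c') 0].
Proof.
move=> gx h0 c0.
have [c' [c1 {}gx]] : exists c', 0 < c' /\ srep x1 x2 x3 h (- c') 0.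
  have [c1|c1] := ltP 0 c; first by exists c.
  exists (- c); rewrite oppr_gt0 lt_neqAle c0; split=> //.
  by have := srep_flip gx; rewrite oppr0.
have [h1|h1] := ltP 0 h; first by exists h, c'.
exists (- h), c'; rewrite oppr_gt0 lt_neqAle h0; split=> //.
by have := srep_flip2 gx; rewrite oppr0.
Qed.

Lemma classified_double_std p h c : srep 1 (- (p + 1)) p h (- c) 0 ->
  h != 0 -> c != 0 -> -2 < p <= 0 -> classified.
Proof.
move=> gx h0 c0 /andP[p2 p0].
have [h' [c' [h1 c1 {}gx]]] := positive_wlog gx h0 c0; clear h0 c0 h c.
have p2' : p != -2 by rewrite gt_eqF.
have [ec eh] := double_eqs gx (lt0r_neq0 h1) (lt0r_neq0 c1) p2'.
have d0 := den5_neq0 p2' ec.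
have d2 : 0 < den5 p ^+ 2 by rewrite exprn_even_gt0.
have sc : 0 < den5 p * numc5 p.
  by rewrite -ec mulrCA -expr2 mulr_gt0 // exprn_gt0.
have sh : 0 < den5 p * numh5 p.
  by rewrite -eh mulrCA -expr2 mulr_gt0 // exprn_gt0.
have Tn : trS 1 (- (p + 1)) p ^+ 2 != 3 * nrmS 1 (- (p + 1)) p.
  by apply/eqP => /trS_sq_eq[? ?]; lra.
(* At p = 0 both equations reduce to a square equal to 1/2, which is [metric2]. *)
have [pz|pn] := eqVneq p 0.
  have sq x : 0 < x -> x ^+ 2 = 1 / 2 -> x = 1 / Num.sqrt 2.
    move=> x0 x2; apply/eqP; rewrite -(eqrXn2 (n := 2)) ?ltW ?divr_gt0 ?sqrtr_gt0 //.
    by rewrite x2 expr_div_n sqr_sqrtr // expr1n.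
  move: gx ec eh Tn; rewrite pz /den5 /numc5 /numh5 /cubic5 => gx ec eh Tn.
  have hE : h' = 1 / Num.sqrt 2 by apply: sq => //; lra.
  have cE : c' = 1 / Num.sqrt 2 by apply: sq => //; lra.
  move: gx Tn; rewrite hE cE add0r => gx Tn.
  have [tE gm] := srep_listed gx Tn metric2E crit_metric2.
  by exists metric2; split=> //; left; right; left.
have par : param5 p c' h'.
  split; last by split; split=> //; [exact/eqn5cE|exact/eqn5hE].
  apply: range5P => //; first by rewrite p2 lt_neqAle pn.
  by apply/eqP => pE; move: sh; rewrite pE /numh5; lra.
have [tE gm] := srep_listed gx Tn (metric5E p c' h') (crit_metric5 par).
by exists (metric5 p c' h'); split=> //; left; do 4 right; exists p, c', h'.
Qed.

Lemma classified_double x1 x2 x3 u1 u2 : srep x1 x2 x3 u1 u2 0 -> x1 + x2 + x3 = 0 ->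
  u1 != 0 -> u2 != 0 -> classified.
Proof.
wlog x0 : x1 x2 x3 u1 u2 / x1 != 0.
  move=> W gx T0 u10 u20; have [xz|x0] := eqVneq x1 0; last exact: (W x1 x2 x3 u1 u2).
  have [xz2|x20] := eqVneq x2 0.
    apply: (classified_diag gx); rewrite xz2 xz in T0 *.
    by have -> : x3 = 0; [lra|split; ring].
  have := srep_swap gx; rewrite oppr0 => gx'.
  by apply: (W _ _ _ _ _ _ gx'); rewrite ?oppr_eq0 //; lra.
move=> gx T0 u10 u20.
(* Here a rotation in the plane of the double eigenvalue turns (u1, u2) into (r, 0), so only one
   skew entry remains. *)
have [xe|xn] := eqVneq x1 x2.
  rewrite -xe in gx T0.
  pose r := Num.sqrt (u1 ^+ 2 + u2 ^+ 2).
  have s0 : 0 < u1 ^+ 2 + u2 ^+ 2 by rewrite ltr_wpDl ?sqr_ge0 // exprn_even_gt0.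
  have r0 : r != 0 by rewrite gt_eqF // sqrtr_gt0.
  have r2 : u1 ^+ 2 + u2 ^+ 2 = r ^+ 2 by rewrite sqr_sqrtr // ltW.
  have := @srep_rotate _ _ _ _ _ _ _ (u1 / r) (u2 / r) _ gx.
  have -> : u1 / r * u2 - u2 / r * u1 = 0 by field.
  have -> : u1 / r * u1 + u2 / r * u2 = r.
    by apply: (mulIf r0); rewrite -[in RHS]expr2 -r2; field.
  move=> rot; apply: (classified_single (rot _)) => //.
    by rewrite !expr_div_n -mulrDl r2 divff // expf_neq0.
  by apply: contra_neq x0; lra.
have b0 : x1^-1 != 0 by rewrite invr_eq0.
have := srep_scale b0 gx; rewrite mulVf // !mulr0.
have -> : x1^-1 * x2 = - (x1^-1 * x3 + 1).
  have -> : x2 = - (x1 + x3) by lra.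
  by rewrite mulrN mulrDr mulVf // [1 + _]addrC.
have p2 : x1^-1 * x3 != -2.
  apply: contra_neq xn => e; have -> : x2 = - (x1 + x3) by lra.
  have -> : x3 = x1 * (x1^-1 * x3) by rewrite mulVKf.
  by rewrite e; ring.
have : x1^-1 * u1 != 0 by rewrite mulf_neq0.
have : x1^-1 * u2 != 0 by rewrite mulf_neq0.
move: p2; move: (x1^-1 * x3) (x1^-1 * u1) (x1^-1 * u2) => p h c p2 c0 h0 {}gx.
rewrite -[c]opprK in gx.
have c0' : - c != 0 by rewrite oppr_eq0.
have [pI|pI] := boolP (-2 < p <= 0); first exact: classified_double_std gx h0 c0' pI.
(* Exchanging the first two eigenvalues and rescaling replaces p by - p / (p + 1), which sends both
   remaining half-lines into (-2, 0). *)
have pI' : p < -2 \/ 0 < p.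
  move: pI; rewrite negb_and -leNgt -ltNge le_eqVlt (negPf p2) /=.
  by move=> /orP[]; [left|right].
have q0 : - (p + 1) != 0 by apply/eqP => ?; case: pI'; lra.
have q0' : p + 1 != 0 by rewrite -oppr_eq0.
have b1 : (- (p + 1))^-1 != 0 by rewrite invr_eq0.
have := srep_scale b1 (srep_swap gx).
rewrite mulVf // oppr0 mulr0 mulr1 !opprK.
have {1}-> : (- (p + 1))^-1 = - ((- (p + 1))^-1 * p + 1).
  by rewrite invrN; field.
rewrite [_ * - h]mulrN; move/classified_double_std; apply; rewrite ?mulf_neq0 //.
have -> : (- (p + 1))^-1 * p = (p + 1)^-1 - 1 by rewrite invrN; field.
have e : (p + 1) * (p + 1)^-1 = 1 by rewrite divff.
case: pI' => pI'.
  have i0 : (p + 1)^-1 < 0 by rewrite invr_lt0; lra.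
  by have : 0 < (p + 2) * (p + 1)^-1; [rewrite nmulr_lgt0 //|]; lra.
have i0 : 0 < (p + 1)^-1 by rewrite invr_gt0; lra.
by have : 0 < p * (p + 1)^-1; [rewrite mulr_gt0|]; lra.
Qed.

Lemma classified_tracefree x1 x2 x3 u1 u2 u3 : srep x1 x2 x3 u1 u2 u3 ->
  x1 + x2 + x3 = 0 -> classified.
Proof.
move=> gx T0.
have two y1 y2 y3 v1 v2 : srep y1 y2 y3 v1 v2 0 -> y1 + y2 + y3 = 0 -> classified.
  move=> gy S0; have [v10|v10] := eqVneq v1 0.
    have [e|e] := eqVneq y3 y1.
      by apply: (classified_diag gy); rewrite v10 e; split; ring.
    have [v20|v20] := eqVneq v2 0.
      by apply: (classified_diag gy); rewrite v10 v20; split; ring.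
    have := srep_cycle gy; rewrite v10 => gy'.
    by apply: (classified_single gy') => //; lra.
  have [v20|v20] := eqVneq v2 0; last exact: classified_double gy S0 v10 v20.
  have [e|e] := eqVneq y2 y3.
    by apply: (classified_diag gy); rewrite v20 e; split; ring.
  by rewrite v20 in gy; exact: classified_single gy S0 v10 e.
have [m [_ [d1 d2 d3] _]] := srep_crit gx.
rewrite /diag_eq /trS T0 in d1 d2 d3.
have gx1 := srep_cycle gx; have gx2 := srep_cycle gx1.
(* For T = 0 the diagonal equations are 3 w d_i = 0, so a non-zero w makes all eigenvalues equal,
   and then S commutes with A. *)
have [w0|w0] := eqVneq (u1 * u2 * u3) 0; last first.
  have w30 : 3 * (u1 * u2 * u3) != 0 by rewrite mulf_neq0 // pnatr_eq0.
  have e1 : x2 - x3 = 0 by apply: (mulfI w30); lra.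
  have e2 : x3 - x1 = 0 by apply: (mulfI w30); lra.
  have e3 : x1 - x2 = 0 by apply: (mulfI w30); lra.
  by apply: (classified_diag gx); rewrite /commuting e1 e2 e3 !mulr0.
move/eqP: w0; rewrite !mulf_eq0 -orbA => /or3P[] /eqP u0; rewrite u0 in gx gx1 gx2.
- by apply: two gx1 _; lra.
- by apply: two gx2 _; lra.
- by apply: two gx _; lra.
Qed.

Lemma sum6_sqr_eq0 (a1 a2 a3 b1 b2 b3 k : R) : 0 < k ->
  a1 ^+ 2 + a2 ^+ 2 + a3 ^+ 2 + k * (b1 ^+ 2 + b2 ^+ 2 + b3 ^+ 2) = 0 ->
  [/\ a1 = 0, a2 = 0 & a3 = 0] /\ [/\ b1 = 0, b2 = 0 & b3 = 0].
Proof.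
move=> k0 e.
have s1 := sqr_ge0 a1; have s2 := sqr_ge0 a2; have s3 := sqr_ge0 a3.
have r1 := mulr_ge0 (ltW k0) (sqr_ge0 b1); have r2 := mulr_ge0 (ltW k0) (sqr_ge0 b2).
have r3 := mulr_ge0 (ltW k0) (sqr_ge0 b3).
have z (a : R) : a ^+ 2 = 0 -> a = 0 by move/eqP; rewrite sqrf_eq0 => /eqP.
have kz (a : R) : k * a = 0 -> a = 0.
  by move/eqP; rewrite mulf_eq0 (gt_eqF k0) => /eqP.
by split; split; apply: z; first [lra|apply: kz; lra].
Qed.

(* With [S0] the trace-free part of [S] and [L = [A, [A, S]]], pairing the
   equations with [L] gives [|L - m S0|^2 = 0]: the only other term,
   [<L, [S, [S, [A, S]]]>], is a multiple of [sum_i x_i (x_j - x_l)^3 = 0]. *)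
Lemma crit_sys_pairing m x1 x2 x3 u1 u2 u3 :
  let T := trS x1 x2 x3 in T != 0 -> crit_sys m x1 x2 x3 u1 u2 u3 ->
  [/\ 2 * (u2 ^+ 2 * (x3 - x1) - u3 ^+ 2 * (x1 - x2)) = m * (x1 - T / 3),
      2 * (u3 ^+ 2 * (x1 - x2) - u1 ^+ 2 * (x2 - x3)) = m * (x2 - T / 3) &
      2 * (u1 ^+ 2 * (x2 - x3) - u2 ^+ 2 * (x3 - x1)) = m * (x3 - T / 3)] /\
  [/\ u2 * u3 * (x1 - T / 3) = 0, u3 * u1 * (x2 - T / 3) = 0 &
      u1 * u2 * (x3 - T / 3) = 0].
Proof.
move=> T T0 [].
set y1 := x1 - T / 3; set y2 := x2 - T / 3; set y3 := x3 - T / 3.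
have y3E : y3 = - y1 - y2 by rewrite /y1 /y2 /y3 /T /trS; field.
have e1 : x1 = y1 + T / 3 by rewrite /y1; ring.
have e2 : x2 = y2 + T / 3 by rewrite /y2; ring.
have e3 : x3 = - y1 - y2 + T / 3 by rewrite -y3E /y3; ring.
rewrite /nrmK /off_eq /diag_eq -/T.
have -> : T ^+ 2 - 3 * nrmS x1 x2 x3 = - 6 * (y1 ^+ 2 + y1 * y2 + y2 ^+ 2).
  by rewrite /nrmS e1 e2 e3; field.
move: y3E e1 e2 e3; move: y1 y2 y3 => y1 y2 y3 -> -> -> ->.
move: T T0; clear x1 x2 x3 => T T0 E [D1 D2 D3] [F1 F2 F3].
set P1 := u2 ^+ 2 * _ - _; set P2 := u3 ^+ 2 * _ - _; set P3 := u1 ^+ 2 * _ - _.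
(* These are the entries of L - m S0: the diagonal of L is 2 P_i and its off-diagonal entries are -3
   u_j u_l y_i. Each of the latter occurs twice in the norm, whence the weight 18. *)
have [] := @sum6_sqr_eq0 (2 * P1 - m * y1) (2 * P2 - m * y2)
    (2 * P3 - m * (- y1 - y2)) (u2 * u3 * y1) (u3 * u1 * y2)
    (u1 * u2 * (- y1 - y2)) 18; rewrite ?ltr0n //; last first.
  by move=> [q1 q2 q3] [b1 b2 b3]; split; split=> //; lra.
apply: (mulfI T0); rewrite mulr0.
move: E D1 D2 D3 F1 F2 F3.
have sub0 (a b : R) : a = b -> a - b = 0 by move=> ->; rewrite subrr.
move=> /sub0 E /sub0 D1 /sub0 D2 /sub0 D3 /sub0 F1 /sub0 F2 /sub0 F3.
set f3 := (X in X = 0) in F3; set f2 := (X in X = 0) in F2.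
set f1 := (X in X = 0) in F1; set d3 := (X in X = 0) in D3.
set d2 := (X in X = 0) in D2; set d1 := (X in X = 0) in D1.
set e0 := (X in X = 0) in E.
(* The weights 2 P_i and -3 u_j u_l y_i are the entries of L, so this is the pairing with L; the
   multiple of the first equation accounts for the square of m S0. The result is T times the sum of
   squares. *)
rewrite -[RHS](_ : 2 * (P1 * d1 + P2 * d2 + P3 * d3)
  - 3 * (u2 * u3 * y1 * f1 + u3 * u1 * y2 * f2 + u1 * u2 * (- y1 - y2) * f3)
  - T * m * e0 / 3 = 0).
  by rewrite /P1 /P2 /P3 /d1 /d2 /d3 /f1 /f2 /f3 /e0; field.
by rewrite E D1 D2 D3 F1 F2 F3; ring.
Qed.

Lemma classified6 f h : srep (1 / 3) f (- (f - 2 / 3)) h 0 0 -> f != 1 / 3 -> h != 0 ->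
  classified.
Proof.
wlog h0 : h / 0 < h.
  move=> W gx fn hn; have [h0|h0] := ltP 0 h; first exact: (W h).
  apply: (W (- h)); rewrite ?oppr_eq0 //; first by rewrite oppr_gt0 lt_neqAle hn.
  by have := srep_flip2 gx; rewrite oppr0.
(* The two eigenvalues f and 2/3 - f are symmetric about 1/3; exchanging them reflects f. *)
wlog f0 : f / 1 / 3 < f.
  move=> W gx fn hn; have [f0|f0] := ltP (1 / 3) f; first exact: (W f).
  apply: (W (- (f - 2 / 3))) => //; last by apply: contra_neq fn; lra.
    by move: f0; rewrite le_eqVlt (negPf fn) /=; lra.
  have := srep_flip2 (srep_swap23 gx); rewrite !oppr0 opprK.
  by have -> : - (- (f - 2 / 3) - 2 / 3) = f by ring.
move=> gx fn hn; have [m [e _ [f1 _ _]]] := srep_crit gx.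
rewrite /off_eq /trS /nrmS /nrmK in e f1.
have z0 : f - 1 / 3 != 0 by rewrite subr_eq0.
have mE : m = - 4 * h ^+ 2 by apply: (mulfI (expf_neq0 2 z0)); lra.
have e6 : eqn6 h f.
  by rewrite /eqn6; apply: (mulfI (mulf_neq0 hn z0)); move: f1; rewrite mE; lra.
have par : param6 h f by split=> //; split=> //; lra.
have [|tE gm] := srep_listed gx _ (metric6E h f) (crit_metric6 par).
  by apply: tracefree_neq => ?; lra.
by exists (metric6 h f); split=> //; right; left; exists h, f.
Qed.

Lemma classified7 a b : srep a (1 / 3) (- (a - 2 / 3)) b 0 b -> a != 1 / 3 -> b != 0 ->
  classified.
Proof.
wlog b0 : b / 0 < b.
  move=> W gx an bn; have [b0|b0] := ltP 0 b; first exact: (W b).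
  apply: (W (- b)); rewrite ?oppr_eq0 //; first by rewrite oppr_gt0 lt_neqAle bn.
  exact: srep_flip2 gx.
wlog a0 : a / 1 / 3 < a.
  move=> W gx an bn; have [a0|a0] := ltP (1 / 3) a; first exact: (W a).
  apply: (W (- (a - 2 / 3))) => //; last by apply: contra_neq an; lra.
    by move: a0; rewrite le_eqVlt (negPf an) /=; lra.
  have := srep_flip2 (srep_cycle (srep_cycle (srep_swap gx))); rewrite !oppr0 opprK.
  by have -> : - (- (a - 2 / 3) - 2 / 3) = a by ring.
move=> gx an bn; have [m [e _ [f1 _ _]]] := srep_crit gx.
rewrite /off_eq /trS /nrmS /nrmK in e f1.
have z0 : a - 1 / 3 != 0 by rewrite subr_eq0.
have mE : m = - 2 * b ^+ 2 by apply: (mulfI (expf_neq0 2 z0)); lra.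
have e7 : eqn7 b a.
  by rewrite /eqn7; apply: (mulfI (mulf_neq0 bn z0)); move: f1; rewrite mE; lra.
have par : param7 b a by split=> //; split=> //; lra.
have [|tE gm] := srep_listed gx _ (metric7E b a) (crit_metric7 par).
  by apply: tracefree_neq => ?; lra.
by exists (metric7 b a); split=> //; right; right; exists b, a.
Qed.

Lemma srep_pairing x1 x2 x3 u1 u2 u3 : srep x1 x2 x3 u1 u2 u3 -> x1 + x2 + x3 = 1 ->
  exists m,
  [/\ 2 * (u2 ^+ 2 * (x3 - x1) - u3 ^+ 2 * (x1 - x2)) = m * (x1 - 1 / 3),
      2 * (u3 ^+ 2 * (x1 - x2) - u1 ^+ 2 * (x2 - x3)) = m * (x2 - 1 / 3) &
      2 * (u1 ^+ 2 * (x2 - x3) - u2 ^+ 2 * (x3 - x1)) = m * (x3 - 1 / 3)] /\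
  [/\ u2 * u3 * (x1 - 1 / 3) = 0, u3 * u1 * (x2 - 1 / 3) = 0 &
      u1 * u2 * (x3 - 1 / 3) = 0].
Proof.
move=> gx T1; have [m cs] := srep_crit gx; exists m.
by have := crit_sys_pairing _ cs; rewrite /trS T1; apply; exact: oner_neq0.
Qed.

(** The vanishing products leave two possibilities when x1 <> 1/3. Either u1 = u3 = 0, which is type
    (6), or u2 = 0; then the sum of the first and third diagonal relations gives u1^2 = u3^2, which
    is type (7). *)
Lemma classified_middle x1 x3 u1 u2 u3 : srep x1 (1 / 3) x3 u1 u2 u3 ->
  x1 + x3 = 2 / 3 -> classified.
Proof.
move=> gx T1; have x3E : x3 = - (x1 - 2 / 3) by lra.
rewrite {}x3E {T1} in gx.
have S1 : x1 + 1 / 3 - (x1 - 2 / 3) = 1 by field.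
have [m [[p1 _ p3] [q1 _ q3]]] := srep_pairing gx S1.
have [y0|y0] := eqVneq x1 (1 / 3).
  by apply: (classified_diag gx); rewrite y0; split; field.
have z0 : x1 - 1 / 3 != 0 by rewrite subr_eq0.
have u13 : u3 ^+ 2 = u1 ^+ 2 by apply: (mulfI z0); lra.
have [u20|u20] := eqVneq u2 0.
  have [u10|u10] := eqVneq u1 0.
    move: u13; rewrite u10 expr0n => /eqP; rewrite sqrf_eq0 => /eqP u30.
    by apply: (classified_diag gx); rewrite u10 u20 u30; split; ring.
  move/eqP: u13; rewrite eqf_sqr => /orP[] /eqP uE; rewrite u20 uE in gx.
    exact: classified7 gx y0 u10.
  by have := srep_flip gx; rewrite oppr0 opprK => {}gx; exact: classified7 gx y0 u10.
have u30 : u3 = 0 by apply: (mulfI (mulf_neq0 u20 z0)); lra.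
have u10 : u1 = 0 by apply: (mulfI (mulf_neq0 u20 z0)); lra.
have := srep_swap23 (srep_cycle gx); rewrite u10 u30 oppr0.
by move/classified6; apply; rewrite ?oppr_eq0.
Qed.

(** The first diagonal relation has zero left-hand side, so x1 <> 1/3 forces m = 0, and the second
    one then makes S and A commute. *)
Lemma classified_one x1 x2 x3 u1 : srep x1 x2 x3 u1 0 0 -> x1 + x2 + x3 = 1 ->
  x1 != 1 / 3 -> classified.
Proof.
move=> gx T1 x10; have [m [[p1 p2 _] _]] := srep_pairing gx T1.
have z0 : x1 - 1 / 3 != 0 by rewrite subr_eq0.
have m0 : m = 0 by apply: (mulfI z0); lra.
have : u1 * (u1 * (x2 - x3)) = 0 by move: p2; rewrite m0; lra.
move/eqP; rewrite mulf_eq0 => /orP[] /eqP u0; apply: (classified_diag gx).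
  by rewrite u0; split; ring.
by split=> //; ring.
Qed.

(** If no eigenvalue is the mean 1/3, all products u_j u_l vanish, so at most one u_i survives. *)
Lemma classified_trace1 x1 x2 x3 u1 u2 u3 : srep x1 x2 x3 u1 u2 u3 ->
  x1 + x2 + x3 = 1 -> classified.
Proof.
move=> gx T1; have gx1 := srep_cycle gx; have gx2 := srep_cycle gx1.
have [x10|x10] := eqVneq x1 (1 / 3).
  by rewrite x10 in gx2; apply: (classified_middle gx2); lra.
have [x20|x20] := eqVneq x2 (1 / 3).
  by rewrite x20 in gx; apply: (classified_middle gx); lra.
have [x30|x30] := eqVneq x3 (1 / 3).
  by rewrite x30 in gx1; apply: (classified_middle gx1); lra.
have [m [_ [q1 q2 q3]]] := srep_pairing gx T1.
have z a b : a * (b - 1 / 3) = 0 -> b != 1 / 3 -> a = 0.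
  by move=> /eqP + bn; rewrite mulf_eq0 subr_eq0 (negPf bn) orbF => /eqP.
have {q1} /eqP := z _ _ q1 x10; have {q2} /eqP := z _ _ q2 x20.
have {q3} /eqP := z _ _ q3 x30; rewrite !mulf_eq0.
have [u10|u10] /= := eqVneq u1 0; last first.
  move=> /eqP u20; rewrite orbF => /eqP u30 _; rewrite u20 u30 in gx.
  exact: classified_one gx T1 x10.
have [u20|u20] /= := eqVneq u2 0; last first.
  move=> _ _ /eqP u30; rewrite u10 u30 in gx1.
  by apply: (classified_one gx1); lra.
by move=> _ _ _; rewrite u10 u20 in gx2; apply: (classified_one gx2); lra.
Qed.

Lemma critical_classified : classified.
Proof.
have [x1 [x2 [x3 [u1 [u2 [u3 gx]]]]]] := srep_exists g.
have [T0|T0] := eqVneq (x1 + x2 + x3) 0; first exact: classified_tracefree gx T0.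
have b0 : (x1 + x2 + x3)^-1 != 0 by rewrite invr_eq0.
by apply: (classified_trace1 (srep_scale b0 gx)); rewrite -!mulrDr mulVf.
Qed.

End Classification.

Lemma listed_a_crit (R : realType) t (g : left_inv_metric R) :
  listed_a t g -> crit_with t g 0.
Proof.
case=> [[-> ->]|[[-> ->]|[[f [p [fp -> ->]]]|[[k [h [kh -> ->]]]|[p [c [h [pch -> ->]]]]]]]].
- exact: crit_metric1.
- exact: crit_metric2.
- exact: crit_metric3.
- exact: crit_metric4.
- exact: crit_metric5.
Qed.

Lemma listed_b_crit (R : realType) t (g : left_inv_metric R) :
  listed_b t g -> critical g t /\ energy g t <> 0.
Proof.
have sq (x : R) : 0 < x -> 0 < x ^+ 2 by move=> x0; rewrite exprn_gt0.
case=> [[h [f [hf -> ->]]]|[b [a [ba -> ->]]]].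
  have [cg ->] := crit_metric6 hf; split=> //.
  by have := sq _ hf.1; lra.
have [cg ->] := crit_metric7 ba; split=> //.
by have := sq _ ba.1; lra.
Qed.

Theorem theorem5p3 (R : realType) :
  (* the classification *)
  (forall (g : left_inv_metric R) (t : R), ~ locally_symmetric g ->
     (critical g t <->
        (energy g t = 0 /\ exists g', listed_a t g' /\ homothetic g g') \/
        (energy g t <> 0 /\ exists g', listed_b t g' /\ homothetic g g')))
  /\
  (* the energies of the listed metrics *)
  ((forall t (g : left_inv_metric R), listed_a t g -> energy g t = 0) /\
   (forall h f : R, param6 h f ->
      energy (metric6 h f) (t6 h) = - (16 / 3) * h ^+ 2) /\
   (forall b a : R, param7 b a ->
      energy (metric7 b a) (t7 b) = - (8 / 3) * b ^+ 2))
  /\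
  (* the parameters are well defined *)
  ((forall k : R, range4 k -> exists! h : R, 0 < h /\ eqn4 k h) /\
   (exists! zeta : R, cubic5 zeta = 0) /\
   (forall zeta : R, cubic5 zeta = 0 ->
      - (1 + 697 / 10 ^+ 3 + 465 / 10 ^+ 6) < zeta
      /\ zeta < - (1 + 697 / 10 ^+ 3 + 464 / 10 ^+ 6)) /\
   (forall p : R, range5 p ->
      (exists! c : R, 0 < c /\ eqn5c p c) /\
      (exists! h : R, 0 < h /\ eqn5h p h)) /\
   (forall h : R, 0 < h -> exists! f : R, 0 < f /\ eqn6 h f) /\
   (forall b : R, 0 < b -> exists! a : R, 0 < a /\ eqn7 b a))
  /\
  (* algebraic Ricci solitons *)
  ((forall t (g : left_inv_metric R),
      listed1 t g \/ listed2 t g \/ listed3 t g -> algebraic_soliton g) /\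
   (forall t (g : left_inv_metric R),
      listed4 t g \/ listed5 t g \/ listed6 t g \/ listed7 t g ->
      ~ algebraic_soliton g)).
Proof.
split; [|split; [|split]].
(* Vanishing of the energy is invariant under homotheties, so the listed metric decides which of the
   two alternatives g falls into. *)
- move=> g t ns; split.
    move=> cg; have [g' [[la|lb] gg']] := critical_classified cg ns.
      left; split; last by exists g'.
      by apply/(homothetic_energy0 t gg'); have [] := listed_a_crit la.
    right; split; last by exists g'.
    by move/(homothetic_energy0 t gg'); have [] := listed_b_crit lb.
  by case=> -[_ [g' [l gg']]]; apply/(homothetic_critical t gg');
    [have [] := listed_a_crit l|have [] := listed_b_crit l].
- split; first by move=> t g /listed_a_crit[].
  by split=> [h f /crit_metric6[]|b a /crit_metric7[]].
- split; first exact: eqn4_exuniq.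
  split; first exact: cubic5_exuniq.
  split; first exact: cubic5_root_bounds.
  split; first exact: eqn5_exuniq.
  by split; [exact: eqn6_exuniq|exact: eqn7_exuniq].
- split=> t g.
    case=> [[_ ->]|[[_ ->]|[f [p [_ _ ->]]]]].
    + exact: soliton1.
    + exact: soliton2.
    + exact: soliton3.
  case=> [[k [h [kh _ ->]]]|[[p [c [h [pch _ ->]]]]|[[h [f [hf _ ->]]]|[b [a [ba _ ->]]]]]].
  + exact: not_soliton4.
  + exact: not_soliton5.
  + exact: not_soliton6.
  + exact: not_soliton7.
Qed.
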